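(* Let $G$ be a contact Carnot group. Then there exists a constant $R_2$ such that, for every point $p=(x,z)\in G$ with $p\neq p_0$, $$\hat\beta(p)\le\left(\frac{8k}{\pi}\frac{\alpha_k}{\alpha_1^2}\right)\frac{|z|}{\|x\|^2}+R_2 ,$$ (with the convention $\frac{|z|}{0}=\infty$ if $x=0$, $z\ne0$), and $R_2$ is homogeneous of degree $0$ as a function of the singular values $\alpha_1<\dots<\alpha_k$ of $A$. In particular, if $x=(x_1,\dots,x_k)$ has all components $x_j$ different from zero, then $\Gamma(p)=\Gamma_0(p)$ and $$\hat\nu(p)\le\left(\frac{8k}{\pi}\frac{\alpha_k}{\alpha_1^2}\right)\frac{|z|}{\|x\|^2}+R_2 .$$
   Context: A contact Carnot group $G$ is a connected, simply connected Lie group of dimension $2n+1$ whose Lie algebra of left-invariant vector fields splits as $\mathfrak g=\mathfrak g_1\oplus\mathfrak g_2$ with $\dim\mathfrak g_2=1$, $[\mathfrak g_1,\mathfrak g_1]=\mathfrak g_2$, $[\mathfrak g_1,\mathfrak g_2]=[\mathfrak g_2,\mathfrak g_2]=0$, with a scalar product on $\mathfrak g_1$ having orthonormal basis $f_1,\dots,f_{2n}$. Fix a generator $f_0$ of $\mathfrak g_2$; then $[f_i,f_j]=A_{ij}f_0$ for a skew-symmetric non-degenerate matrix $A$. Exponential coordinates: $p=(x,z)\in\mathbb{R}^{2n}\times\mathbb{R}$ means $p=\exp_G(\sum_i x_if_i+zf_0)$; $p_0=(0,0)$. Let $0<\alpha_1<\dots<\alpha_k$ be the distinct singular values of $A$ and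 $x_j\in\mathbb{R}^{2n_j}$ the projection of $x$ on the ($2n_j$-dimensional) invariant subspace associated with $\alpha_j$. A geodesic is a non-constant Lipschitz curve $\gamma:[0,1]\to G$, tangent a.e. to $\mathfrak g_1$, locally minimizing the energy $\frac12\int_0^1\|\dot\gamma\|^2dt$. With $H(\eta)=\frac12\sum_i\langle\eta,f_i\rangle^2$ on $T^*G$, the exponential map is $\hat E(\eta)=\pi(e^{\vec H}(\eta))$, $\eta\in T_{p_0}^*G$, and $\Gamma(p)=\hat E^{-1}(p)\subset T^*_{p_0}G$ with the subspace topology is the set of geodesics from $p_0$ to $p$, each identified with its initial covector. Write $\eta=(u_1,\dots,u_k,\lambda)$, where $u=(\langle\eta,f_i\rangle)_i$, $u_j$ is its projection on the invariant subspace of $\alpha_j$, and $\lambda=\langle\eta,f_0\rangle$. Put $I_0=\{j\mid x_j=0\}$ and $\Gamma_0(p)=\{(u,\lambda)\in\Gamma(p)\mid\sum_{j\in I_0}\|u_j\|^2=0\}$. Finally $\hat\nu(p)=\#\Gamma(p)$ and $\hat\beta(p)=\sum_i\operatorname{rank}H_i(\Gamma(p);\mathbb{Z})$, with values in $\mathbb{N}\cup\{\infty\}$. *)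

(* Defs.v *)
From HB Require Import structures.
From mathcomp.multinomials Require Import freeg.
From mathcomp Require Import all_boot all_order all_algebra.
From mathcomp Require Import all_classical all_reals all_analysis.

Set Implicit Arguments.
Unset Strict Implicit.
Unset Printing Implicit Defensive.

Import Order.TTheory GRing.Theory Num.Theory.
Import numFieldNormedType.Exports.

Local Open Scope classical_set_scope.
Local Open Scope ring_scope.

Section smooth_maps.
Context {R : realType} {V W : normedModType R}.

Fixpoint Ck (m : nat) (f : V -> W) : Prop :=
  if m is m'.+1 then
    (forall x v, derivable f x v) /\ (forall v, Ck m' ('D_v f))
  else continuous f.

Definition smooth (f : V -> W) : Prop := forall m, Ck m f.

End smooth_maps.

Definition lie_bracket {R : realType} {V : normedModType R} (X Y : V -> V) (q : V) : V :=
  'D_(X q) Y q - 'D_(Y q) X q.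

Definition dotv {R : realType} {m : nat} (u v : 'rV[R]_m) : R :=
  \sum_(i < m) u 0 i * v 0 i.

Section coordinates.
Context {R : realType} {n : nat}.

Definition xpart (p : 'rV[R]_(n.*2 + 1)) : 'rV[R]_(n.*2) := lsubmx p.
Definition zpart (p : 'rV[R]_(n.*2 + 1)) : R := rsubmx p 0 0.
Definition e1 (i : 'I_n.*2) : 'rV[R]_(n.*2 + 1) := delta_mx 0 (lshift 1 i).
Definition e0 : 'rV[R]_(n.*2 + 1) := delta_mx 0 (rshift n.*2 ord0).

Definition left_field (mul : 'rV[R]_(n.*2 + 1) -> 'rV[R]_(n.*2 + 1) -> 'rV[R]_(n.*2 + 1))
    (v q : 'rV[R]_(n.*2 + 1)) : 'rV[R]_(n.*2 + 1) :=
  'D_v (mul q) 0.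

End coordinates.

(* A contact Carnot group read in exponential coordinates, which form a global
   chart: a Lie group structure on R^(2n) x R in which the point w is
   exp_G (sum_i w_i f_i), that is, in which t |-> t *: w is the one-parameter
   subgroup with velocity w at the identity ([cc_exp]).  The left-invariant
   fields with values e1 i and e0 at the identity are then f_1, ..., f_2n and
   f_0.  The scalar product on g_1 is the one for which f_1, ..., f_2n is
   orthonormal; it enters through [hamiltonian] below. *)
Record contactCarnot (R : realType) (n : nat) := ContactCarnot {
  cc_mul : 'rV[R]_(n.*2 + 1) -> 'rV[R]_(n.*2 + 1) -> 'rV[R]_(n.*2 + 1);
  cc_inv : 'rV[R]_(n.*2 + 1) -> 'rV[R]_(n.*2 + 1);
  cc_A : 'M[R]_(n.*2);
  cc_n_gt0 : (0 < n)%N;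
  cc_mulA : associative cc_mul;
  cc_mul0g : left_id 0 cc_mul;
  cc_mulg0 : right_id 0 cc_mul;
  cc_mulVg : left_inverse 0 cc_inv cc_mul;
  cc_mulgV : right_inverse 0 cc_inv cc_mul;
  cc_mul_smooth : smooth (fun pq => cc_mul pq.1 pq.2);
  cc_inv_smooth : smooth cc_inv;
  cc_exp : forall w s t, cc_mul (s *: w) (t *: w) = (s + t) *: w;
  cc_bracket11 : forall i j q,
    lie_bracket (left_field cc_mul (e1 i)) (left_field cc_mul (e1 j)) q =
      cc_A i j *: left_field cc_mul e0 q;
  cc_bracket12 : forall i q,
    lie_bracket (left_field cc_mul (e1 i)) (left_field cc_mul e0) q = 0;
  cc_A_skew : cc_A^T = - cc_A;
  cc_A_nondeg : cc_A \in unitmx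
}.

Section exponential_map.
Context {R : realType} {n : nat} (G : contactCarnot R n).

(* T^*G in canonical coordinates: (base point, covector). *)
Local Notation cotangent := ('rV[R]_(n.*2 + 1) * 'rV[R]_(n.*2 + 1))%type.

Definition frame (i : 'I_n.*2) : 'rV[R]_(n.*2 + 1) -> 'rV[R]_(n.*2 + 1) :=
  left_field (cc_mul G) (e1 i).

Definition hamiltonian (eta : cotangent) : R :=
  2^-1 * \sum_(i < n.*2) dotv eta.2 (frame i eta.1) ^+ 2.

Definition hamiltonian_field (eta : cotangent) : cotangent :=
  (\row_a 'D_(0, delta_mx 0 a) hamiltonian eta,
   \row_a - 'D_(delta_mx 0 a, 0) hamiltonian eta).

Definition integral_curve (eta0 : cotangent) (c : R -> cotangent) : Prop :=
  c 0 = eta0 /\ forall t : R, is_derive t 1 c (hamiltonian_field (c t)).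

(* The Hamiltonian field is complete and smooth, so the integral curve selected
   here exists and is unique. *)
Definition exp_map (eta : 'rV[R]_(n.*2 + 1)) : 'rV[R]_(n.*2 + 1) :=
  (get (integral_curve (0, eta)) 1).1.

Definition Gamma (p : 'rV[R]_(n.*2 + 1)) : set 'rV[R]_(n.*2 + 1) :=
  exp_map @^-1` [set p].

Definition ucoord (eta : 'rV[R]_(n.*2 + 1)) : 'rV[R]_(n.*2) :=
  \row_i dotv eta (frame i 0).

End exponential_map.

Section singular_values.
Context {R : realType} {m : nat} (A : 'M[R]_m).

Definition singular_value (s : R) : Prop :=
  0 <= s /\ eigenvalue (A^T *m A) (s ^+ 2).

Definition distinct_singular_values (k : nat) (al : k.-tuple R) : Prop :=
  sorted <%R al /\ forall s, s \in al <-> singular_value s.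

(* Orthogonal projection (acting on row vectors) on the invariant subspace of
   the singular value s; kermx V^T is the orthogonal complement of V. *)
Definition sv_proj (s : R) : 'M[R]_m :=
  let V := eigenspace (A^T *m A) (s ^+ 2) in proj_mx V (kermx V^T).

End singular_values.

Section Gamma0.
Context {R : realType} {n k : nat} (G : contactCarnot R n) (al : k.-tuple R).

Definition component (x : 'rV[R]_(n.*2)) (j : 'I_k) : 'rV[R]_(n.*2) :=
  x *m sv_proj (cc_A G) (tnth al j).

Definition Gamma0 (p : 'rV[R]_(n.*2 + 1)) : set 'rV[R]_(n.*2 + 1) :=
  Gamma G p `&` [set eta |
    \sum_(j < k | component (xpart p) j == 0)
      dotv (component (ucoord G eta) j) (component (ucoord G eta) j) = 0].

End Gamma0.

Section singular_homology.
Context {R : realType}.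

Definition std_simplex (m : nat) : set 'rV[R]_m.+1 :=
  [set t | (forall i, 0 <= t 0 i) /\ \sum_i t 0 i = 1].
Arguments std_simplex : clear implicits.

(* Inserts a zero at position i. *)
Definition face_fun (m : nat) (i : 'I_m.+2) (t : 'rV[R]_m.+1) : 'rV[R]_m.+2 :=
  \row_j if unlift i j is Some j' then t 0 j' else 0.

Lemma face_fun_simplex m (i : 'I_m.+2) (t : 'rV[R]_m.+1) :
  std_simplex m t -> std_simplex m.+1 (face_fun i t).
Proof.
move=> [t_ge0 t1]; split=> [j|].
  by rewrite mxE; case: unlift.
rewrite (bigD1_ord i) //= mxE unlift_none add0r -[RHS]t1.
by apply: eq_bigr => j _; rewrite mxE liftK.
Qed.

Definition face (m : nat) (i : 'I_m.+2) (t : std_simplex m) : std_simplex m.+1 :=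
  SigSub (mem_set (face_fun_simplex i (set_valP t))).

Lemma face_fun_continuous m (i : 'I_m.+2) : continuous (@face_fun m i).
Proof.
move=> t U [P Pt PU]; exists (fun a j => P a (lift i j)).
  by move=> a j; have := Pt a (lift i j); rewrite mxE liftK ord1.
move=> u Pu; apply: PU => a j; rewrite mxE.
have := Pt a j; rewrite mxE; case: unliftP => [j' ->|_] Paj; last exact: nbhs_singleton.
by have := Pu a j'; rewrite !(ord1 a).
Qed.

Lemma face_continuous m (i : 'I_m.+2) : continuous (@face m i).
Proof.
apply: continuous_comp_initial => t.
apply: (@continuous_comp _ _ _ set_val (@face_fun m i)).
  exact: initial_continuous.
exact: face_fun_continuous.
Qed.

HB.instance Definition _ m (i : 'I_m.+2) :=
  @isContinuous.Build _ _ (@face m i) (@face_continuous m i).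

Context (X : topologicalType).

Definition simplex (m : nat) := continuousType (std_simplex m) X.

Definition chain (m : nat) := {freeg (simplex m) / int}.

Definition boundary (m : nat) : chain m.+1 -> chain m :=
  fglift (fun s : simplex m.+1 =>
    \sum_(i < m.+2) (-1) ^+ i *: (<< (s \o face i : simplex m) >> : chain m)).

Definition is_cycle (m : nat) : chain m -> Prop :=
  if m is m'.+1 then fun c => boundary c = 0 else fun=> True.

(* r cycles whose homology classes are linearly independent over Z. *)
Definition independent_cycles (m r : nat) (c : 'I_r -> chain m) : Prop :=
  (forall i, is_cycle (c i)) /\
  forall a : 'I_r -> int,
    (exists b : chain m.+1, boundary b = \sum_i a i *: c i) -> forall i, a i = 0.

Definition homology_rank (m : nat) : \bar R :=
  ereal_sup [set r%:R%:E | r in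
    [set r : nat | exists c : 'I_r -> chain m, independent_cycles c]].

Definition total_betti : \bar R := (\sum_(0 <= m <oo) homology_rank m)%E.

End singular_homology.

Section counts.
Context {R : realType} {n : nat} (G : contactCarnot R n).
Implicit Types p : 'rV[R]_(n.*2 + 1).

Definition hat_nu p : \bar R := counting (Gamma G p).

Definition hat_beta p : \bar R := total_betti (set_type (Gamma G p)).

(* |z| / ||x||^2, equal to +oo when x = 0; the value at the origin is never
   used. *)
Definition zx_ratio p : \bar R :=
  if xpart p == 0 then +oo%E
  else (`|zpart p| / dotv (xpart p) (xpart p))%:E.

End counts.

(* Main.v *)
(** In exponential coordinates the bracket relations force the left-invariant frame
to be [f_i = e_i + (x A)_i / 2 e_0]: along a ray the matrix of the frame solves a
singular linear differential equation, and Gronwall's lemma identifies its solution.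
The Hamiltonian flow therefore rotates each component [u_j] with angular speed
[lam alpha_j], and the covectors [(u, lam)] with [lam <> 0] reaching [(x, z)] are
given by the following conditions: [u_j] is determined by [x_j] when [lam alpha_j] is
not a multiple of [2 pi], otherwise [x_j = 0] and [u_j] is free; and, with
[phi t = (t - sin t) / (1 - cos t)],
  [|z| = F |lam| + (sum of the free |u_j|^2) / (2 |lam|)],
  [F mu = sum over x_j <> 0 of (alpha_j |x_j|^2 / 4) phi (alpha_j mu)].

As [phi t >= (t - 1) / 2], the equation bounds [|lam|]. As [phi] is strictly convex
between its poles, [F mu = |z|] has at most two solutions between consecutive poles of
[F]. Hence the fibers of [lam] on the geodesics are finitely many: points, when
[F |lam| = |z|], and spheres, one for each of the [lam] at which some [x_j = 0]
resonates. Their total Betti number, at most [1] and [2] respectively, is bounded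
through barycentric subdivision and Mayer-Vietoris in punctured linear spaces. *)

Require Import Defs.
From HB Require Import structures.
From mathcomp.multinomials Require Import freeg.
From mathcomp Require Import all_boot all_order all_algebra.
From mathcomp Require Import all_classical all_reals all_analysis.
From mathcomp Require Import complex.
From mathcomp Require Import zify lra ring.

Set Implicit Arguments.
Unset Strict Implicit.
Unset Printing Implicit Defensive.

Import Order.TTheory GRing.Theory Num.Theory.
Import numFieldNormedType.Exports.

Local Open Scope classical_set_scope.
Local Open Scope ring_scope.

(** * Singular homology *)

(** Only upper bounds on ranks are needed, so no homology group and no exact sequence is built: a
    bound [r] says that every finite family of cycles has an integral coordinate matrix with [r]
    columns whose left kernel gives bounding combinations. Such bounds pass to retracts, to unions
    that no simplex crosses, and through one Mayer-Vietoris step; [int_left_kernel] turns them into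
    bounds on the rank.

    The constants come from a weighted count. Let N_j be the number of poles of the index j in (0,
    L], where L bounds |lam|. A point fiber has weight 1 and solves F |lam| = |z|, which leaves at
    most 2 (sum of N_j over x_j <> 0, plus 1) of them. A sphere has weight 2, and its |lam| is a
    pole of some j with x_j = 0. The total is at most 2 (sum of all N_j) + 2, so the unknown split
    of the indices disappears. Both kinds can be counted by |lam| because lam has the sign of z. *)

Section free_abelian_groups.
Variables (K : choiceType).
Implicit Types c d : {freeg K / int}.

Lemma freegE c : c = \sum_(z <- dom c) coeff z c *: (<< z >> : {freeg K / int}).
Proof.
rewrite -[LHS]freeg_sumE; apply: eq_bigr => z _; apply/eqP/freeg_eqP => y.
by rewrite coeffZ !coeffU mul1r.
Qed.

Section lift.
Variables (M : lmodType int) (f : K -> M).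

HB.instance Definition _ :=
  GRing.isZmodMorphism.Build {freeg K / int} M (fglift f) (lift_is_additive f).

Lemma fglift_scalable : scalable (fglift f : {freeg K / int} -> M).
Proof. by move=> a u; rewrite -[a]intz !scaler_int raddfMz. Qed.

HB.instance Definition _ :=
  GRing.isScalable.Build int {freeg K / int} M _ (fglift f) fglift_scalable.

Lemma fgliftU z : fglift f (<< z >> : {freeg K / int}) = f z.
Proof. by rewrite liftU scale1r. Qed.

Lemma fgliftE c : fglift f c = \sum_(z <- dom c) coeff z c *: f z.
Proof.
rewrite {1}(freegE c) linear_sum /=; apply: eq_bigr => z _.
by rewrite linearZ /= fgliftU.
Qed.

End lift.

Definition supported (P : K -> Prop) c := forall z, z \in dom c -> P z.

Lemma supported0 P : supported P 0.
Proof. by move=> z; rewrite dom0. Qed.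

Lemma supportedU (P : K -> Prop) z : P z -> supported P << z >>.
Proof. by move=> Pz y; rewrite domU1 inE => /eqP ->. Qed.

Lemma supportedD P c d : supported P c -> supported P d -> supported P (c + d).
Proof. by move=> Pc Pd z /domD_subset; rewrite mem_cat => /orP[/Pc|/Pd]. Qed.

Lemma supportedZ P (a : int) c : supported P c -> supported P (a *: c).
Proof. by move=> Pc z /domZ_subset /Pc. Qed.

Lemma supportedN P c : supported P c -> supported P (- c).
Proof. by rewrite -scaleN1r; exact: supportedZ. Qed.

Lemma supportedB P c d : supported P c -> supported P d -> supported P (c - d).
Proof. by move=> Pc Pd; apply: supportedD => //; exact: supportedN. Qed.

Lemma supported_sum P I (r : seq I) (F : I -> {freeg K / int}) :
  (forall i, supported P (F i)) -> supported P (\sum_(i <- r) F i).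
Proof.
by move=> PF; elim/big_ind: _ => //; [exact: supported0 | exact: supportedD].
Qed.

Lemma supportedW (P Q : K -> Prop) c : (forall z, P z -> Q z) -> supported P c -> supported Q c.
Proof. by move=> PQ Pc z /Pc /PQ. Qed.

Lemma linear_eq_supported (M : lmodType int) (F G : {linear {freeg K / int} -> M}) P c :
  (forall z, P z -> F << z >> = G << z >>) -> supported P c -> F c = G c.
Proof.
move=> FG Pc; rewrite (freegE c) !linear_sum /= !big_seq; apply: eq_bigr => z zc.
by rewrite !linearZ /= FG //; exact: Pc.
Qed.

Lemma linear_eq (M : lmodType int) (F G : {linear {freeg K / int} -> M}) c :
  (forall z, F << z >> = G << z >>) -> F c = G c.
Proof. by move=> FG; apply: (@linear_eq_supported _ _ _ (fun=> True)). Qed.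

End free_abelian_groups.

Lemma supported_lift (K K' : choiceType) (f : K -> {freeg K' / int}) (P : K -> Prop)
    (Q : K' -> Prop) (c : {freeg K / int}) :
  (forall z, P z -> supported Q (f z)) -> supported P c -> supported Q (fglift f c).
Proof.
move=> PQ Pc; rewrite fgliftE big_seq; elim/big_ind: _ => //.
- exact: supported0.
- exact: supportedD.
- by move=> z zc; apply: supportedZ; apply: PQ; exact: Pc.
Qed.

(** * Affine chains as lists of vertices, and their barycentric subdivision *)

Section linear_chains.
Variables (R : realType) (V : lmodType R).

Local Notation lchain := {freeg (seq V) / int}.

Definition lcone (v : V) : lchain -> lchain := fglift (fun s => << v :: s >> : lchain).

HB.instance Definition _ v := GRing.Linear.on (lcone v).

Lemma lconeU v s : lcone v << s >> = << v :: s >>.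
Proof. exact: fgliftU. Qed.

(** The empty list is a simplex of dimension -1, so this complex is augmented: the boundary of a
    vertex is [[::]], and the cone formula [lbd_lcone] has no exceptional case in dimension 0. *)
Fixpoint lbd_seq (s : seq V) : lchain :=
  if s is v :: s' then << s' >> - lcone v (lbd_seq s') else 0.

Lemma lbd_seq_cons v s : lbd_seq (v :: s) = << s >> - lcone v (lbd_seq s).
Proof. by []. Qed.

Definition lbd : lchain -> lchain := fglift lbd_seq.

HB.instance Definition _ := GRing.Linear.on lbd.

Lemma lbdU s : lbd << s >> = lbd_seq s.
Proof. exact: fgliftU. Qed.

Lemma lbd_lcone v c : lbd (lcone v c) = c - lcone v (lbd c).
Proof.
have := @linear_eq _ _ (lbd \o lcone v) (idfun \- (lcone v \o lbd)) c; apply => s /=.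
by rewrite lconeU !lbdU.
Qed.

Lemma lbd_lbd c : lbd (lbd c) = 0.
Proof.
have := @linear_eq _ _ (lbd \o lbd) \0 c; apply => s /=; rewrite lbdU.
elim: s => [|v s IH] /=; first by rewrite linear0.
by rewrite linearB /= lbdU lbd_lcone IH linear0 subr0 subrr.
Qed.

Lemma lbd_seq_sum s : lbd_seq s =
  \sum_(i < size s) (-1) ^+ i *: (<< take i s ++ drop i.+1 s >> : lchain).
Proof.
elim: s => [|v s IH] /=; first by rewrite big_ord0.
rewrite big_ord_recl /= expr0 scale1r drop0 IH linear_sum /= -sumrN.
congr (_ + _); apply: eq_bigr => i _.
by rewrite linearZ /= lconeU /bump /= exprS mulN1r scaleNr.
Qed.

Arguments lbd_seq : simpl never.

Lemma supported_lcone (P Q : seq V -> Prop) v c : (forall s, P s -> Q (v :: s)) ->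
  supported P c -> supported Q (lcone v c).
Proof. by move=> PQ; apply: supported_lift => s Ps; apply: supportedU; exact: PQ. Qed.

(** Here [n] counts the vertices, one more than the dimension. *)
Definition simplex_in (n : nat) (C : V -> Prop) (s : seq V) :=
  size s = n /\ forall v, v \in s -> C v.

Lemma supported_lbd_seq n C s : simplex_in n.+1 C s -> supported (simplex_in n C) (lbd_seq s).
Proof.
move=> [sz Cs]; rewrite lbd_seq_sum; apply: supported_sum => i.
apply: supportedZ; apply: supportedU; split.
  rewrite size_cat size_take size_drop ltn_ord.
  by have := ltn_ord i; move: (i : nat) => j; rewrite sz ltnS subSS => /subnKC.
by move=> v; rewrite mem_cat => /orP[/mem_take|/mem_drop] /Cs.
Qed.

Lemma supported_lbd n C c : supported (simplex_in n.+1 C) c -> supported (simplex_in n C) (lbd c).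
Proof. by apply: supported_lift => s; exact: supported_lbd_seq. Qed.

Definition bary (s : seq V) : V := (size s)%:R^-1 *: \sum_(v <- s) v.

(** The cone from the barycenter over the subdivided boundary. The faces form a chain rather than a
    subterm of [s], so the recursion runs on a counter started at [size s]; [lsd_cons] is the
    equation without the counter. *)
Fixpoint lsd_rec n s : lchain :=
  if n is n'.+1 then lcone (bary s) (fglift (lsd_rec n') (lbd_seq s)) else << s >>.

Definition lsd : lchain -> lchain := fglift (fun s => lsd_rec (size s) s).

(** The chain homotopy T from subdivision to the identity: T s is the cone from the barycenter over
    s - T (boundary of s). *)
Fixpoint lht_rec n s : lchain :=
  if n is n'.+1 then lcone (bary s) (<< s >> - fglift (lht_rec n') (lbd_seq s)) else 0.

Definition lht : lchain -> lchain := fglift (fun s => lht_rec (size s) s).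

HB.instance Definition _ := GRing.Linear.on lsd.
HB.instance Definition _ := GRing.Linear.on lht.

Lemma lsd_nil : lsd << [::] >> = << [::] >>.
Proof. exact: fgliftU. Qed.

Lemma lht_nil : lht << [::] >> = 0.
Proof. exact: fgliftU. Qed.

Lemma supported_size s : supported (fun s' => size s' = (size s).-1) (lbd_seq s).
Proof.
case: s => [|v s]; first exact: supported0.
have := @supported_lbd_seq (size s) (fun=> True) (v :: s).
by move=> /(_ (conj erefl _)) => H; apply: supportedW (H _) => // z [].
Qed.

Lemma lsd_cons v s : lsd << v :: s >> = lcone (bary (v :: s)) (lsd (lbd_seq (v :: s))).
Proof.
rewrite [LHS]fgliftU [LHS]/=; congr lcone.
apply: (linear_eq_supported (F := fglift (lsd_rec (size s))) (G := lsd) _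
  (@supported_size (v :: s))) => s' /= sz.
by rewrite [RHS]fgliftU [LHS]fgliftU sz.
Qed.

Lemma lht_cons v s :
  lht << v :: s >> = lcone (bary (v :: s)) (<< v :: s >> - lht (lbd_seq (v :: s))).
Proof.
rewrite [LHS]fgliftU [LHS]/=; congr (lcone _ (_ - _)).
apply: (linear_eq_supported (F := fglift (lht_rec (size s))) (G := lht) _
  (@supported_size (v :: s))) => s' /= sz.
by rewrite [RHS]fgliftU [LHS]fgliftU sz.
Qed.

(** Induction on the number of vertices: the boundary of a list is supported by lists with one
    vertex less, on which the maps already agree. *)
Lemma size_ind_linear (M : lmodType int) (F G : {linear lchain -> M}) :
  (F << [::] >> = G << [::] >>) ->
  (forall v s, F (lbd_seq (v :: s)) = G (lbd_seq (v :: s)) ->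
    F << v :: s >> = G << v :: s >>) ->
  forall c, F c = G c.
Proof.
move=> F0 FS c; apply: linear_eq => s.
have [n] := ubnP (size s); elim: n s => // n IH [|v s] //= sz; apply: FS.
apply: (linear_eq_supported _ (@supported_size (v :: s))) => s' /= sz'.
by apply: IH; rewrite sz'.
Qed.

Lemma lbd_lsd c : lbd (lsd c) = lsd (lbd c).
Proof.
apply: (size_ind_linear (F := lbd \o lsd) (G := lsd \o lbd)) => [|v s /= IH] /=.
  by rewrite lsd_nil lbdU /= linear0.
by rewrite lsd_cons lbd_lcone IH -!lbdU lbd_lbd !linear0 addr0.
Qed.

Lemma lbd_lht c : lbd (lht c) = c - lsd c - lht (lbd c).
Proof.
apply: (size_ind_linear (F := lbd \o lht) (G := (idfun \- lsd) \- (lht \o lbd))) => [|v s /= IH] /=.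
  by rewrite lsd_nil lht_nil lbdU /= !linear0 subrr addr0.
rewrite lht_cons lbd_lcone [lbd (_ - _)]linearB /= IH -!lbdU lbd_lbd.
by rewrite lsd_cons -lbdU !linear0 addr0 subKr addrAC.
Qed.

(** The iterates are given as lifts of their values on generators, so that linearity comes from
    [fglift]; the recursive equations are recovered below. The sum in [lhtn] telescopes to a
    homotopy for the k-fold subdivision. *)
Definition lsdn k : lchain -> lchain := fglift (fun s => iter k lsd << s >>).
Definition lhtn k : lchain -> lchain :=
  fglift (fun s => \sum_(i < k) lht (lsdn i << s >>)).

HB.instance Definition _ k := GRing.Linear.on (lsdn k).
HB.instance Definition _ k := GRing.Linear.on (lhtn k).

Lemma lsdn0 c : lsdn 0 c = c.
Proof. by apply: (linear_eq (F := lsdn 0) (G := idfun)) => s; rewrite [LHS]fgliftU. Qed.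

Lemma lsdnS k c : lsdn k.+1 c = lsd (lsdn k c).
Proof.
apply: (linear_eq (F := lsdn k.+1) (G := lsd \o lsdn k)) => s /=.
by rewrite [LHS]fgliftU iterS; congr lsd; rewrite [RHS]fgliftU.
Qed.

Lemma lhtn0 c : lhtn 0 c = 0.
Proof.
by apply: (linear_eq (F := lhtn 0) (G := \0)) => s; rewrite [LHS]fgliftU big_ord0.
Qed.

Lemma lhtnS k c : lhtn k.+1 c = lhtn k c + lht (lsdn k c).
Proof.
apply: (linear_eq (F := lhtn k.+1) (G := lhtn k \+ (lht \o lsdn k))) => s /=.
by rewrite [LHS]fgliftU big_ord_recr /= [lhtn k _]fgliftU.
Qed.

Lemma lbd_lsdn k c : lbd (lsdn k c) = lsdn k (lbd c).
Proof. by elim: k => [|k IH]; rewrite ?lsdn0 // !lsdnS lbd_lsd IH. Qed.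

Lemma lbd_lhtn k c : lbd (lhtn k c) = c - lsdn k c - lhtn k (lbd c).
Proof.
elim: k => [|k IH]; first by rewrite !lhtn0 lsdn0 subrr !linear0 addr0.
rewrite !lhtnS lsdnS linearD /= IH lbd_lht -lbd_lsdn opprD !addrA.
by congr (_ - _); rewrite [_ - _ + lsdn k c]addrAC subrK addrAC.
Qed.

(** The part of convexity that subdivision uses. *)
Definition bary_closed (C : V -> Prop) :=
  forall s, s != [::] -> (forall v, v \in s -> C v) -> C (bary s).

Lemma simplex_in_cons n C v s : C v -> simplex_in n C s -> simplex_in n.+1 C (v :: s).
Proof.
move=> Cv [sz Cs]; split; first by rewrite /= sz.
by move=> w; rewrite inE => /orP[/eqP -> //|/Cs].
Qed.

Lemma supported_lsd n C c : bary_closed C ->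
  supported (simplex_in n C) c -> supported (simplex_in n C) (lsd c).
Proof.
move=> CC; elim: n c => [|n IH] c; apply: supported_lift => -[|v s] [] //= sz Cs.
  exact: supportedU.
rewrite -[lcone _ _]/(lsd_rec (size (v :: s)) (v :: s)).
have -> : lsd_rec (size (v :: s)) (v :: s) = lsd << v :: s >> by rewrite [RHS]fgliftU.
rewrite lsd_cons; apply: (@supported_lcone (simplex_in n C)).
  by move=> s'; apply: simplex_in_cons; exact: CC.
by apply: IH; apply: supported_lbd_seq.
Qed.

Lemma supported_lht n C c : bary_closed C ->
  supported (simplex_in n C) c -> supported (simplex_in n.+1 C) (lht c).
Proof.
move=> CC; elim: n c => [|n IH] c; apply: supported_lift => -[|v s] [] //= sz Cs.
  exact: supported0.
rewrite -[lcone _ _]/(lht_rec (size (v :: s)) (v :: s)).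
have -> : lht_rec (size (v :: s)) (v :: s) = lht << v :: s >> by rewrite [RHS]fgliftU.
rewrite lht_cons; apply: (@supported_lcone (simplex_in n.+1 C)).
  by move=> s'; apply: simplex_in_cons; exact: CC.
apply: supportedB; first exact: supportedU.
by apply: IH; apply: supported_lbd_seq.
Qed.

Lemma supported_lsdn k n C c : bary_closed C ->
  supported (simplex_in n C) c -> supported (simplex_in n C) (lsdn k c).
Proof.
by move=> CC Cc; elim: k => [|k IH]; rewrite ?lsdn0 // lsdnS; exact: supported_lsd.
Qed.

Lemma supported_lhtn k n C c : bary_closed C ->
  supported (simplex_in n C) c -> supported (simplex_in n.+1 C) (lhtn k c).
Proof.
move=> CC Cc; elim: k => [|k IH]; first by rewrite lhtn0; exact: supported0.
by rewrite lhtnS; apply: supportedD => //; apply: supported_lht => //; exact: supported_lsdn.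
Qed.

End linear_chains.
Arguments lbd_seq : simpl never.

(** * Naturality of subdivision under linear maps *)

Section naturality.
Variables (R : realType) (V W : lmodType R) (f : {linear V -> W}).

Definition lmap : {freeg (seq V) / int} -> {freeg (seq W) / int} :=
  fglift (fun s => << map f s >> : {freeg (seq W) / int}).

HB.instance Definition _ := GRing.Linear.on lmap.

Lemma lmapU s : lmap << s >> = << map f s >>.
Proof. exact: fgliftU. Qed.

Lemma bary_map s : bary (map f s) = f (bary s).
Proof. by rewrite /bary size_map big_map linearZ_LR [f (\sum_(_ <- _) _)]linear_sum. Qed.

Lemma lcone_lmap v c : lcone (f v) (lmap c) = lmap (lcone v c).
Proof.
apply: (linear_eq (F := lcone (f v) \o lmap) (G := lmap \o lcone v)) => s /=.
by rewrite lmapU !lconeU lmapU.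
Qed.

Lemma lbd_seq_map s : lbd_seq (map f s) = lmap (lbd_seq s).
Proof.
elim: s => [|v s IH]; first by rewrite linear0.
by rewrite [map _ _]/= !lbd_seq_cons IH lcone_lmap linearB /= lmapU.
Qed.

Lemma lsd_lmap c : lsd (lmap c) = lmap (lsd c).
Proof.
apply: (size_ind_linear (F := @lsd _ W \o lmap) (G := lmap \o @lsd _ V)) => [|v s IH] /=.
  by rewrite lsd_nil lmapU lsd_nil.
by rewrite lmapU [map _ _]/= !lsd_cons -[f v :: _]/(map f (v :: s)) bary_map
           lbd_seq_map [lsd _]IH lcone_lmap.
Qed.

Lemma lht_lmap c : lht (lmap c) = lmap (lht c).
Proof.
apply: (size_ind_linear (F := @lht _ W \o lmap) (G := lmap \o @lht _ V)) => [|v s IH] /=.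
  by rewrite lmapU !lht_nil linear0.
by rewrite lmapU [map _ _]/= !lht_cons -[f v :: _]/(map f (v :: s)) bary_map
           lbd_seq_map [lht (lmap _)]IH -lcone_lmap [lmap (_ - _)]linearB /= lmapU.
Qed.

Lemma lsdn_lmap k c : lsdn k (lmap c) = lmap (lsdn k c).
Proof. by elim: k => [|k IH]; rewrite ?lsdn0 // !lsdnS IH lsd_lmap. Qed.

Lemma lhtn_lmap k c : lhtn k (lmap c) = lmap (lhtn k c).
Proof.
elim: k => [|k IH]; first by rewrite !lhtn0 linear0.
by rewrite !lhtnS linearD /= IH lsdn_lmap lht_lmap.
Qed.

End naturality.

(** * Contraction of the mesh under subdivision *)

Section mesh.
Variables (R : realType) (V : normedModType R).
Local Notation lchain := {freeg (seq V) / int}.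

Definition mesh_le (n : nat) (e : R) (s : seq V) :=
  size s = n /\ forall v w, v \in s -> w \in s -> `|v - w| <= e.

Lemma bary_closed_ball (b : V) (e : R) : bary_closed (fun v => `|b - v| <= e).
Proof.
move=> s s0 Cs; rewrite /bary.
have sz : (size s)%:R != 0 :> R by rewrite pnatr_eq0 size_eq0.
have -> : b - (size s)%:R^-1 *: \sum_(v <- s) v = (size s)%:R^-1 *: \sum_(v <- s) (b - v).
  rewrite sumrB scalerBr big_const_seq count_predT iter_addr_0 -[b *+ _]scaler_nat scalerA.
  by rewrite mulVf // scale1r.
rewrite normrZ normfV normr_nat ler_pdivrMl ?lt0r ?sz ?ler0n //.
rewrite (le_trans (ler_norm_sum _ _ _))// mulr_natl -[leRHS]mulr_natl -sum1_size natr_sum mulr_suml.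
by rewrite big_seq [leRHS]big_seq ler_sum // => v vs; rewrite mul1r Cs.
Qed.

(** The difference is the average of the n + 1 vectors w - v, one of which is zero. *)
Lemma bary_dist n e s v : mesh_le n.+1 e s -> v \in s ->
  `|bary s - v| <= n%:R / n.+1%:R * e.
Proof.
move=> [sz se] vs; rewrite /bary sz.
have -> : n.+1%:R^-1 *: \sum_(v <- s) v - v = n.+1%:R^-1 *: \sum_(w <- s) (w - v).
  rewrite sumrB scalerBr big_const_seq count_predT iter_addr_0 sz -[v *+ _]scaler_nat scalerA.
  by rewrite mulVf ?pnatr_eq0 // scale1r.
rewrite normrZ normfV normr_nat mulrAC mulrC ler_pM2r ?invr_gt0 ?ltr0n //.
rewrite (perm_big _ (perm_to_rem vs)) /= big_cons subrr add0r.
rewrite (le_trans (ler_norm_sum _ _ _))//.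
have -> : n%:R * e = \sum_(w <- rem v s) e.
  by rewrite big_const_seq count_predT iter_addr_0 size_rem // sz mulr_natl.
by rewrite big_seq [leRHS]big_seq ler_sum // => w /mem_rem ws; apply: se.
Qed.

Lemma supported_lsd_mesh n e c : supported (mesh_le n.+1 e) c ->
  supported (mesh_le n.+1 (n%:R / n.+1%:R * e)) (lsd c).
Proof.
elim: n e c => [|n IH] e c; apply: supported_lift => -[|v s] [] //= sz se.
all: rewrite -[lcone _ _]/(lsd_rec (size (v :: s)) (v :: s)).
all: have -> : lsd_rec (size (v :: s)) (v :: s) = lsd << v :: s >> by rewrite [RHS]fgliftU.
  case: s sz se => // _ se; rewrite lsd_cons lbd_seq_cons !linear0 addr0 lsd_nil lconeU.
  apply: supportedU; split => // w w'; rewrite !inE => /eqP -> /eqP ->.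
  by rewrite subrr normr0 mul0r mul0r.
rewrite lsd_cons; set b := bary _; set e' := _ * e.
have e0 : 0 <= e by apply: le_trans (se v v _ _); rewrite ?mem_head.
(* The faces contract by n / (n + 1), which is at most (n + 1) / (n + 2). *)
have sup1 : supported (mesh_le n.+1 e') (lsd (lbd_seq (v :: s))).
  have := IH e (lbd_seq (v :: s)).
  move=> H; apply: supportedW (H _) => [s' [sz' se']|].
    split=> // w w' ws ws'; apply: le_trans (se' _ _ ws ws') _.
    apply: ler_wpM2r => //; rewrite ler_pdivrMr ?ltr0n // mulrAC ler_pdivlMr ?ltr0n //.
    by rewrite -!natrM ler_nat; lia.
  have := @supported_lbd_seq _ _ n.+1 (fun w => w \in v :: s) (v :: s).
  move=> /(_ (conj sz (fun _ => id))); apply: supportedW => s' [sz' ss'].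
  by split=> // w w' /ss' ws /ss' ws'; exact: se.
(* The ball of radius [e'] around the barycenter contains all the vertices and is closed under
   barycenters, so it also contains the vertices of the subdivided faces. *)
have sup2 : supported (simplex_in n.+1 (fun w => `|b - w| <= e')) (lsd (lbd_seq (v :: s))).
  apply: supported_lsd; first exact: bary_closed_ball.
  apply: supported_lbd_seq; split=> // w ws.
  by apply: bary_dist ws; split.
have := @supported_lcone _ _
  (fun s => mesh_le n.+1 e' s /\ simplex_in n.+1 (fun w => `|b - w| <= e') s)
  (mesh_le n.+2 e') b (lsd (lbd_seq (v :: s))).
apply; last by move=> s' ss'; split; [apply: sup1 | apply: sup2].
move=> s' [[sz' se'] [_ sb']]; split; first by rewrite /= sz'.
move=> w w'; rewrite !inE => /predU1P[->|ws] /predU1P[->|ws'].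
- by rewrite subrr normr0 mulr_ge0 // divr_ge0 // ler0n.
- exact: sb'.
- by rewrite distrC; exact: sb'.
- exact: se'.
Qed.

Lemma supported_lsdn_mesh k n e c : supported (mesh_le n.+1 e) c ->
  supported (mesh_le n.+1 ((n%:R / n.+1%:R) ^+ k * e)) (lsdn k c).
Proof.
move=> ce; elim: k => [|k IH]; first by rewrite lsdn0 expr0 mul1r.
by rewrite lsdnS exprS -mulrA; exact: supported_lsd_mesh.
Qed.

End mesh.

Lemma continuous_sum (R : numFieldType) (T : topologicalType) (V : normedModType R)
    I (r : seq I) (f : I -> T -> V) :
  (forall i, continuous (f i)) -> continuous (fun t => \sum_(i <- r) f i t).
Proof.
by move=> fc t; apply: (cvg_big (@add_continuous _)) => i _; exact: fc.
Qed.

HB.instance Definition _ (R : realType) (X : topologicalType) m :=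
  GRing.Linear.on (@boundary R X m).

(** * Singular chains, their push-forward, and realization of affine chains *)

Section singular_chains.
Variables (R : realType).
Local Notation stds m := (set_type (@std_simplex R m)).
Local Notation chain := (@chain R).
Local Notation simplex := (@simplex R).
Implicit Types (X Y Z : topologicalType).

Definition inside X T (A : set X) (f : T -> X) := forall t, A (f t).

Section chain_of.
Variables (X : topologicalType) (m : nat).

(* The zero chain when [f] is not continuous. *)
Definition chain_of (f : stds m -> X) : chain X m :=
  if pselect (continuous f) is left fc then << (mkcts fc : simplex X m) >> else 0.

Lemma chain_of_simplex (s : simplex X m) : chain_of s = << s >>.
Proof.
rewrite /chain_of; case: pselect => [fc|[]]; last exact: cts_fun.
by congr (<< _ >>); apply/continuousEP.
Qed.

Lemma chain_ofE (f : stds m -> X) (fc : continuous f) :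
  chain_of f = << (mkcts fc : simplex X m) >>.
Proof. by rewrite -chain_of_simplex. Qed.

Lemma supported_chain_of A (f : stds m -> X) :
  inside A f -> supported (fun s : simplex X m => inside A s) (chain_of f).
Proof.
rewrite /chain_of => Af; case: pselect => fc; last exact: supported0.
exact: supportedU.
Qed.

End chain_of.

Lemma boundary_chain_of X m (f : stds m.+1 -> X) : continuous f ->
  boundary (chain_of f) = \sum_(i < m.+2) (-1) ^+ i *: chain_of (f \o face i).
Proof.
move=> fc; rewrite (chain_ofE fc) [LHS]fgliftU.
apply: eq_bigr => i _; congr (_ *: _); rewrite -chain_of_simplex.
by congr chain_of.
Qed.

Definition carried X m (A : set X) (c : chain X m) := supported (fun s : simplex X m => inside A s) c.

Lemma carried_boundary X m A (c : chain X m.+1) : carried A c -> carried A (boundary c).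
Proof.
apply: supported_lift => s As; apply: supported_sum => i; apply: supportedZ.
by apply: supportedU => t; exact: As.
Qed.

Lemma carriedS X m (A B : set X) (c : chain X m) : A `<=` B -> carried A c -> carried B c.
Proof. by move=> AB; apply: supportedW => s As t; exact/AB/As. Qed.

Lemma delta_simplex m (i : 'I_m.+1) : (@std_simplex R m) (delta_mx 0 i).
Proof.
split; first by move=> j; rewrite mxE; case: (_ && _).
rewrite (bigD1 i) //= mxE !eqxx /= big1 ?addr0 // => j ji.
by rewrite mxE (negbTE ji) andbF.
Qed.

Definition svertex0 m : stds m := SigSub (mem_set (delta_simplex ord0)).

Lemma carried_set0 X m (c : chain X m) : carried set0 c -> c = 0.
Proof.
move=> c0; apply/eqP; rewrite -dom_eq0 -size_eq0 size_eq0; case E : (dom c) => [//|s r].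
by have /c0 H : s \in dom c; [rewrite E mem_head | case: (H (svertex0 m))].
Qed.

Section push.
Variables (X Y : topologicalType) (m : nat).

Definition push (f : X -> Y) : chain X m -> chain Y m :=
  fglift (fun s : simplex X m => chain_of (f \o s)).

HB.instance Definition _ f := GRing.Linear.on (push f).

Lemma pushU f s : push f << s >> = chain_of (f \o s).
Proof. exact: fgliftU. Qed.

Lemma carried_push f (A : set X) (B : set Y) (c : chain X m) :
  (forall x, A x -> B (f x)) -> carried A c -> carried B (push f c).
Proof.
by move=> AB; apply: supported_lift => s As; apply: supported_chain_of => t; exact/AB/As.
Qed.

End push.

(** Continuity is tested only on singular simplices inside [A]. This fits maps that are extended by
    arbitrary values outside [A], such as [tosimplex] or a normalization on a punctured space. On
    chains carried by [A], [push f] then never meets the default value of [chain_of]. *)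
Definition good_on X Y (f : X -> Y) (A : set X) :=
  forall m (s : simplex X m), inside A s -> continuous (f \o s).

Lemma push_boundary X Y (f : X -> Y) A m (c : chain X m.+1) : good_on f A -> carried A c ->
  boundary (push f c) = push f (boundary c).
Proof.
move=> fA; apply: (linear_eq_supported (F := @boundary R Y m \o push f)
  (G := push f \o @boundary R X m)) => s As /=.
rewrite pushU boundary_chain_of ?[boundary _]fgliftU; last exact: fA.
by rewrite linear_sum; apply: eq_bigr => i _; rewrite linearZ /= pushU.
Qed.

Lemma push_push X Y Z (f : X -> Y) (g : Y -> Z) A m (c : chain X m) :
  good_on f A -> carried A c -> push g (push f c) = push (g \o f) c.
Proof.
move=> fA; apply: (linear_eq_supported (F := push g \o push f) (G := push (g \o f))) => s As /=.
by rewrite !pushU (chain_ofE (fA _ _ As)) pushU.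
Qed.

Lemma push_eq X Y (f g : X -> Y) A m (c : chain X m) :
  (forall x, A x -> f x = g x) -> carried A c -> push f c = push g c.
Proof.
move=> fg; apply: (linear_eq_supported (F := push f) (G := push g)) => s As /=.
by rewrite !pushU; congr chain_of; apply/funext => t /=; exact/fg/As.
Qed.

Lemma push_id X m (c : chain X m) : push idfun c = c.
Proof.
by apply: (linear_eq (F := push idfun) (G := idfun)) => s /=; rewrite pushU -[in RHS]chain_of_simplex.
Qed.

Lemma val_continuous (T : topologicalType) (A : set T) :
  continuous (val : set_type A -> T).
Proof. by rewrite -set_valE; exact: initial_continuous. Qed.

Lemma coord_simplex_continuous j (i : 'I_j.+1) : continuous (fun t : stds j => (val t) 0 i).
Proof.
move=> t; apply: (@continuous_comp _ _ _ (val : stds j -> _) (fun M => M 0 i) t).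
  exact: val_continuous.
exact: coord_continuous.
Qed.

Section linear_simplices.
Variable V : normedModType R.

Definition aff (s : seq V) j (t : stds j) : V := \sum_(i < j.+1) (val t) 0 i *: nth 0 s i.

Lemma aff_continuous s j : continuous (@aff s j).
Proof.
apply: continuous_sum => i t.
exact: (@cvgZr_tmp R V _ (nbhs t) _ (fun t : stds j => (val t) 0 i) _ (nth 0 s i)
  (@coord_simplex_continuous j i t)).
Qed.

Definition affs s j : simplex V j := mkcts (@aff_continuous s j).

(** Lists of the wrong length are sent to 0, which makes this a linear map on all list chains,
    whatever the dimension. *)
Definition lreal j : {freeg (seq V) / int} -> chain V j :=
  fglift (fun s => if size s == j.+1 then << affs s j >> : chain V j else 0).

HB.instance Definition _ j := GRing.Linear.on (lreal j).

Lemma lrealU j s : size s = j.+1 -> lreal j << s >> = << affs s j >>.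
Proof. by move=> sz; rewrite [LHS]fgliftU sz eqxx. Qed.

Lemma nth_take_drop (s : seq V) i l : (i < size s)%N ->
  nth 0 (take i s ++ drop i.+1 s) l = nth 0 s (bump i l).
Proof.
move=> si; rewrite nth_cat size_take si /bump; case: ltnP => li.
  by rewrite nth_take // leqNgt li.
by rewrite nth_drop; congr nth; lia.
Qed.

Lemma boundary_lreal j C c : supported (simplex_in j.+2 C) c ->
  boundary (lreal j.+1 c) = lreal j (lbd c).
Proof.
apply: (linear_eq_supported (F := @boundary R V j \o lreal j.+1)
  (G := lreal j \o @lbd _ V)) => s [sz _] /=.
rewrite lrealU // -chain_of_simplex boundary_chain_of; last exact: cts_fun.
rewrite lbdU lbd_seq_sum linear_sum sz; apply: eq_bigr => i _; rewrite linearZ /=; congr (_ *: _).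
have si : (i < size s)%N by rewrite sz.
rewrite lrealU; last by rewrite size_cat size_take size_drop si sz; have := ltn_ord i; lia.
rewrite -chain_of_simplex; congr chain_of; apply/funext => t /=.
rewrite /mkcts /aff (bigD1_ord i) //= mxE unlift_none scale0r add0r.
by apply: eq_bigr => l _; rewrite mxE liftK nth_take_drop.
Qed.

Lemma lreal_wf (P : seq V -> Prop) j c : supported P c ->
  supported (fun t : simplex V j => exists2 s, P s /\ size s = j.+1 & t = affs s j) (lreal j c).
Proof.
apply: supported_lift => s Ps; case: eqP => sz; last exact: supported0.
by apply: supportedU; exists s.
Qed.

End linear_simplices.

Lemma push_lreal (V W : normedModType R) (f : {linear V -> W}) j C c :
  supported (simplex_in j.+1 C) c -> push f (lreal j c) = lreal j (lmap f c).
Proof.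
apply: (linear_eq_supported (F := push f \o lreal j) (G := lreal j \o lmap f)) => s [sz _] /=.
rewrite lmapU !lrealU ?size_map // pushU -chain_of_simplex; congr chain_of.
apply/funext => t /=; rewrite /mkcts /aff linear_sum; apply: eq_bigr => i _.
by rewrite linearZ (nth_map 0) // sz.
Qed.

Lemma face_fun_linear m (i : 'I_m.+2) : linear (@face_fun R m i).
Proof.
move=> a u v; apply/rowP => j; rewrite !mxE; case: unlift => [l|].
  by rewrite !mxE.
by rewrite mulr0 addr0.
Qed.

HB.instance Definition _ m (i : 'I_m.+2) :=
  GRing.isLinear.Build R 'rV[R]_m.+1 'rV[R]_m.+2 _ (@face_fun R m i) (face_fun_linear i).

Definition verts m : seq 'rV[R]_m.+1 := [seq delta_mx 0 i | i <- enum 'I_m.+1].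

Lemma size_verts m : size (verts m) = m.+1.
Proof. by rewrite size_map size_enum_ord. Qed.

Lemma nth_verts m (i : 'I_m.+1) : nth 0 (verts m) i = delta_mx 0 i.
Proof. by rewrite (nth_map i) ?size_enum_ord // nth_ord_enum. Qed.

Lemma aff_verts m (t : stds m) : aff (verts m) t = val t.
Proof.
rewrite /aff [RHS]row_sum_delta; apply: eq_bigr => i _; by rewrite nth_verts.
Qed.

Lemma bary_closed_simplex m : bary_closed (@std_simplex R m).
Proof.
move=> s s0 Cs; have sz : (size s)%:R != 0 :> R by rewrite pnatr_eq0 size_eq0.
split=> [i|].
  rewrite !mxE mulr_ge0 // summxE big_seq sumr_ge0 // => v vs.
  by case: (Cs v vs).
under eq_bigr do rewrite mxE summxE.
rewrite -mulr_sumr exchange_big /= big_seq.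
under eq_bigr => v vs do rewrite (Cs v vs).2.
by rewrite -big_seq big_const_seq count_predT iter_addr_0 mulVf.
Qed.

Lemma verts_in m : simplex_in m.+1 (@std_simplex R m) (verts m).
Proof.
by split; [exact: size_verts | move=> v /mapP[i _ ->]; exact: delta_simplex].
Qed.

Lemma aff_simplex m (s : seq 'rV[R]_m.+1) j (t : stds j) :
  simplex_in j.+1 (@std_simplex R m) s -> (@std_simplex R m) (aff s t).
Proof.
move=> [sz Cs]; have [t0 t1] := set_valP t.
have Cn (i : 'I_j.+1) : (@std_simplex R m) (nth 0 s i) by apply: Cs; rewrite mem_nth // sz.
rewrite /aff; split=> [l|].
  rewrite summxE sumr_ge0 // => i _; rewrite mxE mulr_ge0 //.
  by case: (Cn i).
under eq_bigr do rewrite summxE.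
rewrite exchange_big /= -t1; apply: eq_bigr => i _.
under eq_bigr do rewrite mxE.
by rewrite -mulr_sumr (Cn i).2 mulr1.
Qed.

Definition tosimplex m (v : 'rV[R]_m.+1) : stds m := insubd (svertex0 m) v.

Lemma tosimplexK m (v : 'rV[R]_m.+1) : std_simplex v -> val (tosimplex v) = v.
Proof. by move=> vS; rewrite /tosimplex insubdK //; exact: mem_set. Qed.

Lemma valK_simplex m (t : stds m) : tosimplex (val t) = t.
Proof. by apply: val_inj; rewrite tosimplexK //; exact: set_valP. Qed.

(** A singular simplex made total on the ambient space: whatever is built in the standard simplex
    from affine chains can then be pushed forward along [s]. *)
Definition ext X m (s : simplex X m) (v : 'rV[R]_m.+1) : X := s (tosimplex v).

Lemma tosimplex_good m : good_on (@tosimplex m) (@std_simplex R m).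
Proof.
move=> j s sS; apply: continuous_comp_initial.
have -> : set_val \o (@tosimplex m \o s) = (s : stds j -> 'rV[R]_m.+1).
  by rewrite set_valE; apply/funext => t /=; exact/tosimplexK/sS.
exact: cts_fun.
Qed.

Lemma ext_good X m (s : simplex X m) : good_on (ext s) (@std_simplex R m).
Proof.
move=> j t tS x; apply: (@continuous_comp _ _ _ (@tosimplex m \o t) s).
  exact: tosimplex_good.
exact: cts_fun.
Qed.

End singular_chains.

Lemma degZ (K : choiceType) (a : int) (c : {freeg K / int}) : deg (a *: c) = a * deg c.
Proof. by rewrite -{1}[a]intz scaler_int raddfMz /= -mulrzr mulrC intz. Qed.

(** * Subdivision of singular chains into small simplices *)

Section subdivision.
Variables (R : realType) (X : topologicalType).
Local Notation stds m := (set_type (@std_simplex R m)).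
Local Notation chain := (@chain R).
Local Notation simplex := (@simplex R).
Local Notation verts := (@verts R).

Local Notation real_ext s j c := (push (ext s) (lreal j c)).

Lemma carried_lreal m j (c : {freeg (seq 'rV[R]_m.+1) / int}) :
  supported (simplex_in j.+1 (@std_simplex R m)) c ->
  carried (@std_simplex R m) (lreal j c).
Proof.
move=> cS; apply: supportedW (lreal_wf cS) => _ [s [sS _] ->] t.
exact: aff_simplex.
Qed.

Lemma boundary_real_ext m (s : simplex X m) j c :
  supported (simplex_in j.+2 (@std_simplex R m)) c ->
  boundary (real_ext s j.+1 c) = real_ext s j (lbd c).
Proof.
move=> cS; rewrite (push_boundary (@ext_good R X m s)); last exact: carried_lreal.
by rewrite (boundary_lreal cS).
Qed.

Lemma real_ext_verts m (s : simplex X m) : real_ext s m << verts m >> = << s >>.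
Proof.
rewrite lrealU ?size_verts // pushU -chain_of_simplex; congr chain_of.
by apply/funext => t; rewrite /= /mkcts /ext aff_verts valK_simplex.
Qed.

Lemma supported_verts m : supported (simplex_in m.+1 (@std_simplex R m)) << verts m >>.
Proof. by apply: supportedU; exact: verts_in. Qed.

(** This is what lets naturality of the affine operators under [face_fun i] give the compatibility
    of [sd] and [ht] with the singular boundary. *)
Lemma verts_face m (i : 'I_m.+2) :
  take i (verts m.+1) ++ drop i.+1 (verts m.+1) = map (@face_fun R m i) (verts m).
Proof.
have iv : (i < size (verts m.+1))%N by rewrite size_verts.
apply: (@eq_from_nth _ 0) => [|l].
  by rewrite size_map size_cat size_take size_drop iv !size_verts; have := ltn_ord i; lia.
rewrite size_cat size_take iv size_drop size_verts => li.
have lm : (l < m.+1)%N by move: li; have := ltn_ord i; lia.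
rewrite nth_take_drop // [RHS](nth_map 0) ?size_verts //.
have [b ->] : exists b : 'I_m.+1, l = b by exists (Ordinal lm).
rewrite (_ : bump i b = lift i b) // !nth_verts; apply/rowP => a; rewrite !mxE eqxx /=.
case: unliftP => [b' ->|->]; first by rewrite mxE /= (inj_eq lift_inj).
by rewrite (negbTE (neq_lift _ _)).
Qed.

Lemma lbd_verts m : lbd << verts m.+1 >> =
  \sum_(i < m.+2) (-1) ^+ i *: lmap (@face_fun R m i) << verts m >>.
Proof.
rewrite lbdU lbd_seq_sum size_verts; apply: eq_bigr => i _.
by rewrite verts_face lmapU.
Qed.

Lemma real_ext_face m (s : simplex X m.+1) (i : 'I_m.+2) j c :
  supported (simplex_in j.+1 (@std_simplex R m)) c ->
  real_ext s j (lmap (@face_fun R m i) c) = real_ext (s \o face i : simplex X m) j c.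
Proof.
move=> cS; rewrite -(push_lreal _ cS).
have fg : good_on R (@face_fun R m i) (@std_simplex R m).
  move=> l t _ x; apply: (@continuous_comp _ _ _ t); first exact: cts_fun.
  exact: face_fun_continuous.
rewrite (push_push _ fg); last exact: carried_lreal.
apply: (push_eq _ (carried_lreal cS)) => v vS; rewrite /ext /=; congr (s _); apply: val_inj.
by rewrite tosimplexK /= ?tosimplexK //; exact: face_fun_simplex.
Qed.

Definition sd k m : chain X m -> chain X m :=
  fglift (fun s : simplex X m => real_ext s m (lsdn k << verts m >>)).

Definition ht k m : chain X m -> chain X m.+1 :=
  fglift (fun s : simplex X m => real_ext s m.+1 (lhtn k << verts m >>)).

HB.instance Definition _ k m := GRing.Linear.on (@sd k m).
HB.instance Definition _ k m := GRing.Linear.on (@ht k m).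

Lemma lhtn_nil k : lhtn k << [::] >> = 0 :> {freeg (seq 'rV[R]_1) / int}.
Proof.
have sd0 i : lsdn i << [::] >> = << [::] >> :> {freeg (seq 'rV[R]_1) / int}.
  by elim: i => [|i IH]; rewrite ?lsdn0 // lsdnS IH lsd_nil.
by elim: k => [|k IH]; rewrite ?lhtn0 // lhtnS IH sd0 lht_nil addr0.
Qed.

(** Stated apart because singular chains have no boundary in dimension 0. In the list complex the
    remaining term is the homotopy of [[::]], which is 0. *)
Lemma boundary_ht0 k (c : chain X 0) : boundary (ht k c) = c - sd k c.
Proof.
apply: (linear_eq (F := @boundary R X 0 \o @ht k 0) (G := idfun \- @sd k 0)) => s /=.
rewrite [ht _ _]fgliftU [sd _ _]fgliftU boundary_real_ext; last first.
  by apply: supported_lhtn; [exact: bary_closed_simplex | exact: supported_verts].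
rewrite lbd_lhtn !linearB /= real_ext_verts.
have -> : lbd << verts 0 >> = << [::] >>.
  by rewrite lbdU lbd_seq_sum size_verts big_ord1 expr0 scale1r take0 drop_oversize ?size_verts.
by rewrite lhtn_nil !linear0 addr0.
Qed.

Lemma boundary_ht k m (c : chain X m.+1) :
  boundary (ht k c) = c - sd k c - ht k (boundary c).
Proof.
apply: (linear_eq (F := @boundary R X m.+1 \o @ht k m.+1)
  (G := (idfun \- @sd k m.+1) \- (@ht k m \o @boundary R X m))) => s /=.
rewrite [ht _ << _ >>]fgliftU [sd _ _]fgliftU boundary_real_ext; last first.
  by apply: supported_lhtn; [exact: bary_closed_simplex | exact: supported_verts].
rewrite lbd_lhtn !linearB /= real_ext_verts; congr (_ - _).
rewrite [boundary _]fgliftU lbd_verts !linear_sum; apply: eq_bigr => i _.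
rewrite !linearZ /=; congr (_ *: _); rewrite lhtn_lmap real_ext_face; last first.
  by apply: supported_lhtn; [exact: bary_closed_simplex | exact: supported_verts].
by rewrite [RHS]fgliftU.
Qed.

(** Inherited from the list complex: a singular simplex is the image of the list of vertices of the
    standard simplex. *)
Lemma boundary_boundary m (c : chain X m.+2) : boundary (boundary c) = 0.
Proof.
apply: (linear_eq (F := @boundary R X m \o @boundary R X m.+1) (G := \0)) => s /=.
rewrite -real_ext_verts boundary_real_ext; last exact: supported_verts.
rewrite boundary_real_ext; last by apply: supported_lbd; exact: supported_verts.
by rewrite lbd_lbd !linear0.
Qed.

Lemma deg_boundary (c : chain X 1) : deg (boundary c) = 0.
Proof.
rewrite (freegE c) linear_sum raddf_sum big1 // => s _; rewrite linearZ /=.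
rewrite degZ [boundary _]fgliftU big_ord_recl big_ord1 /=.
by rewrite expr0 expr1 scale1r scaleN1r raddfB /= !degU subrr mulr0.
Qed.

Lemma carried_ht k m A (c : chain X m) : carried A c -> carried A (ht k c).
Proof.
apply: supported_lift => s As; apply: (@carried_push _ _ _ _ _ setT) => //.
by move=> x _; exact: As.
Qed.

Lemma std_simplex_compact m : compact (@std_simplex R m).
Proof.
apply: bounded_closed_compact.
  exists 1; split => // M M1 t [t0 t1] /=; rewrite (le_trans _ (ltW M1)) //.
  rewrite [leLHS]mx_normrE; apply/bigmax_leP; split => // -[a i] _ /=.
  rewrite (ord1 a) ger0_norm // -t1 (bigD1 i) //= lerDl sumr_ge0 //.
have -> : @std_simplex R m = \bigcap_(i : 'I_m.+1) ((fun t : 'rV[R]_m.+1 => t 0 i) @^-1` [set x | 0 <= x])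
    `&` ((fun t : 'rV[R]_m.+1 => \sum_i t 0 i) @^-1` [set 1]).
  apply/seteqP; split => t [H1 H2]; split => //; first by move=> i _; exact: H1.
  by move=> i; exact: H1.
apply: closedI.
  apply: closed_bigI => i _; apply: closed_comp; last exact: closed_ge.
  by move=> t _; exact: coord_continuous.
apply: closed_comp; last exact: closed_eq.
move=> t _; apply: (@continuous_sum _ _ R^o) => i; exact: coord_continuous.
Qed.

(** A Lebesgue number of the cover of the standard simplex by the preimages of [U] and [V]. *)
Lemma lebesgue_simplex m (s : simplex X m) (U V : set X) : open U -> open V ->
  inside (U `|` V) s ->
  exists2 d : R, 0 < d & forall v, std_simplex v ->
    (forall w, std_simplex w -> `|v - w| < d -> U (ext s w)) \/
    (forall w, std_simplex w -> `|v - w| < d -> V (ext s w)).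
Proof.
move=> oU oV sUV.
have loc (W : set X) (v : 'rV[R]_m.+1) : open W -> std_simplex v -> W (ext s v) ->
    exists2 e : R, 0 < e & forall w, std_simplex w -> `|v - w| < e -> W (ext s w).
  move=> oW vS Wv.
  have oP : open (s @^-1` W) by apply: open_comp => // x _; exact: cts_fun.
  case: oP => B oB sB.
  have Bv : B v.
    have : (set_val @^-1` B) (tosimplex v) by rewrite sB.
    by rewrite set_valE /= tosimplexK.
  have /nbhs_ballP[e /= e0 eB] : nbhs v B by exact: open_nbhs_nbhs.
  exists e => // w wS vw.
  have Bw : B w by apply: eB; rewrite -ball_normE.
  have : (s @^-1` W) (tosimplex w) by rewrite -sB /= set_valE tosimplexK.
  by [].
(* With [d] tending to 0 from the right, compactness turns a radius valid near each point into a
   uniform one. *)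
have := (compact_near_coveringP _).1 (@std_simplex_compact m).
move=> /(_ R (0%R^'+) (fun d v => (forall w, std_simplex w -> `|v - w| < d -> U (ext s w)) \/
    (forall w, std_simplex w -> `|v - w| < d -> V (ext s w))) _).
have main : forall v, @std_simplex R m v -> exists2 e : R, 0 < e &
    (forall w, std_simplex w -> `|v - w| < e -> U (ext s w)) \/
    (forall w, std_simplex w -> `|v - w| < e -> V (ext s w)).
  move=> v vS; case: (sUV (tosimplex v)) => Wv.
    by have [e e0 He] := loc U v oU vS Wv; exists e => //; left.
  by have [e e0 He] := loc V v oV vS Wv; exists e => //; right.
case.
  move=> v vS; have [e e0 He] := main v vS.
  (* Half for the displacement of the center, half for the radius [d]. *)
  have e20 : 0 < e / 2 by rewrite divr_gt0.
  exists (ball v (e / 2), [set d | d < e / 2]) => /=.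
    by split; [exact: nbhsx_ballx | exact: nbhs_right_lt].
  move=> [v' d] /= []; rewrite -ball_normE /= => vv' de.
  have tri w : `|v' - w| < d -> `|v - w| < e.
    move=> wd; rewrite -(subrK v' v) -addrA (le_lt_trans (ler_normD _ _)) //.
    by rewrite [e]splitr ltrD // (lt_trans wd).
  case: He => He; [left|right] => w wS /tri; exact: He.
move=> e /= e0 He; exists (e / 2); first by rewrite divr_gt0.
apply: He; last by rewrite divr_gt0.
rewrite /ball_ /= sub0r normrN gtr0_norm ?divr_gt0 // ltr_pdivrMr // mulr_natr mulr2n.
by rewrite ltrDr.
Qed.

Lemma small_simplex m (s : simplex X m) (U V : set X) : open U -> open V ->
  inside (U `|` V) s ->
  exists k0, forall k, (k0 <= k)%N ->
    supported (fun t : simplex X m => inside U t \/ inside V t) (sd k << s >>).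
Proof.
move=> oU oV sUV; have [d d0 Hd] := lebesgue_simplex oU oV sUV.
have m1 : `|m%:R / m.+1%:R : R| < 1.
  by rewrite ger0_norm ?divr_ge0 // ltr_pdivrMr ?ltr0n // mul1r ltr_nat.
have := cvg_geometric 1 m1.
move/cvgrPdist_lt => /(_ d d0) [k0 _ Hk]; exists k0 => k kk0.
have {}Hk := Hk k kk0.
rewrite [sd _ _]fgliftU.
(* In the maximum norm the vertices of the standard simplex are at distance at most 1. *)
have sup1 : supported (mesh_le m.+1 ((m%:R / m.+1%:R) ^+ k * (1:R))) (lsdn k << verts m >>).
  apply: supported_lsdn_mesh; apply: supportedU; split; first exact: size_verts.
  move=> v w /mapP[i _ ->] /mapP[j _ ->].
  rewrite [leLHS]mx_normrE; apply/bigmax_leP; split => // -[a l] _ /=.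
  rewrite !mxE; case: (_ && _); case: (_ && _) => /=;
    by rewrite ?subrr ?normr0 ?subr0 ?sub0r ?normrN ?normr1.
have sup2 : supported (simplex_in m.+1 (@std_simplex R m)) (lsdn k << verts m >>).
  by apply: supported_lsdn; [exact: bary_closed_simplex | exact: supported_verts].
have sup : supported (fun z => mesh_le m.+1 ((m%:R / m.+1%:R) ^+ k * (1:R)) z /\
  simplex_in m.+1 (@std_simplex R m) z) (lsdn k << verts m >>).
  by move=> z zk; split; [exact: sup1 | exact: sup2].
apply: (@supported_lift _ _ _ _ _ _ _ (lreal_wf sup)) => _ [z [[zmesh zS] sz] ->].
have z0S : std_simplex (nth 0 z 0) by apply: zS.2; rewrite mem_nth // sz.
(* A point of an affine simplex is a convex combination of its vertices, hence no farther from one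
   of them than the mesh. *)
have close (t : stds m) : `|nth 0 z 0 - aff z t| < d.
  have [t0 t1] := set_valP t.
  apply: le_lt_trans (_ : (m%:R / m.+1%:R) ^+ k < d); last first.
    move: Hk; rewrite sub0r normrN ger0_norm; last by rewrite mulr_ge0 // exprn_ge0 // divr_ge0.
    by rewrite /geometric /= mul1r.
  rewrite -[X in X - _]scale1r -[X in X *: _ - _]t1 scaler_suml /aff -sumrB.
  under eq_bigr do rewrite -scalerBr.
  apply: le_trans (ler_norm_sum _ _ _) _; rewrite -[leRHS]mul1r -[X in X * _]t1 mulr_suml ler_sum // => i _.
  rewrite normrZ ger0_norm // ler_wpM2l // -[leRHS]mulr1 zmesh.2 //.
    by rewrite mem_nth // sz.
  by rewrite mem_nth // sz.
have := Hd _ z0S; case=> HW.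
- apply: supportedW (@supported_chain_of _ _ _ U _ _) => [t Ut|t]; first by left.
  by apply: HW; [exact: aff_simplex | exact: close].
- apply: supportedW (@supported_chain_of _ _ _ V _ _) => [t Ut|t]; first by right.
  by apply: HW; [exact: aff_simplex | exact: close].
Qed.

Lemma small_chain m (c : chain X m) (U V : set X) : open U -> open V ->
  carried (U `|` V) c ->
  exists k, supported (fun t : simplex X m => inside U t \/ inside V t) (sd k c).
Proof.
move=> oU oV cUV.
have [f Hf] : exists f : simplex X m -> nat, forall s, s \in dom c ->
    forall k, (f s <= k)%N ->
    supported (fun t : simplex X m => inside U t \/ inside V t) (sd k << s >>).
  have := @choice (simplex X m) nat (fun s k0 => s \in dom c -> forall k, (k0 <= k)%N ->
    supported (fun t : simplex X m => inside U t \/ inside V t) (sd k << s >>)).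
  case=> [s|f Hf]; last by exists f.
  have [sc|sc] := boolP (s \in dom c); last by exists 0%N.
  by have [k0 Hk0] := small_simplex oU oV (cUV s sc); exists k0.
(* Since [small_simplex] holds for all large [k], one [k] serves the whole support. *)
exists (\max_(s <- dom c) f s)%N; rewrite (freegE c) linear_sum big_seq /=.
elim/big_ind: _ => [||s sc]; [exact: supported0|exact: supportedD|].
rewrite linearZ; apply: supportedZ; apply: Hf => //.
by rewrite -freegE; apply: leq_bigmax_seq.
Qed.

End subdivision.

Lemma continuous_row (R : realType) (T : topologicalType) N (f : T -> 'rV[R]_N) :
  (forall i, continuous (fun t => f t 0 i : R^o)) -> continuous f.
Proof.
move=> fc; have -> : f = fun t => \sum_i f t 0 i *: delta_mx 0 i.
  by apply/funext => t; exact: row_sum_delta.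
apply: continuous_sum => i t; exact: (@cvgZr_tmp R _ _ (nbhs t) _ (fun t => f t 0 i) _ _ (fc i t)).
Qed.

Section continuous_real_functions.
Variables (R : realType) (T : topologicalType).
Implicit Types f g : T -> R.

Lemma continuousD_real f g : continuous f -> continuous g -> continuous (fun t => f t + g t).
Proof. by move=> fc gc t; apply: (@cvgD R R^o); [exact: fc | exact: gc]. Qed.

Lemma continuousB_real f g : continuous f -> continuous g -> continuous (fun t => f t - g t).
Proof. by move=> fc gc t; apply: (@cvgB R R^o); [exact: fc | exact: gc]. Qed.

Lemma continuousM_real f g : continuous f -> continuous g -> continuous (fun t => f t * g t).
Proof. by move=> fc gc t; apply: cvgM; [exact: fc | exact: gc]. Qed.

Lemma continuousV_real f : (forall t, f t != 0) -> continuous f ->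
  continuous (fun t => (f t)^-1).
Proof. by move=> f0 fc t; apply: cvgV; [exact: f0 | exact: fc]. Qed.

Lemma continuousZ_real (V : normedModType R) f (g : T -> V) :
  continuous f -> continuous g -> continuous (fun t => f t *: g t).
Proof. by move=> fc gc t; apply: cvgZ; [exact: fc | exact: gc]. Qed.

End continuous_real_functions.

(** * Cones over singular chains *)

Section cone.
Variables (R : realType) (V : normedModType R) (apex : V).
Local Notation stds m := (set_type (@std_simplex R m)).
Local Notation chain := (@chain R).
Local Notation simplex := (@simplex R).

(* Away from a neighbourhood of the apex, [collapse] is the radial projection on
   the opposite face; near it, [cone_fun] is constant, so that the values of
   [collapse] do not matter there. *)
Definition collapse m (t : 'rV[R]_m.+2) : 'rV[R]_m.+1 :=
  let M := Num.max (1 - t 0 ord0) 2^-1 in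
  \row_i (t 0 (lift ord0 i) / M + (1 - (1 - t 0 ord0) / M) * (i == ord0)%:R).

Definition cone_weight m (t : 'rV[R]_m.+2) : R := Num.min 1 (2 * t 0 ord0).

Definition cone_fun m (s : stds m -> V) (t : stds m.+1) : V :=
  cone_weight (val t) *: apex + (1 - cone_weight (val t)) *: s (tosimplex (collapse (val t))).

Lemma collapse_simplex m (t : 'rV[R]_m.+2) : std_simplex t -> std_simplex (collapse t).
Proof.
move=> [t0 t1]; rewrite /collapse; set M := Num.max _ _.
have M0 : 0 < M by rewrite lt_max invr_gt0 ltr0n orbT.
have tM : (1 - t 0 ord0) / M <= 1 by rewrite ler_pdivrMr // mul1r le_max lexx.
split=> [i|].
  rewrite mxE addr_ge0 // ?mulr_ge0 // ?invr_ge0 ?(ltW M0) //.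
  by rewrite subr_ge0.
under eq_bigr do rewrite mxE.
rewrite big_split /= -mulr_suml -mulr_sumr.
have -> : \sum_(i < m.+1) (i == ord0)%:R = 1 :> R.
  by rewrite (bigD1 ord0) //= big1 ?addr0 // => i /negbTE ->.
move: t1; rewrite big_ord_recl /= => t1.
have -> : \sum_(i < m.+1) t 0 (lift ord0 i) = 1 - t 0 ord0 by rewrite -t1 addrC addKr.
by rewrite mulr1 addrC subrK.
Qed.

Lemma collapse_continuous m : continuous (fun t : stds m.+1 => collapse (val t)).
Proof.
have cst_c (x : R) : continuous (fun _ : stds m.+1 => x) by exact: cst_continuous.
have tc : continuous (fun t : stds m.+1 => 1 - (val t) 0 ord0).
  by apply: continuousB_real => //; exact: coord_simplex_continuous.
have Mc : continuous (fun t : stds m.+1 => (Num.max (1 - (val t) 0 ord0) 2^-1)^-1).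
  apply: continuousV_real => t; first by rewrite gt_eqF // lt_max invr_gt0 ltr0n orbT.
  exact: (@continuous_max R _ (fun t : stds m.+1 => 1 - (val t) 0 ord0 : R^o) (fun=> 2^-1) t
    (tc t) (cst_c _ t)).
apply: continuous_row => i; rewrite /collapse.
under eq_fun do rewrite mxE.
apply: continuousD_real.
  by apply: continuousM_real => //; exact: coord_simplex_continuous.
by apply: continuousM_real => //; apply: continuousB_real => //; exact: continuousM_real.
Qed.

Lemma cone_fun_continuous m (s : stds m -> V) : continuous s -> continuous (cone_fun s).
Proof.
move=> sc.
have cst_c (x : R) : continuous (fun _ : stds m.+1 => x) by exact: cst_continuous.
have wc : continuous (fun t : stds m.+1 => cone_weight (val t)).
  have tc : continuous (fun t : stds m.+1 => 2 * (val t) 0 ord0).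
    by apply: continuousM_real => //; exact: coord_simplex_continuous.
  move=> t; exact: (@continuous_min R _ (fun=> 1)
    (fun t : stds m.+1 => 2 * (val t) 0 ord0 : R^o) t (cst_c _ t) (tc t)).
have cc : continuous (fun t : stds m.+1 => tosimplex (collapse (val t))).
  apply: continuous_comp_initial.
  have -> : set_val \o (fun t : stds m.+1 => tosimplex (collapse (val t))) =
      (fun t : stds m.+1 => collapse (val t)).
    by rewrite set_valE; apply/funext => u /=; rewrite tosimplexK //;
       apply: collapse_simplex; exact: set_valP.
  exact: collapse_continuous.
have w1c : continuous (fun t : stds m.+1 => 1 - cone_weight (val t)) by exact: continuousB_real.
have sc' : continuous (fun t : stds m.+1 => s (tosimplex (collapse (val t)))).
  by move=> t; exact: (continuous_comp (cc t) (sc _)).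
move=> t; apply: (@cvgD R V _ (nbhs t)).
  exact: (@continuousZ_real R _ V _ _ wc (@cst_continuous _ _ apex) t).
exact: (@continuousZ_real R _ V _ _ w1c sc' t).
Qed.

Definition cone m : chain V m -> chain V m.+1 :=
  fglift (fun s : simplex V m => chain_of (cone_fun s)).

HB.instance Definition _ m := GRing.Linear.on (@cone m).

Lemma cone_face0 m (s : stds m -> V) : cone_fun s \o face ord0 = s.
Proof.
apply/funext => t; have [t0 t1] := set_valP t; rewrite /cone_fun /cone_weight /=.
rewrite mxE unlift_none mulr0 minEle ler10 scale0r add0r subr0 scale1r; congr s.
apply: val_inj; rewrite tosimplexK; last first.
  by apply: collapse_simplex; apply: face_fun_simplex; exact: set_valP.
apply/rowP => i; rewrite !mxE unlift_none subr0 liftK.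
have -> : Num.max 1 2^-1 = 1 :> R by rewrite maxEle; case: leP => //; lra.
by rewrite !divr1 subrr mul0r addr0.
Qed.

Lemma face_head m (i : 'I_m.+2) (t : 'rV[R]_m.+2) :
  face_fun (lift ord0 i) t 0 ord0 = t 0 ord0.
Proof.
rewrite mxE (_ : ord0 = lift (lift ord0 i) ord0) ?liftK //.
by apply: val_inj; rewrite /= /bump /=; lia.
Qed.

Lemma face_tail m (i : 'I_m.+2) (t : 'rV[R]_m.+2) j :
  face_fun (lift ord0 i) t 0 (lift ord0 j) = face_fun i (\row_j t 0 (lift ord0 j)) 0 j.
Proof.
rewrite !mxE; case: (unliftP i j) => [l ->|->]; last by rewrite unlift_none.
rewrite (_ : lift ord0 (lift i l) = lift (lift ord0 i) (lift ord0 l)) ?liftK ?mxE //.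
by apply: val_inj; rewrite /= /bump /=; lia.
Qed.

Lemma cone_faceS m (s : stds m.+1 -> V) (i : 'I_m.+2) :
  cone_fun s \o face (lift ord0 i) = cone_fun (s \o face i).
Proof.
apply/funext => t; rewrite /cone_fun /= /cone_weight face_head.
(* For t_0 >= 1/2 both sides are the apex. Otherwise the maximum in [collapse] is 1 - t_0, and the
   radial projection commutes with faces. *)
have [t12|t12] := leP 1 (2 * (val t) 0 ord0).
  by rewrite subrr !scale0r.
congr (_ + _ *: s _); apply: val_inj.
rewrite /= !tosimplexK; last 2 first.
- exact/collapse_simplex/set_valP.
- exact/collapse_simplex/face_fun_simplex/set_valP.
have E (M : R) : 1 - (val t) 0 ord0 = M -> M = Num.max (1 - (val t) 0 ord0) 2^-1.
  by move=> <-; rewrite maxEle; case: leP => //; lra.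
apply/rowP => j; rewrite [LHS]mxE face_head face_tail -(E _ erefl).
have n0 : 1 - (val t) 0 ord0 != 0 by rewrite subr_eq0 eq_sym lt_eqF //; lra.
rewrite divff // subrr mul0r addr0 !mxE; case: unlift => [l|]; last by rewrite mul0r.
by rewrite !mxE -(E _ erefl) divff // subrr mul0r addr0.
Qed.

Lemma boundary_cone m (c : chain V m.+1) : boundary (cone c) = c - cone (boundary c).
Proof.
apply: (linear_eq (F := @boundary R V m.+1 \o @cone m.+1)
  (G := idfun \- (@cone m \o @boundary R V m))) => s /=.
rewrite [cone _]fgliftU boundary_chain_of; last by apply: cone_fun_continuous; exact: cts_fun.
rewrite big_ord_recl expr0 scale1r cone_face0 chain_of_simplex; congr (_ + _).
rewrite [boundary _]fgliftU linear_sum -sumrN; apply: eq_bigr => i _.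
by rewrite cone_faceS linearZ /= [cone _]fgliftU /bump /= exprS mulN1r scaleNr.
Qed.

Definition pt_simplex : simplex V 0 := mkcts (@cst_continuous (stds 0) V apex).

(** In dimension 0 the second face of a cone is its apex, counted once for each point; hence the
    degree, and the role of chains of degree 0 as reduced cycles. *)
Lemma boundary_cone0 (c : chain V 0) : boundary (cone c) = c - deg c *: << pt_simplex >>.
Proof.
have degl : linear (fun c : chain V 0 => deg c *: (<< pt_simplex >> : chain V 0)).
  by move=> a u v; rewrite degD degZ scalerDl scalerA.
pose D := GRing.isLinear.Build int (chain V 0) (chain V 0) _ _ degl.
pose D' : {linear chain V 0 -> chain V 0} := HB.pack (fun c : chain V 0 => deg c *: (<< pt_simplex >> : chain V 0)) D.
apply: (linear_eq (F := @boundary R V 0 \o @cone 0) (G := idfun \- D')) => s /=.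
rewrite [cone _]fgliftU boundary_chain_of; last by apply: cone_fun_continuous; exact: cts_fun.
rewrite big_ord_recl big_ord1 expr0 scale1r cone_face0 chain_of_simplex; congr (_ + _).
rewrite /= degU scale1r /bump /= expr1 scaleN1r -chain_of_simplex; congr (- chain_of _).
apply/funext => t; rewrite /= /mkcts /cst /cone_fun /cone_weight.
have -> : val (face (lift ord0 ord0) t) 0 ord0 = 1.
  have [_ ] := set_valP t; rewrite big_ord1 => <-.
  by rewrite /= mxE; case: unliftP => [l _|//]; rewrite (ord1 l).
by rewrite minEle mulr1 ler1n /= subrr scale1r scale0r addr0.
Qed.

Definition starshaped (A : set V) := A apex /\
  forall x (a : R), A x -> 0 <= a <= 1 -> A (a *: apex + (1 - a) *: x).

Lemma carried_cone m A (c : chain V m) : starshaped A -> carried A c -> carried A (cone c).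
Proof.
move=> [_ As]; apply: supported_lift => s sA; apply: supported_chain_of => t.
apply: As; first exact: sA.
have [t0 _] := set_valP t.
by rewrite /cone_weight le_min ler01 mulr_ge0 //= ge_min lexx.
Qed.

End cone.

(** * Upper bounds for homology ranks, and Mayer-Vietoris *)

Section homological_dimension.
Variables (R : realType).
Local Notation stds m := (set_type (@std_simplex R m)).
Local Notation chain := (@chain R).
Local Notation simplex := (@simplex R).
Implicit Types X Y : topologicalType.

Definition bounds X m (A : set X) (c : chain X m) :=
  exists2 b : chain X m.+1, carried A b & boundary b = c.

Lemma bounds0 X m (A : set X) : bounds A (0 : chain X m).
Proof. by exists 0; [exact: supported0 | rewrite linear0]. Qed.

Lemma boundsD X m (A : set X) (c d : chain X m) : bounds A c -> bounds A d -> bounds A (c + d).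
Proof.
by move=> [b Ab <-] [b' Ab' <-]; exists (b + b'); [exact: supportedD | rewrite linearD].
Qed.

Lemma boundsS X m (A B : set X) (c : chain X m) : A `<=` B -> bounds A c -> bounds B c.
Proof. by move=> AB [b Ab <-]; exists b => //; exact: carriedS Ab. Qed.

(* Cycles of the augmented complex. *)
Definition reduced_cycle X m : chain X m -> Prop :=
  if m is m'.+1 then fun c => boundary c = 0 else fun c => deg c = 0.

(* The classes of the cycles carried by [A] inject into Z^r, in the weak form
   that any finite family of them has integral coordinates in Z^r. *)
Definition rank_le X m (cyc : chain X m -> Prop) (A : set X) r :=
  forall n (z : 'I_n -> chain X m), (forall i, cyc (z i) /\ carried A (z i)) ->
  exists M : 'M[int]_(n, r), forall a : 'rV[int]_n, a *m M = 0 ->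
    bounds A (\sum_i a 0 i *: z i).

Definition homology_le X (A : set X) m r := rank_le (@is_cycle R X m) A r.
Definition reduced_homology_le X (A : set X) m r := rank_le (@reduced_cycle X m) A r.

Lemma carried_lin X m (A : set X) n (a : 'rV[int]_n) (z : 'I_n -> chain X m) :
  (forall i, carried A (z i)) -> carried A (\sum_i a 0 i *: z i).
Proof. by move=> zA; apply: supported_sum => i; apply: supportedZ; exact: zA. Qed.

Section split.
Variables (X : topologicalType) (m : nat) (U V : set X).

Lemma split_carried (c : chain X m) :
  supported (fun t : simplex X m => inside U t \/ inside V t) c ->
  exists u v, [/\ c = u + v, carried U u & carried V v].
Proof.
move=> cUV; pose pr : chain X m -> chain X m :=
  fglift (fun s : simplex X m => if `[< inside U s >] then << s >> : chain X m else 0).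
exists (pr c), (c - pr c); split; first by rewrite addrC subrK.
  apply: supported_lift cUV => s _; case: asboolP => sU; last exact: supported0.
  exact: supportedU.
have -> : c - pr c = fglift (fun s : simplex X m =>
    if `[< inside U s >] then 0 else << s >> : chain X m) c.
  apply: (linear_eq (F := idfun \- fglift (fun s : simplex X m =>
    if `[< inside U s >] then << s >> : chain X m else 0))
   (G := fglift (fun s : simplex X m => if `[< inside U s >] then 0 else << s >> : chain X m))).
  by move=> s /=; rewrite !fgliftU; case: ifP => _; rewrite ?subrr ?subr0.
apply: supported_lift cUV => s [|] sU; case: asboolP => // _; first exact: supported0.
  exact: supported0.
exact: supportedU.
Qed.

Hypotheses (oU : open U) (oV : open V).

(** For a cycle the homotopy formula reduces to c - sd c = boundary of [ht c], and the subdivided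
    chain is small enough to be split. *)
Lemma split_cycle (c : chain X m) : reduced_cycle c -> carried (U `|` V) c ->
  exists u v b, [/\ c = u + v + boundary b, carried U u, carried V v & carried (U `|` V) b].
Proof.
move=> cc cUV; have [k] := small_chain oU oV cUV.
move=> /split_carried[u [v [uv uU vV]]].
exists u, v, (ht k c); split=> //; last exact: carried_ht.
rewrite -uv; move: cc {u v uv uU vV cUV}; case: m c => [|m'] c cc.
  by rewrite boundary_ht0 addrC subrK.
by rewrite boundary_ht [boundary c]cc linear0 subr0 addrC subrK.
Qed.

End split.

Section mayer_vietoris.
Variables (E : normedModType R) (U V : set E) (p q : E).
Hypotheses (oU : open U) (oV : open V) (sU : starshaped p U) (sV : starshaped q V).

Lemma starshaped_bounds (A : set E) a m (c : chain E m) : starshaped a A ->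
  reduced_cycle c -> carried A c -> bounds A c.
Proof.
move=> sA cc cA; exists (cone a c); first exact: carried_cone.
case: m c cc cA => [|m] c cc cA.
  by rewrite boundary_cone0 [deg c]cc scale0r subr0.
by rewrite boundary_cone [boundary c]cc linear0 subr0.
Qed.

Lemma bounds_UV m (c : chain E m) (u v : chain E m) b :
  bounds U u -> bounds V v -> carried (U `|` V) b -> c = u + v + boundary b ->
  bounds (U `|` V) c.
Proof.
move=> bu bv bb ->; apply: boundsD; last by exists b.
by apply: boundsD; [apply: boundsS bu | apply: boundsS bv] => x Ux; [left|right].
Qed.

Lemma split_family m n (z : 'I_n -> chain E m) :
  (forall i, reduced_cycle (z i) /\ carried (U `|` V) (z i)) ->
  exists u v b, [/\ forall i, z i = u i + v i + boundary (b i), forall i, carried U (u i),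
    forall i, carried V (v i) & forall i, carried (U `|` V) (b i)].
Proof.
move=> zc.
have /choice[f Hf] : forall i, exists w : chain E m * chain E m * chain E m.+1,
    [/\ z i = w.1.1 + w.1.2 + boundary w.2, carried U w.1.1, carried V w.1.2 &
        carried (U `|` V) w.2].
  move=> i; have [zi1 zi2] := zc i.
  by have [u [v [b H]]] := split_cycle oU oV zi1 zi2; exists (u, v, b).
exists (fun i => (f i).1.1), (fun i => (f i).1.2), (fun i => (f i).2).
by split=> i; have [] := Hf i.
Qed.

Lemma lin_split m n (a : 'rV[int]_n) (z u v : 'I_n -> chain E m) (b : 'I_n -> chain E m.+1) :
  (forall i, z i = u i + v i + boundary (b i)) ->
  \sum_i a 0 i *: z i = \sum_i a 0 i *: u i + \sum_i a 0 i *: v i +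
    boundary (\sum_i a 0 i *: b i).
Proof.
move=> zE; rewrite linear_sum -!big_split /=; apply: eq_bigr => i _.
by rewrite zE !scalerDr linearZ.
Qed.

Lemma deg_lin m n (a : 'rV[int]_n) (z : 'I_n -> chain E m) :
  deg (\sum_i a 0 i *: z i) = \sum_i a 0 i * deg (z i).
Proof. by rewrite raddf_sum; apply: eq_bigr => i _; rewrite /= degZ. Qed.

(** Injectivity of the connecting map, as [U] and [V] are acyclic. For z = u + v + boundary b, the
    class is measured by the cycle boundary u in the intersection. If a combination of these bounds
    a chain e there, then the same combination of the u minus e, and of the v plus e, are cycles in
    starshaped sets, hence bound. *)
Lemma reduced_homology_MV m r :
  reduced_homology_le (U `&` V) m r -> reduced_homology_le (U `|` V) m.+1 r.
Proof.
move=> HUV n z zc; have [u [v [b [zE uU vV bUV]]]] := split_family zc.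
have wE i : boundary (u i) = - boundary (v i).
  apply/eqP; rewrite -addr_eq0; have [+ _] := zc i; rewrite /= zE !linearD /=.
  by rewrite boundary_boundary addr0 => ->.
have [|M HM] := HUV n (fun i => boundary (u i)).
  move=> i; split.
    case: (m) (u i) => [|m'] ui; [exact: deg_boundary | exact: boundary_boundary].
  (* The boundaries of u and of -v are the same chain, so each simplex of its support lies in [U]
     and in [V]. *)
  move=> s sw; have h1 := carried_boundary (uU i) sw.
  have h2 : inside V s.
    have := carried_boundary (supportedN (vV i)); rewrite linearN -wE.
    by move=> /(_ s sw).
  by move=> t; split; [exact: h1 | exact: h2].
exists M => a aM; have [e eUV He] := HM a aM.
apply: (@bounds_UV _ _ (\sum_i a 0 i *: u i - e) (\sum_i a 0 i *: v i + e)
  (\sum_i a 0 i *: b i)).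
- apply: (starshaped_bounds sU); last first.
    apply: supportedB; first exact: carried_lin.
    by apply: carriedS eUV => x [].
  rewrite /= linearB /= He linear_sum; apply/eqP; rewrite subr_eq0; apply/eqP.
  by apply: eq_bigr => i _; rewrite linearZ.
- apply: (starshaped_bounds sV); last first.
    apply: supportedD; first exact: carried_lin.
    by apply: carriedS eUV => x [].
  rewrite /= linearD /= He linear_sum -big_split big1 // => i _.
  by rewrite linearZ /= wE scalerN subrr.
- exact: carried_lin.
- by rewrite (lin_split _ zE) addrACA addNr addr0.
Qed.

Lemma split_deg m n (z u v : 'I_n -> chain E 0) (b : 'I_n -> chain E 1) :
  (forall i, z i = u i + v i + boundary (b i)) -> (forall i, @reduced_cycle E 0 (z i)) ->
  m = 0%N -> forall i, deg (v i) = - deg (u i).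
Proof.
move=> zE zc _ i; have := zc i; rewrite /= zE !degD deg_boundary addr0 addrC.
by move/eqP; rewrite addr_eq0 => /eqP.
Qed.

(** The single coordinate is the degree of the part in [U]: once it vanishes, both parts have degree
    0 and bound. *)
Lemma reduced_homology_MV0 : reduced_homology_le (U `|` V) 0 1.
Proof.
move=> n z zc; have [u [v [b [zE uU vV bUV]]]] := split_family zc.
have vE := split_deg zE (fun i => (zc i).1) erefl.
exists (\col_i deg (u i)) => a /rowP/(_ ord0); rewrite !mxE => aM.
have du : \sum_i a 0 i * deg (u i) = 0.
  by rewrite -[RHS]aM; apply: eq_bigr => i _; rewrite mxE.
apply: (bounds_UV _ _ _ (lin_split a zE)); last exact: carried_lin.
  apply: (starshaped_bounds sU); last exact: carried_lin.
  by rewrite /= deg_lin.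
apply: (starshaped_bounds sV); last exact: carried_lin.
rewrite /= deg_lin; under eq_bigr do rewrite vE mulrN.
by rewrite sumrN du oppr0.
Qed.

(** A multiple of the common point [x], moved from one part to the other, brings both degrees to 0,
    so no coordinate is left. *)
Lemma reduced_homology_MV0_meet x : (U `&` V) x -> reduced_homology_le (U `|` V) 0 0.
Proof.
move=> [Ux Vx] n z zc; have [u [v [b [zE uU vV bUV]]]] := split_family zc.
have vE := split_deg zE (fun i => (zc i).1) erefl.
exists 0 => a _; pose d := \sum_i a 0 i * deg (u i).
apply: (@bounds_UV _ _ (\sum_i a 0 i *: u i - d *: << pt_simplex x >>)
  (\sum_i a 0 i *: v i + d *: << pt_simplex x >>) (\sum_i a 0 i *: b i)).
- apply: (starshaped_bounds sU); first by rewrite /= degB degZ degU deg_lin mulr1 subrr.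
  apply: supportedB; first exact: carried_lin.
  by apply: supportedZ; apply: supportedU => t.
- apply: (starshaped_bounds sV).
    rewrite /= degD degZ degU deg_lin mulr1; under eq_bigr do rewrite vE mulrN.
    by rewrite sumrN addNr.
  apply: supportedD; first exact: carried_lin.
  by apply: supportedZ; apply: supportedU => t.
- exact: carried_lin.
- by rewrite (lin_split _ zE) addrACA addNr addr0.
Qed.

End mayer_vietoris.

(** In degree 0 the degree is added as a coordinate: subtracting it times a base point makes a chain
    reduced. An empty [A] has no base point, but then it carries only the chain 0. *)
Lemma homology_le_of_reduced (E : normedModType R) (A : set E) m r :
  reduced_homology_le A m r -> homology_le A m ((m == 0%N) + r).
Proof.
case: m => [|m] // HA n z zc.
have [[x Ax]|A0] := pselect (exists x, A x); last first.
  exists 0 => a _; rewrite big1; first exact: bounds0.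
  move=> i _; rewrite (_ : z i = 0) ?scaler0 //; apply: carried_set0.
  by apply: carriedS (zc i).2 => y Ay; case: A0; exists y.
have [|M HM] := HA n (fun i => z i - deg (z i) *: << pt_simplex x >>).
  move=> i; split; first by rewrite /= degB degZ degU mulr1 subrr.
  apply: supportedB; first by have [] := zc i.
  by apply: supportedZ; apply: supportedU => t.
exists (row_mx (\col_i deg (z i)) M) => a; rewrite mul_mx_row => aM.
have [a1 a2] : a *m (\col_i deg (z i)) = 0 /\ a *m M = 0.
  by apply: eq_row_mx; rewrite aM row_mx0.
have := HM a a2; congr bounds; under eq_bigr do rewrite scalerBr scalerA.
rewrite sumrB -scaler_suml.
have -> : \sum_i a 0 i * deg (z i) = 0.
  by have /rowP/(_ ord0) := a1; rewrite !mxE => {2}<-; apply: eq_bigr => i _; rewrite mxE.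
by rewrite scale0r subr0.
Qed.

(** As [g] is a left inverse of [f] on [A], a chain bounding the image of a cycle in [B] is sent by
    [g] to one bounding the cycle itself. *)
Lemma homology_le_retract X Y (A : set X) (B : set Y) (f : X -> Y) (g : Y -> X) m r :
  good_on R f A -> good_on R g B -> (forall x, A x -> B (f x)) -> (forall y, B y -> A (g y)) ->
  (forall x, A x -> g (f x) = x) -> homology_le B m r -> homology_le A m r.
Proof.
move=> fA gB fAB gBA gf HB n z zc.
have [|M HM] := HB n (fun i => push f (z i)).
  move=> i; have [zi1 zi2] := zc i; split; last exact: carried_push zi2.
  case: m z zc zi1 zi2 HB => [|m] z zc zi1 zi2 _ //=.
  by rewrite (push_boundary fA zi2) [boundary _]zi1 linear0.
exists M => a /HM[b bB Hb]; exists (push g b); first exact: carried_push bB.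
rewrite (push_boundary gB bB) Hb linear_sum; apply: eq_bigr => i _.
rewrite linearZ /= (push_push _ fA (zc i).2).
by rewrite (push_eq (g := idfun) _ (zc i).2) ?push_id.
Qed.

Lemma homology_le_union X (A B : set X) m r1 r2 :
  (forall j (s : simplex X j), inside (A `|` B) s -> inside A s \/ inside B s) ->
  (forall x, A x -> B x -> False) ->
  homology_le A m r1 -> homology_le B m r2 -> homology_le (A `|` B) m (r1 + r2).
Proof.
move=> sAB AB0 HA HB n z zc.
have /choice[f Hf] : forall i, exists w : chain X m * chain X m,
    [/\ z i = w.1 + w.2, carried A w.1 & carried B w.2].
  move=> i; have [|u [v H]] := @split_carried X m A B (z i); last by exists (u, v).
  by apply: supportedW (zc i).2 => s; exact: sAB.
have cyc i : is_cycle (f i).1 /\ is_cycle (f i).2.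
  have [zE fA fB] := Hf i; have [+ _] := zc i; move: (z i) (f i).1 (f i).2 zE fA fB.
  case: (m) => [//|m'] zi u v -> uA vB /=; rewrite linearD /= => uv0.
  (* The boundary of u is also that of -v, so it is carried by the two disjoint sets at once. *)
  suff u0 : boundary u = 0 by split=> //; rewrite u0 add0r in uv0.
  apply: carried_set0 => s su t; apply: (AB0 (s t)); first exact: carried_boundary uA s su t.
  have uE : boundary u = boundary (- v).
    by rewrite linearN; apply/eqP; rewrite -addr_eq0 uv0.
  have := carried_boundary (supportedN vB); rewrite -uE => /(_ s su t); exact.
have [|MA HMA] := HA n (fun i => (f i).1).
  by move=> i; have [? ? ?] := Hf i; have [? ?] := cyc i.
have [|MB HMB] := HB n (fun i => (f i).2).
  by move=> i; have [? ? ?] := Hf i; have [? ?] := cyc i.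
exists (row_mx MA MB) => a; rewrite mul_mx_row => aM.
have [a1 a2] : a *m MA = 0 /\ a *m MB = 0 by apply: eq_row_mx; rewrite aM row_mx0.
have -> : \sum_i a 0 i *: z i = \sum_i a 0 i *: (f i).1 + \sum_i a 0 i *: (f i).2.
  by rewrite -big_split; apply: eq_bigr => i _; have [-> _ _] := Hf i; rewrite scalerDr.
apply: boundsD.
  by apply: boundsS (HMA a a1) => x; left.
by apply: boundsS (HMB a a2) => x; right.
Qed.

Lemma homology_le_set0 X m : @homology_le X set0 m 0.
Proof.
move=> n z zc; exists 0 => a _; rewrite big1; first exact: bounds0.
by move=> i _; rewrite (carried_set0 (zc i).2) scaler0.
Qed.

End homological_dimension.

(** Rank over the rationals, then multiplication by the product of the denominators. Applied to a
    coordinate matrix, it refutes the independence of more than [r] cycles. *)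
Lemma int_left_kernel n r (M : 'M[int]_(n, r)) : (r < n)%N ->
  exists2 a : 'rV[int]_n, a != 0 & a *m M = 0.
Proof.
move=> rn; pose Q := map_mx (intr : int -> rat) M.
have kn0 : kermx Q != 0.
  rewrite kermx_eq0 /row_free; apply: contraL rn => /eqP <-.
  by rewrite -leqNgt rank_leq_col.
have [v vn0 vQ] : exists2 v : 'rV[rat]_n, v != 0 & v *m Q = 0.
  have [i vn0] : exists i, row i (kermx Q) != 0.
    apply/existsP; apply: contraNT kn0; rewrite negb_exists => /forallP H.
    by apply/eqP/row_matrixP => i; rewrite row0; apply/eqP; have := H i; rewrite negbK.
  by exists (row i (kermx Q)) => //; rewrite -row_mul mulmx_ker row0.
pose D := \prod_j denq (v 0 j).
have Dn0 : D != 0 by apply/prodf_neq0 => j _; exact: denq_neq0.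
pose a := \row_j (numq (v 0 j) * \prod_(l | l != j) denq (v 0 l)).
have aE : map_mx (intr : int -> rat) a = D%:~R *: v.
  apply/rowP => j; rewrite !mxE intrM /D [X in _ = X%:~R * _](bigD1 j) //= intrM [RHS]mulrAC; congr (_ * _).
  by rewrite numqE mulrC.
have Q0 : D%:~R != 0 :> rat by rewrite intr_eq0.
exists a.
  apply: contraNneq vn0 => a0; move: aE; rewrite a0 map_mx0 => /esym/eqP.
  by rewrite scaler_eq0 (negbTE Q0).
have E : map_mx (intr : int -> rat) (a *m M) = 0 by rewrite map_mxM /= aE -scalemxAl vQ scaler0.
apply/rowP => j; have /eqP := congr1 (fun B : 'rV[rat]_r => B 0 j) E.
by rewrite mxE [X in _ == X]mxE intr_eq0 => /eqP ->; rewrite mxE.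
Qed.

(** * Betti numbers of punctured spaces and of unions of fibers *)

Section betti.
Variables (R : realType).
Local Notation stds m := (set_type (@std_simplex R m)).
Local Notation chain := (@chain R).
Local Notation simplex := (@simplex R).

Lemma homology_rank_le (X : topologicalType) m r :
  homology_le R [set: X] m r -> (@homology_rank R X m <= r%:R%:E)%E.
Proof.
move=> HX; apply: ge_ereal_sup => _ [r' [c [cyc ind]] <-]; rewrite lee_fin ler_nat leqNgt.
apply/negP => rr'; have [|M HM] := HX r' c; first by move=> i; split=> // s _ t.
have [a a0 aM] := int_left_kernel M rr'.
have [b _ bE] := HM a aM.
move: a0; apply/negP; rewrite negbK; apply/eqP/rowP => i; rewrite mxE.
by apply: (ind (fun i => a 0 i)); exists b.
Qed.

Lemma homology_rank_ge0 (X : topologicalType) m : (0 <= @homology_rank R X m)%E.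
Proof.
apply: ereal_sup_ubound; exists 0%N => //; exists (fun=> 0); split=> [[]|a _ []] //.
Qed.

Lemma total_betti_le (X : topologicalType) (rk : nat -> nat) (T : nat) :
  (forall m, homology_le R [set: X] m (rk m)) ->
  (forall K, \sum_(0 <= m < K) rk m <= T)%N ->
  (@total_betti R X <= T%:R%:E)%E.
Proof.
move=> HX HT; apply: lime_le.
  by apply: is_cvg_nneseries => m _ _; exact: homology_rank_ge0.
apply: nearW => K; apply: (@le_trans _ _ (\sum_(0 <= m < K) (rk m)%:R%:E)%E).
  by apply: lee_sum => m _; exact: homology_rank_le.
by rewrite sumEFin lee_fin -natr_sum ler_nat.
Qed.

Lemma continuous_good_on (X Y : topologicalType) (f : X -> Y) (A : set X) :
  (forall x, A x -> {for x, continuous f}) -> good_on R f A.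
Proof.
move=> fA m s sA t; apply: continuous_comp; first exact: cts_fun.
exact/fA/sA.
Qed.

Section punctured.
Variable N : nat.

(* The product of a punctured [d]-dimensional space with an [N - d]-dimensional one. *)
Definition punctured d : set 'rV[R]_N := [set x | exists i : 'I_N, (i < d)%N /\ x 0 i != 0].

Lemma open_coord (i : 'I_N) (D : set R) : open D -> open [set x : 'rV[R]_N | D (x 0 i)].
Proof.
move=> oD; apply: (@open_comp _ _ (fun x : 'rV[R]_N => x 0 i)) => // x _.
exact: coord_continuous.
Qed.

Lemma punctured_open d : open (punctured d).
Proof.
have -> : punctured d = \bigcup_(i in [set i : 'I_N | (i < d)%N]) [set x | x 0 i != 0].
  by apply/seteqP; split=> x [j]; [case=> jd xj; exists j | move=> jd xj; exists j].
by apply: bigcup_open => i _; apply: (@open_coord i [set y | y != 0]); exact: open_neq.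
Qed.

Section step.
Variable j : 'I_N.
(** For e = 1 and e = -1 these cover [punctured j.+1] and meet in [punctured j]. Each is starshaped
    about e times the j-th basis vector: it is the complement of a set of points whose first j
    coordinates vanish and on which e x_j <= 0. *)
Let U (e : R) : set 'rV[R]_N := punctured j `|` [set x | 0 < e * x 0 j].

Lemma half_open e : open (U e).
Proof.
apply: openU; first exact: punctured_open.
apply: (@open_coord j [set y | 0 < e * y]).
apply: (@open_comp _ _ ( *%R e) [set y | 0 < y]); last exact: open_gt.
by move=> x _; exact: mulrl_continuous.
Qed.

Lemma half_starshaped (e : R) : 0 < e * e -> starshaped (e *: delta_mx 0 j) (U e).
Proof.
move=> e0; split; first by right; rewrite /= !mxE !eqxx /= mulr1.
move=> x a Ux /andP[a0 a1]; have [a1'|an1] := eqVneq a 1.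
  by right; rewrite a1' subrr scale0r addr0 scale1r /= !mxE !eqxx mulr1.
have a11 : 0 < 1 - a by rewrite subr_gt0 lt_neqAle an1.
case: Ux => [[i [ij xi]]|/= xj]; [left | right].
  exists i; split=> //; rewrite !mxE (_ : (i == j) = false) ?andbF ?mulr0 ?add0r.
    by rewrite mulf_neq0 // gt_eqF.
  by apply/eqP => /(congr1 val) /=; move: ij; lia.
rewrite /= !mxE !eqxx mulr1 mulrDr ltr_wpDl //.
  by rewrite mulrCA mulr_ge0 // ltW.
by rewrite mulrCA mulr_gt0.
Qed.

Lemma half_union : U 1 `|` U (-1) = punctured j.+1.
Proof.
apply/seteqP; split=> x.
  case; case=> [[i [ij xi]]|/= xj].
  - by exists i; split=> //; lia.
  - by exists j; split=> //; rewrite gt_eqF // -[ltRHS]mul1r.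
  - by exists i; split=> //; lia.
  - by exists j; split=> //; rewrite lt_eqF // -oppr_gt0 -mulN1r.
move=> [i [ij xi]]; have [ij'|ij'] := ltnP i j; first by left; left; exists i.
have ji : i = j by apply: val_inj => /=; lia.
rewrite {}ji in xi; case: (ltgtP (x 0 j) 0) xi => // xi _.
- by right; right; rewrite /= mulN1r oppr_gt0.
- by left; right; rewrite /= mul1r.
Qed.

Lemma half_inter : U 1 `&` U (-1) = punctured j.
Proof.
apply/seteqP; split=> [x [[//|/= xj] [//|/= xj']]|x xj]; last by split; left.
by move: xj xj'; rewrite mul1r mulN1r oppr_gt0 => xj /(lt_trans xj); rewrite ltxx.
Qed.

Lemma punctured_step m r : reduced_homology_le R (punctured j) m r ->
  reduced_homology_le R (punctured j.+1) m.+1 r.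
Proof.
rewrite -half_union -half_inter; apply: reduced_homology_MV; try exact: half_open.
- exact: (@half_starshaped 1 ltac:(by rewrite mul1r)).
- exact: (@half_starshaped (-1) ltac:(by rewrite mulrNN mul1r)).
Qed.

(** The two halves are disjoint exactly when j = 0, that is, for a punctured line; otherwise the
    first basis vector lies in both. *)
Lemma punctured_step0 : reduced_homology_le R (punctured j.+1) 0 (val j == 0%N).
Proof.
have s1 : starshaped (1 *: delta_mx 0 j) (U 1) by apply: half_starshaped; rewrite mul1r.
have s2 : starshaped (-1 *: delta_mx 0 j) (U (-1)).
  by apply: half_starshaped; rewrite mulrNN mul1r.
rewrite -half_union; case: eqP => j0.
  exact: (reduced_homology_MV0 (@half_open 1) (@half_open (-1)) s1 s2).
have j0' : (0 < N)%N by exact: leq_ltn_trans (ltn_ord j).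
apply: (reduced_homology_MV0_meet (@half_open 1) (@half_open (-1)) s1 s2
  (x := delta_mx 0 (Ordinal j0'))).
rewrite half_inter; exists (Ordinal j0'); split=> /=; first by rewrite lt0n; apply/eqP.
by rewrite mxE !eqxx oner_eq0.
Qed.

End step.

(** The homology of the sphere of dimension [j]: each Mayer-Vietoris step raises the degree by one,
    starting from the empty [punctured 0]. *)
Lemma punctured_reduced_homology j m : (j < N)%N ->
  reduced_homology_le R (punctured j.+1) m (m == j).
Proof.
elim: j m => [|j IH] [|m] jN.
- exact: (@punctured_step0 (Ordinal jN)).
- apply: (@punctured_step (Ordinal jN)) => /=.
  have -> : punctured 0 = set0 by apply/seteqP; split=> // x [i []].
  move=> n z zc; exists 0 => a _; rewrite big1; first exact: bounds0.
  by move=> i _; rewrite (carried_set0 (zc i).2) scaler0.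
- exact: (@punctured_step0 (Ordinal jN)).
- by rewrite eqSS; apply: (@punctured_step (Ordinal jN)); apply: IH; exact: ltnW.
Qed.

End punctured.

Lemma punctured_homology N m :
  homology_le R [set x : 'rV[R]_N.+1 | x != 0] m ((m == 0%N) + (m == N)).
Proof.
have -> : [set x : 'rV[R]_N.+1 | x != 0] = punctured N.+1.
  apply/seteqP; split=> x /=; last by case=> i [_]; apply: contraNneq => ->; rewrite mxE.
  move=> x0; apply/not_existsP => H; move: x0; apply/negP; rewrite negbK; apply/eqP/rowP => i.
  have := H i; rewrite ltn_ord mxE => /not_andP[] // /negP; rewrite negbK => /eqP.
  by [].
apply: homology_le_of_reduced; exact: punctured_reduced_homology.
Qed.

(** Constant maps make the point a retract of a line, which is starshaped. *)
Lemma point_homology (X : topologicalType) (x : X) m : homology_le R [set x] m (m == 0%N).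
Proof.
apply: (@homology_le_retract R X 'rV[R]_1 [set x] setT (fun=> 0) (fun=> x)) => //.
- by apply: continuous_good_on => y _; exact: cst_continuous.
- by apply: continuous_good_on => y _; exact: cst_continuous.
- rewrite -[X in homology_le _ _ _ X]addn0; apply: homology_le_of_reduced => n z zc.
  exists 0 => a _; apply: (@starshaped_bounds _ _ _ 0); first by split.
    case: m z zc => [|m] z zc /=.
      rewrite raddf_sum big1 // => i _; rewrite /= degZ.
      by have [] := zc i; rewrite /= => -> _; rewrite mulr0.
    rewrite linear_sum big1 // => i _; rewrite linearZ /=.
    by have [] := zc i; rewrite /= => -> _; rewrite scaler0.
  by move=> s _ t.
Qed.

(** Two distinct values would force all intermediate ones along the segment joining their points,
    more than [L] can hold. *)
Lemma finite_valued_simplex (X : topologicalType) (f : X -> R) (L : seq R) m (s : simplex X m) :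
  continuous f -> (forall t, f (s t) \in L) -> forall t t', f (s t) = f (s t').
Proof.
move=> fc fL t t'; apply: contrapT => /eqP ft.
(* Clamping the parameter to [0, 1] keeps the path in the simplex and makes it continuous on the
   whole line. *)
pose cl (x : R) := Num.max 0 (Num.min 1 x).
have cl01 x : 0 <= cl x <= 1 by rewrite /cl le_max lexx /= ge_max ler01 ge_min lexx.
have clc : continuous cl.
  move=> x; apply: (@continuous_max R _ (fun=> 0)); first exact: cst_continuous.
  by apply: (@continuous_min R _ (fun=> 1) id); [exact: cst_continuous | exact: cvg_id].
pose p x := (1 - cl x) *: val t + cl x *: val t'.
have [t0 t1] := set_valP t; have [t0' t1'] := set_valP t'.
have pS x : @std_simplex R m (p x).
  have /andP[c0 c1] := cl01 x; split=> [i|].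
    by rewrite !mxE addr_ge0 // mulr_ge0 // subr_ge0.
  under eq_bigr do rewrite !mxE.
  by rewrite big_split /= -!mulr_sumr t1 t1' !mulr1 subrK.
have pc : continuous p.
  move=> x; apply: cvgD.
    apply: cvgZr_tmp; apply: (@cvgB _ R^o); [exact: cvg_cst | exact: clc].
  apply: cvgZr_tmp; exact: clc.
have gc : continuous (f \o s \o (fun x => tosimplex (p x))).
  move=> x; apply: continuous_comp; last first.
    by apply: continuous_comp; [exact: cts_fun | exact: fc].
  move: x; apply: continuous_comp_initial.
  have -> : set_val \o (fun x => tosimplex (p x)) = p.
    by rewrite set_valE; apply/funext => y /=; rewrite tosimplexK.
  exact: pc.
set g := f \o s \o _ in gc.
have g0 : g 0 = f (s t).
  rewrite /g /= /p /cl minEle ler10 /= maxEle lexx subr0 scale1r scale0r addr0.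
  by rewrite valK_simplex.
have g1 : g 1 = f (s t').
  rewrite /g /= /p /cl minEle lexx /= maxEle ler01 subrr scale1r scale0r add0r.
  by rewrite valK_simplex.
have L0 : (0 < size L)%N.
  by move: (fL t); case: (L).
have ivt v : Num.min (g 0) (g 1) <= v <= Num.max (g 0) (g 1) -> v \in L.
  move=> vb; have [|c _ <-] := IVT ler01 _ vb.
    exact: continuous_subspaceT.
  exact: fL.
(* One more equally spaced value than [L] has entries. *)
pose pt (k : nat) := g 0 + (g 1 - g 0) * (k%:R / (size L)%:R).
have gn : g 1 - g 0 != 0 by rewrite subr_eq0 g0 g1 eq_sym.
have szn : (size L)%:R != 0 :> R by rewrite pnatr_eq0 -lt0n.
have : (size [seq pt k | k <- iota 0 (size L).+1] <= size L)%N.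
  apply: uniq_leq_size.
    rewrite map_inj_uniq ?iota_uniq // => k l /addrI /(mulfI gn) /(mulIf (invr_neq0 szn)).
    by move=> /eqP; rewrite eqr_nat => /eqP.
  move=> _ /mapP[k + ->]; rewrite mem_iota add0n ltnS /= => kL; apply: ivt.
  have : 0 <= k%:R / (size L)%:R :> R by rewrite divr_ge0.
  have : k%:R / (size L)%:R <= 1 :> R by rewrite ler_pdivrMr ?ltr0n // mul1r ler_nat.
  rewrite /pt; move: (k%:R / _) => y y1 y0; rewrite minEle maxEle.
  have y1' : 0 <= 1 - y by rewrite subr_ge0.
  move: (g 0) (g 1) => a b; case: (leP a b) => ab.
    have ba : 0 <= b - a by rewrite subr_ge0.
    have := mulr_ge0 ba y0; have := mulr_ge0 ba y1'; rewrite mulrBr mulr1.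
    by move: ((b - a) * y) => w ? ?; apply/andP; split; lra.
  have ba : 0 <= a - b by rewrite subr_ge0 ltW.
  have := mulr_ge0 ba y0; have := mulr_ge0 ba y1'; rewrite mulrBr mulr1 -(opprB b a) mulNr.
  by move: ((b - a) * y) => w ? ?; apply/andP; split; lra.
by rewrite size_map size_iota ltnn.
Qed.

(** No singular simplex passes from one fiber to another, so the bounds add up over the finitely
    many values. *)
Lemma homology_le_fibers (X : topologicalType) (f : X -> R) (L : seq R) (rk : R -> nat) m :
  continuous f -> uniq L -> {in L, forall l, homology_le R (f @^-1` [set l]) m (rk l)} ->
  homology_le R (f @^-1` [set` L]) m (\sum_(l <- L) rk l).
Proof.
move=> fc; elim: L => [|l L IH] /=.
  move=> _ _; rewrite big_nil.
  have -> : f @^-1` [set` [::]] = set0 by apply/seteqP; split=> x.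
  exact: homology_le_set0.
move=> /andP[lL uL] HL; rewrite big_cons.
have -> : f @^-1` [set` l :: L] = (f @^-1` [set l]) `|` (f @^-1` [set` L]).
  apply/seteqP; split=> x /=; first by rewrite inE => /predU1P[|]; [left|right].
  by case=> [->|xL]; rewrite inE ?eqxx ?xL ?orbT.
apply: homology_le_union.
- move=> j s sL.
  have cst : forall t t', f (s t) = f (s t').
    apply: (@finite_valued_simplex _ f (l :: L)) => // t.
    by case: (sL t) => /= h; rewrite inE ?h ?eqxx ?orbT.
  have [e|ne] := pselect (f (s (svertex0 R j)) = l).
    by left=> t /=; rewrite -e; exact: cst.
  right=> t; case: (sL t) => //= h; case: ne; rewrite -h; exact: cst.
- by move=> x /= -> h; move: lL; rewrite h.
- by apply: HL; rewrite mem_head.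
- by apply: IH => // y yL; apply: HL; rewrite inE yL orbT.
Qed.

End betti.

(** * Spectral decomposition of skew-symmetric matrices *)

Lemma row_sqr_eq0 (R : realDomainType) m (x : 'rV[R]_m) : x *m x^T = 0 -> x = 0.
Proof.
move=> /matrixP/(_ 0 0); rewrite !mxE => x0; apply/rowP => i; rewrite mxE.
have xx j : 0 <= x 0 j * x^T j 0 by rewrite mxE -expr2 sqr_ge0.
have := psumr_eq0P (fun j _ => xx j) x0 (i := i) isT.
by move/eqP; rewrite mxE mulf_eq0 orbb => /eqP.
Qed.

Section symmetric.
Variables (R : rcfType) (m : nat) (S : 'M[R]_m).
Hypothesis S_sym : S^T = S.
Local Notation C := (R[i]%C).
Local Notation toC := (real_complex R).

(** Computed in two ways, y S y^* is both c |y|^2 and its conjugate. *)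
Lemma symmetric_real_eigenvalue (y : 'rV[C]_m) (c : C) : y != 0 ->
  y *m map_mx toC S = c *: y -> c \is Num.real.
Proof.
move=> y0 yS; apply/Num.Theory.CrealP.
pose yc := map_mx (Num.conj : C -> C) y.
have realconj (x : R) : Num.conj (toC x) = toC x.
  by apply/Num.Theory.CrealP; rewrite complex_real.
have ycS : yc *m map_mx toC S = Num.conj c *: yc.
  have : map_mx (Num.conj : C -> C) (y *m map_mx toC S) = map_mx (Num.conj : C -> C) (c *: y).
    by rewrite yS.
  rewrite map_mxM map_mxZ /= => <-; congr (_ *m _); apply/matrixP => i j.
  by rewrite !mxE realconj.
have E : y *m map_mx toC S *m yc^T = y *m (yc *m map_mx toC S)^T.
  have ST : (map_mx toC S)^T = map_mx toC S by apply/matrixP => i j; rewrite !mxE -{2}S_sym mxE.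
  by rewrite trmx_mul ST mulmxA.
move: E; rewrite yS ycS linearZ /= -scalemxAl -scalemxAr => /eqP.
rewrite -subr_eq0 -scalerBl scaler_eq0 => /orP[|].
  by rewrite subr_eq0 => /eqP /esym.
move=> /eqP/matrixP/(_ 0 0); rewrite !mxE => yy0.
have : y = 0.
  apply/rowP => i; rewrite mxE.
  have yyc j : 0 <= y 0 j * yc^T j 0 by rewrite !mxE -Num.Theory.normCK exprn_ge0.
  have /eqP := psumr_eq0P (fun j _ => yyc j) yy0 (i := i) isT.
  by rewrite !mxE -Num.Theory.normCK expf_eq0 /= normr_eq0 => /eqP.
by move=> y00; rewrite y00 eqxx in y0.
Qed.

(** [T] is the matrix of [S] restricted to the row space of [W]. A complex root of its
    characteristic polynomial is an eigenvalue of [S], hence real, and so has a real eigenvector. *)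
Lemma symmetric_eigenvector (W : 'M[R]_m) : W != 0 -> (W *m S <= W)%MS ->
  exists v : 'rV[R]_m, exists a, [/\ v != 0, (v <= W)%MS & v *m S = a *: v].
Proof.
move=> W0 WS; pose B := row_base W; pose T := B *m S *m pinvmx B.
have BS : B *m S = T *m B.
  by rewrite /T mulmxKpV // eq_row_base (submx_trans _ WS) // submxMr // eq_row_base.
have Bf : row_free B by exact: row_base_free.
have r0 : (0 < \rank W)%N by rewrite lt0n mxrank_eq0.
have [|c croot] := closed_rootP (char_poly (map_mx toC T)) _.
  by rewrite size_char_poly eqSS -lt0n.
have : eigenvalue (map_mx toC T) c by rewrite eigenvalue_root_char.
case/eigenvalueP => w wT w0.
have wS : w *m map_mx toC B *m map_mx toC S = c *: (w *m map_mx toC B).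
  by rewrite -mulmxA -map_mxM BS map_mxM mulmxA wT scalemxAl.
have Bf' : row_free (map_mx toC B) by rewrite row_free_map.
have wB0 : w *m map_mx toC B != 0.
  apply: contraNneq w0 => wB; apply/eqP; apply: (row_free_inj Bf').
  by rewrite /= mul0mx.
have creal := symmetric_real_eigenvalue wB0 wS.
move: croot; rewrite -map_char_poly -(RRe_real creal) fmorph_root -eigenvalue_root_char.
case/eigenvalueP => v vT v0; exists (v *m B), (complex.Re c); split.
- apply: contraNneq v0 => vB; apply/eqP; apply: (row_free_inj Bf).
  by rewrite /= mul0mx.
- by rewrite (submx_trans (submxMl _ _)) // eq_row_base.
- by rewrite -mulmxA BS mulmxA vT scalemxAl.
Qed.

End symmetric.

Section orthogonal_projection.
Variables (R : realFieldType) (m : nat) (V : 'M[R]_m).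

Lemma cap_orthogonal : (V :&: kermx V^T)%MS = 0.
Proof.
apply/row_matrixP => i; rewrite row0; apply: row_sqr_eq0; set x := row i _.
have /submxP[y xy] : (x <= V)%MS by rewrite (submx_trans (row_sub _ _)) // capmxSl.
have /sub_kermxP xV : (x <= kermx V^T)%MS by rewrite (submx_trans (row_sub _ _)) // capmxSr.
by rewrite {2}xy trmx_mul mulmxA xV mul0mx.
Qed.

Lemma sum_orthogonal : (1%:M <= V + kermx V^T)%MS.
Proof.
rewrite sub1mx /row_full mxrank_disjoint_sum ?cap_orthogonal //.
by rewrite mxrank_ker mxrank_tr subnKC // rank_leq_row.
Qed.

End orthogonal_projection.

(** * Projections on the singular subspaces of a skew-symmetric matrix *)

Section skew.
Variables (R : realType) (m k : nat) (A : 'M[R]_m) (al : k.-tuple R).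
Hypotheses (A_skew : A^T = - A) (A_unit : A \in unitmx) (A_al : distinct_singular_values A al).
Local Notation S := (A^T *m A).
Local Notation P j := (sv_proj A (tnth al j)).
Local Notation V j := (eigenspace S (tnth al j ^+ 2)).

Lemma gram_sym : S^T = S. Proof. by rewrite trmx_mul trmxK. Qed.

Lemma gramE : S = - (A *m A). Proof. by rewrite A_skew mulNmx. Qed.

Lemma sv_gt0 j : 0 < tnth al j.
Proof.
have [al0 ev] := (A_al.2 (tnth al j)).1 (mem_tnth _ _).
rewrite lt_neqAle al0 andbT; apply: contraTneq ev => <-; apply/negP => /eigenvalueP[v].
rewrite expr0n scale0r mulmxA => vS v0; move/eqP: v0; apply.
have Au' : A^T \in unitmx by rewrite unitmx_tr.
apply: (can_inj (mulmxK Au')); apply: (can_inj (mulmxK A_unit)).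
by rewrite vS !mul0mx.
Qed.

Lemma sv_inj : injective (tnth al).
Proof.
move=> i j ij; apply: val_inj => /=.
have u : uniq al by apply: lt_sorted_uniq; have [] := A_al.
have := nth_uniq 0 (s := al) (i := i) (j := j).
by rewrite !size_tuple !ltn_ord -!tnth_nth ij eqxx => /(_ isT isT u) /esym /eqP.
Qed.

Lemma eigenspace_orth i j p q (v : 'M[R]_(p, m)) (w : 'M[R]_(q, m)) : i != j ->
  (v <= V i)%MS -> (w <= V j)%MS -> v *m w^T = 0.
Proof.
move=> ij /eigenspaceP vS /eigenspaceP wS.
have : v *m S *m w^T = v *m (w *m S)^T by rewrite trmx_mul gram_sym !mulmxA.
rewrite vS wS linearZ /= -scalemxAl -scalemxAr => /eqP.
rewrite -subr_eq0 -scalerBl scaler_eq0 => /orP[|/eqP //].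
rewrite subr_sqr mulf_eq0 (gt_eqF (addr_gt0 (sv_gt0 i) (sv_gt0 j))) orbF subr_eq0 => /eqP /sv_inj.
by move/eqP: ij.
Qed.

Lemma proj_sub p (x : 'M[R]_(p, m)) j : (x *m P j <= V j)%MS.
Proof. exact: proj_mx_sub. Qed.

Lemma proj_id p (x : 'M[R]_(p, m)) j : (x <= V j)%MS -> x *m P j = x.
Proof. by apply: proj_mx_id; exact: cap_orthogonal. Qed.

Lemma proj_other p (x : 'M[R]_(p, m)) i j : i != j -> (x <= V i)%MS -> x *m P j = 0.
Proof.
move=> ij xV; apply: proj_mx_0; first exact: cap_orthogonal.
by apply/sub_kermxP; exact: (eigenspace_orth ij xV (submx_refl _)).
Qed.

Lemma proj_compl p (x : 'M[R]_(p, m)) j : (x - x *m P j) *m (V j)^T = 0.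
Proof.
apply/sub_kermxP; apply: proj_mx_compl_sub.
exact: submx_trans (submx1 _) (sum_orthogonal _).
Qed.

(** The spectral theorem: the common orthogonal complement [K] of the eigenspaces is invariant under
    [S]. Were it nonzero, it would contain an eigenvector, whose eigenvalue is the square of some
    listed singular value. *)
Lemma sum_proj : \sum_j P j = 1%:M.
Proof.
apply/eqP; rewrite -subr_eq0 -opprB oppr_eq0; set W := _ - _.
have WV j : W *m (V j)^T = 0.
  rewrite /W (bigD1 j) //= opprD addrA mulmxDl mulNmx.
  have := proj_compl 1%:M j; rewrite mul1mx => ->; rewrite sub0r mulmx_suml big1 ?oppr0 //.
  by move=> i ij; apply: (eigenspace_orth ij) => //; rewrite -[X in (X <= _)%MS]mul1mx proj_sub.
apply: contraT => W0.
pose K := (\bigcap_j kermx (V j)^T)%MS.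
have KV j : K *m (V j)^T = 0 by apply/sub_kermxP; exact: (bigcapmx_inf j isT (submx_refl _)).
have WS : (K *m S <= K)%MS.
  apply/sub_bigcapmxP => j _; apply/sub_kermxP.
  have /eigenspaceP VS : (V j <= V j)%MS by [].
  have -> : K *m S *m (V j)^T = K *m (V j *m S)^T by rewrite [(_ *m S)^T]trmx_mul gram_sym [RHS]mulmxA.
  by rewrite VS linearZ /= -scalemxAr KV scaler0.
have W1 : K != 0.
  apply: contraNneq W0 => E; rewrite -submx0 -E; apply/sub_bigcapmxP => j _.
  by apply/sub_kermxP.
have [v [a [v0 vW vS]]] := symmetric_eigenvector gram_sym W1 WS.
(* Because a |v|^2 = |v A^T|^2. *)
have a0 : 0 <= a.
  have : v *m S *m v^T = (v *m A^T) *m (v *m A^T)^T by rewrite trmx_mul trmxK !mulmxA.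
  rewrite vS -scalemxAl => /matrixP/(_ 0 0); rewrite !mxE => E.
  have vv : 0 < \sum_j v 0 j * v^T j 0.
    rewrite lt_neqAle sumr_ge0 ?andbT; last by move=> i _; rewrite mxE -expr2 sqr_ge0.
    apply: contraNneq v0 => vv0; apply/eqP; apply: row_sqr_eq0; apply/matrixP => i j.
    by rewrite !ord1 mxE -vv0 mxE.
  rewrite -(pmulr_lge0 _ vv) E sumr_ge0 // => i _; rewrite [X in _ * X]mxE -expr2 sqr_ge0 //.
have sv : singular_value A (Num.sqrt a).
  by split; rewrite ?sqrtr_ge0 // sqr_sqrtr //; apply/eigenvalueP; exists v.
have /tnthP[j aj] := (A_al.2 _).2 sv.
have vV : (v <= V j)%MS by apply/eigenspaceP; rewrite -aj sqr_sqrtr.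
have vV' : (v <= kermx (V j)^T)%MS by apply: submx_trans vW (bigcapmx_inf j isT (submx_refl _)).
move: v0; rewrite -submx0 -(cap_orthogonal (V j)) sub_capmx vV vV'. by [].
Qed.

(** Expanding the identity as the sum of the projections and using orthogonality gives P = P P^T,
    which is symmetric. *)
Lemma projT j : (P j)^T = P j.
Proof.
have E : P j = P j *m (P j)^T.
  rewrite -{1}[P j]mulmx1 -trmx1 -sum_proj linear_sum mulmx_sumr (bigD1 j) //= big1 ?addr0 //.
  move=> i ij; apply: (@eigenspace_orth j i); rewrite 1?eq_sym //.
    by rewrite -[X in (X <= _)%MS]mul1mx proj_sub.
  by rewrite -[X in (X <= _)%MS]mul1mx proj_sub.
by rewrite {2}E {1}E trmx_mul trmxK.
Qed.

Lemma proj_proj i j : P i *m P j = if i == j then P i else 0.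
Proof.
have PV : (P i <= V i)%MS by rewrite -[X in (X <= _)%MS]mul1mx proj_sub.
by case: eqVneq => [<-|ij]; [exact: proj_id | exact: proj_other PV].
Qed.

Lemma proj_sqr j : P j *m A *m A = - tnth al j ^+ 2 *: P j.
Proof.
have /eigenspaceP PV : (P j <= V j)%MS by rewrite -[X in (X <= _)%MS]mul1mx proj_sub.
by rewrite scaleNr -PV gramE mulmxN opprK mulmxA.
Qed.

(** As S = - A^2 commutes with A, each eigenspace is preserved by A. *)
Lemma proj_comm j : A *m P j = P j *m A.
Proof.
have AV i : (P i *m A <= V i)%MS.
  apply/eigenspaceP; have := proj_sqr i; rewrite gramE mulmxN !mulmxA => ->.
  by rewrite -scalemxAl scaleNr opprK.
rewrite -{1}[A]mul1mx -sum_proj !mulmx_suml (bigD1 j) //= big1 ?addr0; first exact: proj_id.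
by move=> i ij; exact: proj_other (AV i).
Qed.

Lemma sv_count : (0 < m)%N -> (0 < k)%N.
Proof.
move=> m0; rewrite lt0n; apply/eqP => k0; have := sum_proj.
rewrite big1 => [E|j _]; last by exfalso; have := leq_ltn_trans (leq0n j) (ltn_ord j); rewrite lt0n => /eqP; apply.
have : (1%:M : 'M[R]_m) (Ordinal m0) (Ordinal m0) = 0 by rewrite -E mxE.
by rewrite mxE eqxx => /eqP; rewrite oner_eq0.
Qed.

End skew.

(** * Zeros of sums of dilates of [phi] *)

Section real_derivatives.
Variable R : realType.
Implicit Types (f g : R -> R) (x a b c : R).

Lemma drv_cst c x : is_derive x (1 : R) (fun=> c) 0.
Proof. exact: is_derive_cst. Qed.

Lemma drv_id x : is_derive x (1 : R) (fun t => t) (1 : R).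
Proof. exact: is_derive_id. Qed.

Lemma drvD f g x a b : is_derive x 1 f a -> is_derive x 1 g b ->
  is_derive x 1 (fun t => f t + g t) (a + b).
Proof. exact: is_deriveD. Qed.

Lemma drvB f g x a b : is_derive x 1 f a -> is_derive x 1 g b ->
  is_derive x 1 (fun t => f t - g t) (a - b).
Proof. exact: is_deriveB. Qed.

Lemma drvM f g x a b : is_derive x 1 f a -> is_derive x 1 g b ->
  is_derive x 1 (fun t => f t * g t) (a * g x + f x * b).
Proof.
move=> fa gb; apply: is_derive_eq (is_deriveM fa gb) _.
by rewrite addrC [in LHS]/GRing.scale /= mulrC.
Qed.

Lemma drvZ c f x a : is_derive x 1 f a -> is_derive x 1 (fun t => c * f t) (c * a).
Proof.
by move=> fa; apply: is_derive_eq (drvM (drv_cst c x) fa) _; rewrite mul0r add0r.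
Qed.

Lemma drvV f x a : f x != 0 -> is_derive x 1 f a ->
  is_derive x 1 (fun t => (f t)^-1) (- a / f x ^+ 2).
Proof.
move=> fx fa; apply: is_derive_eq (is_deriveV fx fa) _.
by rewrite [in LHS]/GRing.scale /= mulNr mulrC mulNr.
Qed.

Lemma drv_dilate f x a c : is_derive (c * x) 1 f a -> is_derive x 1 (fun t => f (c * t)) (c * a).
Proof.
move=> fa; have gc : is_derive x 1 (fun t => c * t) (c * 1) by apply: drvZ; exact: drv_id.
by apply: is_derive_eq (is_derive1_comp fa gc) _; rewrite mulr1 mulrC.
Qed.

Lemma drv_sum I (r : seq I) (P : pred I) (f : I -> R -> R) (d : I -> R) x :
  (forall i, P i -> is_derive x 1 (f i) (d i)) ->
  is_derive x 1 (fun t => \sum_(i <- r | P i) f i t) (\sum_(i <- r | P i) d i).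
Proof.
move=> fd; elim: r => [|i r IH].
  rewrite big_nil; have -> : (fun t => \sum_(i <- [::] | P i) f i t) = fun=> 0.
    by apply/funext => t; rewrite big_nil.
  exact: drv_cst.
rewrite big_cons; case: ifP => Pi.
  have -> : (fun t => \sum_(i <- i :: r | P i) f i t) =
      fun t => f i t + \sum_(i <- r | P i) f i t.
    by apply/funext => t; rewrite big_cons Pi.
  by apply: drvD => //; exact: fd.
have -> // : (fun t => \sum_(i <- i :: r | P i) f i t) = fun t => \sum_(i <- r | P i) f i t.
by apply/funext => t; rewrite big_cons Pi.
Qed.

Lemma drv_within f df a b : (forall x, a <= x <= b -> is_derive x 1 f (df x)) ->
  {within `[a, b], continuous f}.
Proof.
move=> fd; apply: derivable_within_continuous => x; rewrite in_itv /= => xab.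
by have [] := fd x xab.
Qed.

Lemma drv_unique f x a b : is_derive x 1 f a -> is_derive x 1 f b -> a = b.
Proof. by move=> [_ <-] [_ <-]. Qed.

Lemma rolle f df a b : a < b -> (forall x, a <= x <= b -> is_derive x 1 f (df x)) ->
  f a = f b -> exists2 c, a < c < b & df c = 0.
Proof.
move=> ab fd fab; have [|c] := @Rolle _ f a b ab _ (drv_within fd) fab.
  by move=> x; rewrite in_itv /= => /andP[ax xb]; have [|] := fd x; rewrite ?(ltW ax) ?(ltW xb).
rewrite in_itv /= => /andP[ac cb] f0; exists c; first by rewrite ac.
by apply: drv_unique f0; apply: fd; rewrite (ltW ac) (ltW cb).
Qed.

Lemma mean_value f df a b : a < b -> (forall x, a <= x <= b -> is_derive x 1 f (df x)) ->
  exists2 c, a < c < b & f b - f a = df c * (b - a).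
Proof.
move=> ab fd; have [|c] := @MVT _ f df a b ab _ (drv_within fd).
  by move=> x; rewrite in_itv /= => /andP[ax xb]; apply: fd; rewrite (ltW ax) (ltW xb).
by rewrite in_itv /= => cab fab; exists c.
Qed.

Lemma drv_nondecreasing f df a b : a <= b ->
  (forall x, a <= x <= b -> is_derive x 1 f (df x)) ->
  (forall x, a <= x <= b -> 0 <= df x) -> f a <= f b.
Proof.
rewrite le_eqVlt => /predU1P[->//|ab] fd df0; have [c /andP[ac cb] E] := mean_value ab fd.
rewrite -subr_ge0 E mulr_ge0 //; first by apply: df0; rewrite (ltW ac) (ltW cb).
by rewrite subr_ge0 ltW.
Qed.

End real_derivatives.

(** * The function [phi]: positivity, convexity and a lower bound *)

Section phi.
Variable R : realType.
Implicit Types x y a b c : R.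

Lemma sin_lt_id x : 0 < x -> sin x < x.
Proof.
move=> x0; have [x1|x1] := ltP 1 x; first exact: le_lt_trans (sin_le1 x) x1.
have d y : 0 <= y <= x -> is_derive y 1 (fun t => t - sin t) (1 - cos y).
  by move=> _; exact: drvB (drv_id y) (is_derive_sin y).
have [c /andP[c0 cx]] := mean_value x0 d; rewrite sin0 !subr0 => E.
rewrite -subr_gt0 E mulr_gt0 // subr_gt0 -cos0.
have pi2 := @pi_ge2 R.
by rewrite ltr_cos ?in_itv /= ?lexx ?(ltW c0) //= ?pi_ge0 //; lra.
Qed.

Lemma cos_lt1 x : 0 < x < pi *+ 2 -> cos x < 1.
Proof.
move=> /andP[x0 xpi]; have h : 0 < x / 2 < pi.
  by rewrite divr_gt0 //= ltr_pdivrMr // mulr_natr.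
have := sin_gt0_pi h; have -> : x = (x / 2) *+ 2 by rewrite -mulr_natr divfK.
rewrite mulr2n cosD -mulr2n -!expr2; have := cos2Dsin2 (x / 2).
rewrite (_ : x / 2 *+ 2 / 2 = x / 2); last by rewrite -mulr_natr mulfK.
by move: (cos _) (sin _) => u v uv v0; nra.
Qed.

Lemma cos_eq1 x : 0 < x -> cos x = 1 -> exists m : nat, x = (pi *+ 2) * m.+1%:R.
Proof.
move=> x0 cx; have p0 : 0 < pi *+ 2 :> R by rewrite mulrn_wgt0 // pi_gt0.
pose m := Num.truncn (x / (pi *+ 2)).
have xm : 0 <= x / (pi *+ 2) by rewrite divr_ge0 // ltW.
have /andP[m1 m2] := Num.Theory.truncn_itv xm; rewrite -/m in m1 m2.
have m1' : pi *+ 2 * m%:R <= x by rewrite mulrC -ler_pdivlMr.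
have m2' : x < pi *+ 2 * m.+1%:R by rewrite mulrC -ltr_pdivrMr.
have r2 : x - pi *+ 2 * m%:R < pi *+ 2.
  by rewrite ltrBlDl; move: m2'; rewrite -natr1 mulrDr mulr1.
have cr : cos (x - pi *+ 2 * m%:R) = 1.
  rewrite -(periodicn (@cosD2pi R) m) -[RHS]cx; congr cos.
  by rewrite -[pi *+ 2 *+ m]mulr_natr subrK.
have [r0|r0] := eqVneq (x - pi *+ 2 * m%:R) 0.
  have xE : x = pi *+ 2 * m%:R by apply/eqP; rewrite -subr_eq0 r0.
  case: (m) xE => [|l ->]; last by exists l.
  by rewrite mulr0 => x00; move: x0; rewrite x00 ltxx.
have : cos (x - pi *+ 2 * m%:R) < 1.
  by apply: cos_lt1; rewrite r2 andbT lt_neqAle eq_sym r0 subr_ge0.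
by rewrite cr ltxx.
Qed.

Definition phi x := (x - sin x) / (1 - cos x).
Definition dphi x := (2 * (1 - cos x) - x * sin x) / (1 - cos x) ^+ 2.
Definition ddphi x := (x * (2 + cos x) - 3 * sin x) / (1 - cos x) ^+ 2.

Lemma phiN x : phi (- x) = - phi x.
Proof. by rewrite /phi sinN cosN -opprD mulNr. Qed.

Lemma drv_1mcos x : is_derive x 1 (fun t => 1 - cos t) (sin x).
Proof.
apply: is_derive_eq (drvB (drv_cst 1 x) (is_derive_cos x)) _.
by rewrite sub0r opprK.
Qed.

Lemma is_derive_phi x : cos x != 1 -> is_derive x 1 phi (dphi x).
Proof.
move=> cx; have c0 : 1 - cos x != 0 by rewrite subr_eq0 eq_sym.
have := drvM (drvB (drv_id x) (is_derive_sin x)) (drvV (f := fun t => 1 - cos t) c0 (drv_1mcos x)).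
move/is_derive_eq; apply; rewrite /dphi; have := cos2Dsin2 x => cs.
have s2 : sin x ^+ 2 = 1 - cos x ^+ 2 by rewrite -cs addrAC subrr add0r.
apply/eqP; rewrite -subr_eq0; apply/eqP.
(* The two sides agree only modulo the relation between sine and cosine; their difference is written
   as an explicit multiple of it. The same device recurs below. *)
transitivity ((sin x ^+ 2 - (1 - cos x ^+ 2)) / (1 - cos x) ^+ 2); first by field.
by rewrite s2 subrr mul0r.
Qed.

Lemma is_derive_dphi x : cos x != 1 -> is_derive x 1 dphi (ddphi x).
Proof.
move=> cx; have c0 : 1 - cos x != 0 by rewrite subr_eq0 eq_sym.
have c20 : (1 - cos x) ^+ 2 != 0 by rewrite expf_neq0.
have num := drvB (drvZ 2 (drv_1mcos x)) (drvM (drv_id x) (is_derive_sin x)).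
have sq : is_derive x 1 (fun t => (1 - cos t) ^+ 2) (sin x * (1 - cos x) + (1 - cos x) * sin x).
  exact: drvM (drv_1mcos x) (drv_1mcos x).
have := drvM num (drvV (f := fun t => (1 - cos t) ^+ 2) c20 sq).
move/is_derive_eq; apply; rewrite /ddphi; have := cos2Dsin2 x => cs.
have s2 : sin x ^+ 2 = 1 - cos x ^+ 2 by rewrite -cs addrAC subrr add0r.
apply/eqP; rewrite -subr_eq0; apply/eqP.
transitivity ((sin x ^+ 2 - (1 - cos x ^+ 2)) * (2 * x) / (1 - cos x) ^+ 3); first by field.
by rewrite s2 subrr !mul0r.
Qed.

(** The Cusa-Huygens inequality: after division by 2 + cos x, the derivative is the square of (1 -
    cos x) / (2 + cos x). *)
Lemma cusa x : 0 < x -> 0 < x * (2 + cos x) - 3 * sin x.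
Proof.
have c2 y : 2 + cos y != 0 by rewrite gt_eqF //; have := cos_geN1 y; lra.
have c20 y : 0 < 2 + cos y by have := cos_geN1 y; lra.
pose g y : R := y - 3 * (sin y / (2 + cos y)).
pose dg y : R := (1 - cos y) ^+ 2 / (2 + cos y) ^+ 2.
have gd y : is_derive y 1 g (dg y).
  have d2 : is_derive y 1 (fun t => 2 + cos t) (0 - sin y).
    exact: drvD (drv_cst 2 y) (is_derive_cos y).
  have := drvB (drv_id y) (drvZ 3 (drvM (is_derive_sin y) (drvV (f := fun t => 2 + cos t) (c2 y) d2))).
  move/is_derive_eq; apply; rewrite /dg; have := cos2Dsin2 y => cs.
  have s2 : sin y ^+ 2 = 1 - cos y ^+ 2 by rewrite -cs addrAC subrr add0r.
  apply/eqP; rewrite -subr_eq0; apply/eqP.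
  transitivity ((-3) * (sin y ^+ 2 - (1 - cos y ^+ 2)) / (2 + cos y) ^+ 2); first by field.
  by rewrite s2 subrr mulr0 mul0r.
(* Up to pi the derivative is strictly positive; beyond, where it can vanish, monotonicity is
   enough. *)
have g_small y : 0 < y <= pi -> 0 < g y.
  move=> /andP[y0 ypi]; have [c /andP[c0 cy]] := mean_value y0 (fun z _ => gd z).
  rewrite {2}/g sin0 mul0r mulr0 !subr0 => ->; rewrite mulr_gt0 // divr_gt0 // exprn_gt0 //.
  rewrite subr_gt0 cos_lt1 // c0 (lt_le_trans cy) // (le_trans ypi) //.
  by rewrite mulr2n lerDl pi_ge0.
have g_pos y : 0 < y -> 0 < g y.
  move=> y0; have [ypi|ypi] := leP y pi; first by apply: g_small; rewrite y0.
  apply: (@lt_le_trans _ _ (g pi)); first by apply: g_small; rewrite pi_gt0 lexx.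
  apply: (drv_nondecreasing (ltW ypi) (fun z _ => gd z)) => z _.
  by rewrite /dg divr_ge0 // sqr_ge0.
move=> x0; have := g_pos x x0; rewrite /g.
have -> : x * (2 + cos x) - 3 * sin x = (x - 3 * (sin x / (2 + cos x))) * (2 + cos x).
  by field.
by move=> gx; rewrite mulr_gt0.
Qed.

Lemma ddphi_gt0 x : 0 < x -> cos x != 1 -> 0 < ddphi x.
Proof.
by move=> x0 cx; rewrite divr_gt0 ?cusa // exprn_even_gt0 //= subr_eq0 eq_sym.
Qed.

Lemma cos_lt1_neq x : cos x != 1 -> 0 < 1 - cos x.
Proof. by move=> cx; rewrite subr_gt0 lt_neqAle cx cos_le1. Qed.

Lemma phi_gt0 x : 0 < x -> cos x != 1 -> 0 < phi x.
Proof.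
by move=> x0 cx; rewrite divr_gt0 ?cos_lt1_neq // subr_gt0 sin_lt_id.
Qed.

(** For x >= 1 use sin x <= 1 and 1 - cos x <= 2; for x < 1 the left side is negative. This 2 and
    the 4 in [weight] make the 8 of the theorem. *)
Lemma phi_ge x : 0 < x -> cos x != 1 -> (x - 1) / 2 <= phi x.
Proof.
move=> x0 cx; have c0 := cos_lt1_neq cx; rewrite /phi ler_pdivrMr // mulrAC ler_pdivlMr //.
have := sin_lt_id x0; have := sin_le1 x; have := cos_geN1 x.
move: c0; move: (cos x) (sin x) => u v; nra.
Qed.

End phi.

(** * Counting the solutions of [Fsum x = z] between poles *)

Section counting.
Variables (R : realType) (k : nat) (Q : pred 'I_k) (w al : 'I_k -> R).
Hypotheses (w_gt0 : forall j, Q j -> 0 < w j) (al_gt0 : forall j, 0 < al j).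
Hypothesis Q_ex : exists j, Q j.

Definition Fsum (x : R) := \sum_(j | Q j) w j * phi (al j * x).

(** By Rolle, three equal values give two zeros of the first derivative and one of the second, which
    is positive. *)
Lemma Fsum_no_three (a b c : R) : 0 < a -> a < b -> b < c ->
  (forall j x, Q j -> a <= x <= c -> cos (al j * x) != 1) ->
  Fsum a = Fsum b -> Fsum b = Fsum c -> False.
Proof.
move=> a0 ab bc nores Fab Fbc.
pose dF x := \sum_(j | Q j) w j * (al j * dphi (al j * x)).
pose ddF x := \sum_(j | Q j) w j * (al j * (al j * ddphi (al j * x))).
have Fd x : a <= x <= c -> is_derive x 1 Fsum (dF x).
  move=> xac; apply: drv_sum => j Qj; apply: drvZ; apply: drv_dilate.
  by apply: is_derive_phi; exact: nores.
have dFd x : a <= x <= c -> is_derive x 1 dF (ddF x).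
  move=> xac; apply: drv_sum => j Qj; apply: drvZ; apply: drvZ; apply: drv_dilate.
  by apply: is_derive_dphi; exact: nores.
have [x|x1 /andP[ax1 x1b] F1] := @rolle _ Fsum dF a b ab _ Fab.
  by move=> /andP[ax xb]; apply: Fd; rewrite ax (le_trans xb) // ltW.
have [x|x2 /andP[bx2 x2c] F2] := @rolle _ Fsum dF b c bc _ Fbc.
  by move=> /andP[bx xc]; apply: Fd; rewrite xc (le_trans _ bx) // ltW.
have x12 := lt_trans x1b bx2.
have [x||x3 /andP[x13 x32] F3] := @rolle _ dF ddF x1 x2 x12.
- move=> /andP[x1x xx2]; apply: dFd; rewrite (le_trans (ltW ax1)) //=.
  by rewrite (le_trans xx2) // ltW.
- by rewrite F1 F2.
have ax3 := lt_trans ax1 x13; have x3c := lt_trans x32 x2c.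
suff : 0 < ddF x3 by rewrite F3 ltxx.
have [j0 Qj0] := Q_ex.
have pos j : Q j -> 0 < w j * (al j * (al j * ddphi (al j * x3))).
  move=> Qj; rewrite mulr_gt0 ?w_gt0 // mulr_gt0 // mulr_gt0 //.
  apply: ddphi_gt0; first by rewrite mulr_gt0 // (lt_trans a0).
  by apply: nores => //; rewrite (ltW ax3) ltW.
rewrite /ddF (bigD1 j0) //= ltr_wpDr ?pos // sumr_ge0 // => j /andP[Qj _].
exact/ltW/pos.
Qed.

Lemma fiber_count (T : eqType) (s : seq T) (rho : T -> nat) N b :
  (forall x, x \in s -> (rho x <= N)%N) ->
  (forall r, (count (fun x => rho x == r) s <= b)%N) -> (size s <= b * N.+1)%N.
Proof.
move=> rN cb.
have -> : size s = (\sum_(r < N.+1) count (fun x => rho x == r) s)%N.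
  elim: s rN {cb} => [|x s IH] rN; first by rewrite big1.
  rewrite /= big_split /= -IH; last by move=> y ys; apply: rN; rewrite inE ys orbT.
  have xN : (rho x < N.+1)%N by rewrite ltnS rN // mem_head.
  rewrite (bigD1 (Ordinal xN)) //= eqxx big1 // => i /eqP ni; case: eqP => // e.
  by case: ni; apply: val_inj.
apply: (@leq_trans (\sum_(r < N.+1) b)%N); first by apply: leq_sum => r _; exact: cb.
by rewrite sum_nat_const card_ord mulnC.
Qed.

Variables (L z : R).
Hypothesis L_ge0 : 0 <= L.

Definition npoles j := Num.truncn (L * al j / (pi *+ 2)).

Definition poles j := [seq (pi *+ 2) * m.+1%:R / al j | m <- iota 0 (npoles j)].

Lemma size_poles j : size (poles j) = npoles j.
Proof. by rewrite size_map size_iota. Qed.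

Lemma npoles_le j : (npoles j)%:R <= L * al j / (pi *+ 2) :> R.
Proof.
have h : 0 <= L * al j / (pi *+ 2).
  by apply: divr_ge0; [rewrite mulr_ge0 // ltW | rewrite mulrn_wge0 // pi_ge0].
by have /andP[] := Num.Theory.truncn_itv h.
Qed.

Lemma mem_poles j x : 0 < x -> x <= L -> cos (al j * x) = 1 -> x \in poles j.
Proof.
move=> x0 xL cx; have [|m xm] := cos_eq1 _ cx; first by rewrite mulr_gt0.
have p0 : 0 < pi *+ 2 :> R by rewrite mulrn_wgt0 // pi_gt0.
apply/mapP; exists m; last by rewrite -xm mulrC mulKf // gt_eqF.
rewrite mem_iota add0n /= /npoles.
have h : 0 <= L * al j / (pi *+ 2) by apply: divr_ge0; [rewrite mulr_ge0 // ltW | exact: ltW].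
have /andP[_ t2] := Num.Theory.truncn_itv h.
rewrite -ltnS -(ltr_nat R); apply: le_lt_trans t2.
by rewrite ler_pdivlMr // mulrC -xm mulrC ler_wpM2r // ltW.
Qed.

Definition Nsum (P : pred 'I_k) := (\sum_(j | P j) npoles j)%N.

(** Solutions are labelled by the number [rho] of poles below them. There are at most [Nsum Q + 1]
    labels, and solutions with the same label have no pole between them, so a label occurs at most
    twice. *)
Lemma Fsum_count (s : seq R) : uniq s ->
  (forall x, x \in s -> [/\ 0 < x, x <= L, forall j, Q j -> cos (al j * x) != 1 & Fsum x = z]) ->
  (size s <= 2 * (Nsum Q).+1)%N.
Proof.
move=> us sP; pose D := flatten [seq poles j | j <- enum Q].
have szD : size D = Nsum Q.
  rewrite size_flatten /shape -map_comp sumnE big_map /Nsum -big_enum /=.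
  by apply: eq_bigr => j _; rewrite size_poles.
pose rho x := count (fun d => d < x) D.
apply: (@fiber_count _ _ rho) => [x _|r]; first by rewrite -szD count_size.
rewrite -size_filter leqNgt; apply/negP => sz3.
set f := [seq x <- s | rho x == r] in sz3.
have fu : uniq f by exact: filter_uniq.
have [a [b [c [ab bc fabc]]]] : exists a b c, [/\ a < b, b < c & [/\ a \in f, b \in f & c \in f]].
  have : sorted <%R (sort <=%R f) by rewrite sort_lt_sorted.
  have mem := mem_sort <=%R f; move: sz3; rewrite -(size_sort <=%R).
  case E : (sort _ _) => [|a [|b [|c q]]] //= _ /and3P[ab bc _].
  by exists a, b, c; split=> //; rewrite -!mem E !inE !eqxx !orbT.
have [af bf cf] := fabc.
have fP x : x \in f -> x \in s /\ rho x = r by rewrite mem_filter => /andP[/eqP].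
have [[as_ ra] [bs _] [cs rc]] := And3 (fP _ af) (fP _ bf) (fP _ cf).
have [a0 aL aQ aF] := sP _ as_; have [b0 bL bQ bF] := sP _ bs; have [c0 cL cQ cF] := sP _ cs.
apply: (@Fsum_no_three a b c) => //; rewrite ?aF ?bF ?cF //.
move=> j x Qj /andP[ax xc]; apply/eqP => cx.
have x0 := lt_le_trans a0 ax; have xL := le_trans xc cL.
have xD : x \in D.
  by apply/flatten_mapP; exists j; [rewrite mem_enum | exact: mem_poles].
have xc' : x < c by rewrite lt_neqAle xc andbT; apply: contraNneq (cQ j Qj) => <-; rewrite cx.
(* The pole [x] is counted for [c] but not for [a]. *)
have : (rho a < rho c)%N.
  have xcnt : (0 < count (pred1 x) D)%N by rewrite -has_count has_pred1.
  have := count_predUI (fun d => d < a) (pred1 x) D.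
  have -> : count (predI (fun d => d < a) (pred1 x)) D = 0%N.
    rewrite (eq_count (a2 := pred0)) ?count_pred0 // => d /=.
    by case: eqP => [->|]; rewrite ?andbF // ltNge ax.
  have : (count (predU (fun d => (d < a)%R) (pred1 x)) D <= rho c)%N.
    apply: sub_count => d /= /orP[da|/eqP -> //].
    by rewrite (lt_trans da) // (le_lt_trans ax).
  by move=> le_c; rewrite addn0 => E; apply: leq_trans le_c; rewrite E -addn1 leq_add2l.
by rewrite ra rc ltnn.
Qed.

End counting.

(** * The left-invariant frame *)

Section directional_derivatives.
Variables (R : realType) (V : normedModType R).
Implicit Types (g : V -> R) (x v w : V).

Lemma line_quotient g (t : R) v x :
  (fun h : R => h^-1 *: (((fun s => g (s *: v + x)) \o shift t) (h *: (1 : R)) - g (t *: v + x))) =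
  (fun h : R => h^-1 *: ((g \o shift (t *: v + x)) (h *: v) - g (t *: v + x))).
Proof.
apply/funext => h /=; congr (_ *: (g _ - _)).
by rewrite [h *: 1]/GRing.scale /= mulr1 scalerDl addrA.
Qed.

Lemma drv_line g (t : R) v x : derivable g (t *: v + x) v ->
  is_derive t 1 (fun s => g (s *: v + x)) ('D_v g (t *: v + x)).
Proof.
move=> gd; split; first by rewrite /derivable line_quotient.
by rewrite /derive line_quotient.
Qed.

Lemma line_drv g v x (d : R) : is_derive (0 : R) 1 (fun s => g (s *: v + x)) d ->
  derivable g x v /\ 'D_v g x = d.
Proof.
move=> [gd <-]; have := line_quotient g 0 v x; rewrite scale0r add0r => E.
by split; [rewrite /derivable -E; move: gd; rewrite /derivable scale0r add0r
  | rewrite /derive -E scale0r add0r].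
Qed.

Lemma deriveZ_dir g (c : R) v x : derivable g x v ->
  derivable g x (c *: v) /\ 'D_(c *: v) g x = c * 'D_v g x.
Proof.
move=> gd; apply: line_drv; have := @drv_line g (c * 0) v x.
rewrite mulr0 scale0r add0r => /(_ gd) H.
have H' : is_derive (c * 0) 1 (fun s => g (s *: v + x)) ('D_v g x) by rewrite mulr0.
have := drv_dilate H'.
by have -> : (fun t => g ((c * t) *: v + x)) = (fun s => g (s *: (c *: v) + x))
  by apply/funext => s; rewrite scalerA mulrC.
Qed.

(** The increment along v + w is split at x + h w. The mean value theorem turns its v-part into a
    value of ['D_v g] near [x], and continuity of that derivative gives the limit. *)
Lemma deriveD_dir g v w x : (forall y, derivable g y v) -> continuous ('D_v g) ->
  derivable g x w -> derivable g x (v + w) /\ 'D_(v + w) g x = 'D_v g x + 'D_w g x.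
Proof.
move=> gv gc gw.
have key : h^-1 *: (g (h *: (v + w) + x) - g (h *: w + x)) @[h --> 0^'] --> 'D_v g x.
  apply/cvgrPdist_lt => e e0.
  have /cvgrPdist_lt/(_ e e0) := gc x.
  move=> /nbhs_ballP[d /= d0 Hd].
  pose B := `|v| + `|w| + 1.
  have B0 : 0 < B by rewrite ltr_wpDl // addr_ge0.
  exists (d / B); first by rewrite /= divr_gt0.
  move=> h /=; rewrite sub0r normrN => hd h0.
  have der (t : R) : is_derive t 1 (fun s => g (s *: v + (h *: w + x))) ('D_v g (t *: v + (h *: w + x))).
    exact: drv_line.
  have [xi xih E] : exists2 xi, `|xi| <= `|h| &
      g (h *: v + (h *: w + x)) - g (0 *: v + (h *: w + x)) =
      'D_v g (xi *: v + (h *: w + x)) * (h - 0).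
    have [h0'|h0'] := ltP 0 h.
      have [c /andP[c0 ch] E] := mean_value h0' (fun t _ => der t).
      by exists c => //; rewrite !gtr0_norm // ltW.
    have {}h0' : h < 0 by rewrite lt_neqAle h0 h0'.
    have [c /andP[ch c0] E] := mean_value h0' (fun t _ => der t).
    exists c; first by rewrite !ltr0_norm // lerN2 ltW.
    by rewrite -opprB E -mulrN opprB.
  rewrite [h *: (v + w)]scalerDr -addrA; move: E; rewrite scale0r add0r subr0 => ->.
  rewrite [_ *: _]/GRing.scale /= mulrC mulfK //; apply: Hd.
  rewrite -ball_normE /= addrA opprD addrCA subrr addr0 normrN.
  apply: le_lt_trans (ler_normD _ _) _; rewrite !normrZ.
  apply: (@le_lt_trans _ _ (`|h| * (`|v| + `|w|))).
    by rewrite mulrDr lerD // ler_wpM2r.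
  apply: (@le_lt_trans _ _ (`|h| * B)); first by rewrite ler_wpM2l // lerDl.
  by rewrite -ltr_pdivlMr.
have key2 : h^-1 *: (g (h *: w + x) - g x) @[h --> 0^'] --> 'D_w g x by exact: gw.
have key3 : h^-1 *: (g (h *: (v + w) + x) - g x) @[h --> 0^'] --> 'D_v g x + 'D_w g x.
  have -> : (fun h => h^-1 *: (g (h *: (v + w) + x) - g x)) =
      (fun h => h^-1 *: (g (h *: (v + w) + x) - g (h *: w + x)) + h^-1 *: (g (h *: w + x) - g x)).
    by apply/funext => h; rewrite -scalerDr subrKA.
  exact: cvgD key key2.
split; first by apply/cvg_ex; exists ('D_v g x + 'D_w g x).
by apply: cvg_lim => //; exact: key3.
Qed.

Definition C1 g := (forall x v, derivable g x v) /\ (forall v, continuous ('D_v g)).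

Lemma C1_derive_sum g x I (r : seq I) (c : I -> R) (v : I -> V) : C1 g ->
  'D_(\sum_(i <- r) c i *: v i) g x = \sum_(i <- r) c i * 'D_(v i) g x.
Proof.
move=> [gd gc]; elim: r => [|i r IH].
  rewrite !big_nil; have [_] := @deriveZ_dir g 0 0 x (gd x 0).
  by rewrite scaler0 mul0r.
rewrite !big_cons -IH; have [|||_ ->] := @deriveD_dir g (c i *: v i) (\sum_(i <- r) c i *: v i) x.
- by move=> y; exact: gd.
- have -> : 'D_(c i *: v i) g = (fun y => c i * 'D_(v i) g y).
    by apply/funext => y; have [] := deriveZ_dir (c i) (gd y (v i)).
  by move=> y; apply: cvgM; [exact: cvg_cst | exact: gc].
- exact: gd.
- by have [_ ->] := deriveZ_dir (c i) (gd x (v i)).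
Qed.

End directional_derivatives.

(** The sum [g] of the squares satisfies g' <= kap g, so g exp(- kap s) does not increase from its
    value 0. The bound is assumed for s > 0 only, as the equation to which it is applied is singular
    at 0. *)
Lemma gronwall0 (R : realType) N (z dz : 'I_N -> R -> R) (C : R) : 0 <= C ->
  (forall i (s : R), 0 <= s <= 1 -> is_derive s 1 (z i) (dz i s)) ->
  (forall i s, 0 < s <= 1 -> `|dz i s| <= C * \sum_b `|z b s|) ->
  (forall i, z i 0 = 0) -> forall i, z i 1 = 0.
Proof.
move=> C0 zd zC z0.
pose g s := \sum_i z i s ^+ 2; pose dg s := \sum_i (dz i s * z i s + z i s * dz i s).
(* From 2 |z_i| |z_b| <= z_i^2 + z_b^2, summed over i and b. *)
pose kap : R := 2 * C * N%:R.
have gd (s : R) : 0 <= s <= 1 -> is_derive s 1 g (dg s).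
  by move=> s01; apply: drv_sum => i _; exact: drvM (zd i s s01) (zd i s s01).
have dg_le s : 0 <= s <= 1 -> dg s <= kap * g s.
  move=> /andP[s0 s1]; move: s0; rewrite le_eqVlt => /predU1P[<-|s0].
    rewrite /dg /g !big1 ?mulr0 // => i _; rewrite z0 ?mulr0 ?mul0r ?addr0 ?expr0n //.
  apply: (@le_trans _ _ (\sum_i \sum_b C * (z i s ^+ 2 + z b s ^+ 2))).
    apply: ler_sum => i _.
    have := zC i s; rewrite s0 s1 => /(_ isT) h.
    apply: (@le_trans _ _ (2 * `|z i s| * (C * \sum_b `|z b s|))).
      have -> : dz i s * z i s + z i s * dz i s = 2 * (z i s * dz i s) by ring.
      rewrite -mulrA ler_wpM2l //.
      by rewrite (le_trans (ler_norm _)) // normrM ler_wpM2l.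
    rewrite mulr_sumr mulr_sumr; apply: ler_sum => b _.
    rewrite mulrCA ler_wpM2l // -[z i s ^+ 2]real_normK ?num_real // -[z b s ^+ 2]real_normK ?num_real //.
    rewrite -subr_ge0 (_ : _ - _ = (`|z i s| - `|z b s|) ^+ 2) ?sqr_ge0 //; ring.
  rewrite le_eqVlt; apply/orP; left; apply/eqP.
  under eq_bigr do rewrite -mulr_sumr big_split /= sumr_const card_ord -mulr_natl.
  rewrite -mulr_sumr big_split /= sumr_const card_ord -mulr_sumr -mulr_natl /kap /g.
  by move: (\sum_i _) => S; ring.
pose e s : R := expR (- kap * s).
have ed (s : R) : is_derive s 1 e (- kap * e s).
  exact: (drv_dilate (f := expR) (is_derive_expR (- kap * s))).
pose G s := - (g s * e s).
have Gd (s : R) : 0 <= s <= 1 -> is_derive s 1 G (0 - (dg s * e s + g s * (- kap * e s))).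
  move=> s01; have := drvB (drv_cst 0 s) (drvM (gd s s01) (ed s)).
  by have -> : (fun t => 0 - g t * e t) = G by apply/funext => t; rewrite sub0r.
have : G 0 <= G 1.
  apply: (drv_nondecreasing ler01 Gd) => s /dg_le h.
  have e0 : 0 <= e s by exact: expR_ge0.
  have : 0 <= (kap * g s - dg s) * e s by rewrite mulr_ge0 // subr_ge0.
  by congr (0 <= _); ring.
rewrite /G {1}/g big1 ?mul0r ?oppr0; last by move=> i _; rewrite z0 expr0n.
rewrite oppr_ge0 pmulr_lle0 ?expR_gt0 // => g1 i.
have gz : g 1 = 0.
  by apply/eqP; rewrite eq_le g1 sumr_ge0 // => j _; exact: sqr_ge0.
have := psumr_eq0P (fun j _ => sqr_ge0 (z j 1)) gz (i := i) isT.
by move/eqP; rewrite expf_eq0 => /eqP.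
Qed.

Lemma derive_coord (R : realType) (V : normedModType R) N (F : V -> 'rV[R]_N) x v i :
  derivable F x v -> derivable (fun y => F y 0 i) x v /\ 'D_v (fun y => F y 0 i) x = 'D_v F x 0 i.
Proof.
by move=> Fd; split; [exact: (derivable_mxP _ _ _).1 Fd 0 i | rewrite derive_mx // mxE].
Qed.

Lemma Ck1_coord (R : realType) (V : normedModType R) N (F : V -> 'rV[R]_N) i :
  Ck 1 F -> C1 (fun y => F y 0 i).
Proof.
move=> [Fd Fc]; split=> [x v|v]; first by have [] := derive_coord i (Fd x v).
have -> : 'D_v (fun y => F y 0 i) = (fun M => M 0 i) \o 'D_v F.
  by apply/funext => x; have [] := derive_coord i (Fd x v).
move=> x; apply: (@continuous_comp _ _ _ ('D_v F) (fun M : 'rV[R]_N => M 0 i)); first exact: Fc.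
exact: coord_continuous.
Qed.

Lemma C1_derive_row (R : realType) N (g : 'rV[R]_N -> R) (x w : 'rV[R]_N) : C1 g ->
  'D_w g x = \sum_l w 0 l * 'D_(delta_mx 0 l) g x.
Proof.
move=> gC; rewrite -(C1_derive_sum x (index_enum _) (fun l => w 0 l) (fun l => delta_mx 0 l) gC).
by rewrite -row_sum_delta.
Qed.

(** The algebra behind [Lc_euler]: [l] stands for the coefficients of the frame at the point [q],
    [d] for their partial derivatives and [om] for the structure constants. *)
Lemma euler_bracket (R : comRingType) (I : finType) (q : I -> R) (l om : I -> I -> R)
    (d : I -> I -> I -> R) z c i :
  (forall j, \sum_b q b * l b j = q j) ->
  (forall a b j, \sum_m l a m * d b j m - \sum_m l b m * d a j m = om a b * l z j) ->
  (forall w j, \sum_b (w b * l b j + q b * \sum_m w m * d b j m) = w j) ->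
  \sum_m q m * d c i m = l c i + (\sum_b q b * om b c) * l z i - \sum_b l c b * l b i.
Proof.
move=> H1 H2 H3.
have Dq : \sum_m q m * d c i m = \sum_b q b * \sum_m l b m * d c i m.
  transitivity (\sum_m (\sum_b q b * l b m) * d c i m).
    by apply: eq_bigr => m _; rewrite H1.
  under eq_bigr do rewrite mulr_suml.
  rewrite exchange_big /=; apply: eq_bigr => b _; rewrite mulr_sumr.
  by apply: eq_bigr => m _; rewrite mulrA.
have := H3 (l c) i; rewrite big_split /= => <-.
have -> : \sum_b q b * (\sum_m l c m * d b i m) =
    \sum_m q m * d c i m - (\sum_b q b * om b c) * l z i.
  rewrite Dq mulr_suml -sumrB; apply: eq_bigr => b _.
  by rewrite -mulrA -H2 mulrBr opprB addrCA subrr addr0.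
by ring.
Qed.

Lemma ray_bound (R : realType) (m d : R -> R) : (forall s : R, is_derive s 1 m (d s)) ->
  continuous d -> exists2 C : R, 0 <= C & forall s : R, 0 <= s <= 1 -> `|m 0 - m s| <= C * s.
Proof.
move=> md dc.
have nc : continuous (fun s : R => `|d s|).
  by move=> s; apply: (@continuous_comp _ _ _ d Num.norm); [exact: dc | exact: norm_continuous].
have [s0 _ Hs0] := EVT_max (@ler01 R) (continuous_subspaceT nc).
exists `|d s0| => // s /andP[]; rewrite le_eqVlt => /predU1P[<-|sp] s1.
  by rewrite subrr normr0 mulr0.
have [c /andP[c0 cs]] := mean_value sp (fun t _ => md t).
rewrite subr0 => E'; rewrite distrC E' normrM [`|s|]gtr0_norm //.
by rewrite ler_wpM2r ?(ltW sp) // Hs0 // in_itv /= (ltW c0) (le_trans (ltW cs)).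
Qed.

(* The row [z = s (M_d - s/2 beta_d M_ez - e_d)] solves [s z' = z (1 - M)]. *)
Lemma ray_solution (R : realType) N (M dM : 'I_N -> 'I_N -> R -> R) (beta : 'I_N -> R)
    (ez : 'I_N) (C : R) :
  0 <= C -> beta ez = 0 ->
  (forall b i (s : R), is_derive s 1 (M b i) (dM b i s)) ->
  (forall b i s, s * dM b i s =
    M b i s + s * beta b * M ez i s - \sum_l M b l s * M l i s) ->
  (forall b i s, 0 <= s <= 1 -> `|(i == b)%:R - M b i s| <= C * s) ->
  forall c i, M c i 1 = (i == c)%:R + 2^-1 * beta c * (i == ez)%:R.
Proof.
move=> C0 beta_ez Md Meq HC c i.
have rowE d : forall i', M d i' 1 - 2^-1 * beta d * M ez i' 1 - (i' == d)%:R = 0.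
  pose z (i' : 'I_N) (s : R) :=
    s * M d i' s - 2^-1 * beta d * (s * (s * M ez i' s)) - (i' == d)%:R * s.
  pose dz (i' : 'I_N) (s : R) := (1 * M d i' s + s * dM d i' s) -
    2^-1 * beta d * (1 * (s * M ez i' s) + s * (1 * M ez i' s + s * dM ez i' s)) -
    (i' == d)%:R * 1.
  have zd i' (s : R) : is_derive s 1 (z i') (dz i' s).
    exact: (drvB (drvB (drvM (drv_id s) (Md d i' s))
      (drvZ _ (drvM (drv_id s) (drvM (drv_id s) (Md ez i' s))))) (drvZ _ (drv_id s))).
  have key i' s : s * dz i' s = \sum_b z b s * ((i' == b)%:R - M b i' s).
    have -> : \sum_b z b s * ((i' == b)%:R - M b i' s) = z i' s - \sum_b z b s * M b i' s.
      under eq_bigr do rewrite mulrBr.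
      rewrite sumrB; congr (_ - _); rewrite (bigD1 i') //= eqxx mulr1 big1 ?addr0 // => b bi.
      by rewrite eq_sym (negbTE bi) mulr0.
    have -> : \sum_b z b s * M b i' s = s * (\sum_b M d b s * M b i' s) -
        2^-1 * beta d * (s * (s * \sum_b M ez b s * M b i' s)) - s * M d i' s.
      rewrite !mulr_sumr -!sumrB; under eq_bigr do rewrite /z 2!mulrBl.
      rewrite 2!sumrB; congr (_ - _).
        by rewrite -sumrB; apply: eq_bigr => b _; ring.
      rewrite (bigD1 d) //= eqxx [X in _ + X]big1 ?addr0 ?mul1r // => b bd.
      by rewrite (negbTE bd) !mul0r.
    have := Meq d i' s; have := Meq ez i' s; rewrite beta_ez mulr0 mul0r addr0.
    rewrite /dz /z; set S1 := \sum_l _; set S2 := \sum_l _ => e1 e2.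
    transitivity (s * M d i' s + s * (s * dM d i' s) - 2^-1 * beta d *
      (s * (s * M ez i' s) + s * (s * M ez i' s) + s * (s * (s * dM ez i' s))) - (i' == d)%:R * s).
      by ring.
    by rewrite e1 e2; field.
  move=> i'; have := @gronwall0 R N z dz C C0 (fun i s _ => zd i s) _ _ i'; rewrite /z !mul1r mulr1; apply.
    (* The bound C s on the entries of 1 - M cancels the factor [s] of [key], so the singular
       equation falls under Gronwall's lemma. *)
    move=> i'' s /andP[s0 s1].
    rewrite -(ler_pM2l s0) -[X in X * `|_|]gtr0_norm // -normrM key.
    apply: le_trans (ler_norm_sum _ _ _) _; rewrite mulrCA mulrA mulr_sumr.
    apply: ler_sum => b _; rewrite normrM mulrC; apply: ler_wpM2r => //.
    by apply: HC; rewrite (ltW s0).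
  by move=> i''; rewrite /z !mul0r !mulr0 !subr0.
have Mez i' : M ez i' 1 = (i' == ez)%:R.
  by have := rowE ez i'; rewrite beta_ez mulr0 mul0r subr0 => /eqP; rewrite subr_eq0 => /eqP.
have := rowE c i; rewrite Mez => /eqP; rewrite subr_eq0 subr_eq => /eqP ->.
by [].
Qed.

(** * The coefficients of the left-invariant frame *)

Section frame.
Variables (R : realType) (n : nat) (G : contactCarnot R n).
Local Notation N := (n.*2 + 1)%N.
Local Notation E := 'rV[R]_(n.*2 + 1).
Local Notation mul := (cc_mul G).
Local Notation e b := (delta_mx 0 b : 'rV[R]_(n.*2 + 1)).

Implicit Types q v w : E.

Let f (pq : E * E) : E := mul pq.1 pq.2.
Let fc i (pq : E * E) : R := mul pq.1 pq.2 0 i.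
Definition Lc b i (q : E) : R := 'D_(0, e b) (fc i) (q, 0).

Lemma fc_C1 i : C1 (fc i).
Proof. by apply: (@Ck1_coord R _ N f); exact: cc_mul_smooth. Qed.

Lemma dfc_C1 (v : E * E) i : C1 ('D_v (fc i)).
Proof.
have [fd _] := cc_mul_smooth G 1.
have -> : 'D_v (fc i) = (fun y => ('D_v f) y 0 i).
  by apply/funext => x; have [] := derive_coord i (fd x v).
by apply: Ck1_coord; have [_] := cc_mul_smooth G 2; apply.
Qed.

Lemma left_field_coord v q i : left_field mul v q 0 i = 'D_(0, v) (fc i) (q, 0).
Proof.
have [fd _] := cc_mul_smooth G 1.
have [_ ->] := derive_coord (F := f) i (fd (q, 0) (0, v)).
congr ((_ : 'rV[R]_N) 0 i); rewrite /left_field /derive.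
have -> // : (fun h : R => h^-1 *: ((mul q \o shift 0) (h *: v) - mul q 0)) =
  (fun h : R => h^-1 *: ((f \o shift (q, 0)) (h *: (0, v)) - f (q, 0))).
apply/funext => h /=; congr (_ *: (_ - _)).
by rewrite /f /= scaler0 add0r.
Qed.

Lemma pair_sumr (v : E) : (0, v) = \sum_b v 0 b *: ((0, e b) : E * E).
Proof.
rewrite [RHS]surjective_pairing; congr (_, _).
  rewrite (big_morph fst (id1 := 0) (op1 := +%R)) // big1 // => b _ /=.
  by rewrite scaler0.
rewrite (big_morph snd (id1 := 0) (op1 := +%R)) // {1}[v]row_sum_delta.
by apply: eq_bigr.
Qed.

Lemma left_field_sum v q i : left_field mul v q 0 i = \sum_b v 0 b * Lc b i q.
Proof. by rewrite left_field_coord pair_sumr C1_derive_sum //; exact: fc_C1. Qed.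

Lemma left_field_e b q i : left_field mul (e b) q 0 i = Lc b i q.
Proof. exact: left_field_coord. Qed.

(** Differentiate the product of q and s q, which is (1 + s) q: in exponential coordinates, the
    left-invariant field with value [q] at the identity is radial at [q]. *)
Lemma Lc_exp q i : \sum_b q 0 b * Lc b i q = q 0 i.
Proof.
rewrite -left_field_sum left_field_coord.
suff /line_drv[_ ->] : is_derive (0 : R) 1 (fun s => fc i (s *: (0, q) + (q, 0))) (q 0 i) by [].
have -> : (fun s : R => fc i (s *: (0, q) + (q, 0))) = (fun s => (1 + s) * q 0 i).
  apply/funext => s; rewrite /fc /= scaler0 add0r addr0.
  by rewrite -{1}[q]scale1r cc_exp mxE.
have := drvM (drvD (drv_cst 1 (0 : R)) (drv_id (0 : R))) (drv_cst (q 0 i) (0 : R)).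
by move/is_derive_eq; apply; rewrite mulr0 addr0 add0r mul1r.
Qed.

Lemma Lc0 b i : Lc b i 0 = (i == b)%:R.
Proof.
rewrite /Lc.
suff /line_drv[_ ->] : is_derive (0 : R) 1 (fun s => fc i (s *: (0, e b) + (0, 0))) ((i == b)%:R : R) by [].
have -> : (fun s : R => fc i (s *: (0, e b) + (0, 0))) = (fun s => (i == b)%:R * s).
  apply/funext => s; rewrite /fc /= scaler0 !addr0 cc_mul0g.
  by rewrite !mxE eqxx /= mulrC.
by have := drvZ (i == b)%:R (drv_id (0 : R)); rewrite mulr1.
Qed.

(** Derivatives of the frame are mixed second derivatives of the product, with [w] in the first
    factor and [e b] in the second. *)
Lemma Lc_derive b i w q :
  derivable (Lc b i) q w /\ 'D_w (Lc b i) q = 'D_(w, 0) ('D_(0, e b) (fc i)) (q, 0).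
Proof.
have [gd _] := dfc_C1 (0, e b) i; have := gd (q, 0) (w, 0).
have E' : (fun h : R => h^-1 *: ((Lc b i \o shift q) (h *: w) - Lc b i q)) =
  (fun h : R => h^-1 *: (('D_(0, e b) (fc i) \o shift (q, 0)) (h *: (w, 0)) - 'D_(0, e b) (fc i) (q, 0))).
  apply/funext => h; have Eh : h *: ((w, 0) : E * E) + (q, 0) = (h *: w + q, 0).
    by rewrite -[LHS]/(h *: w + q, h *: 0 + 0) scaler0 addr0.
  by rewrite /= Eh.
by rewrite /derivable /derive E'.
Qed.

Lemma Lc_C1 b i : C1 (Lc b i).
Proof.
split=> [q w|w]; first by have [] := Lc_derive b i w q.
have -> : 'D_w (Lc b i) = 'D_(w, 0) ('D_(0, e b) (fc i)) \o (fun q => (q, 0)).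
  by apply/funext => q; have [] := Lc_derive b i w q.
move=> q; apply: continuous_comp; last by have [_] := dfc_C1 (0, e b) i; apply.
exact: (@cvg_pair _ _ _ (nbhs q) (nbhs q) (nbhs (0 : E)) _ _ _ id (fun=> 0) cvg_id (cvg_cst _)).
Qed.

(** The structure constants of the whole frame: [cc_A] extended by zero to the central direction. *)
Definition omega : 'M[R]_(n.*2 + 1) := block_mx (cc_A G) 0 0 0.
Local Notation ez := (rshift n.*2 (ord0 : 'I_1)).

Lemma lie_coord a b q i :
  lie_bracket (left_field mul (e a)) (left_field mul (e b)) q 0 i =
  \sum_c Lc a c q * 'D_(e c) (Lc b i) q - \sum_c Lc b c q * 'D_(e c) (Lc a i) q.
Proof.
have D c d : 'D_(left_field mul (e c) q) (left_field mul (e d)) q 0 i =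
    \sum_l Lc c l q * 'D_(e l) (Lc d i) q.
  have Ld : derivable (left_field mul (e d)) q (left_field mul (e c) q).
    apply/derivable_mxP => r l; rewrite (ord1 r).
    have -> : (fun x => left_field mul (e d) x 0 l) = Lc d l.
      by apply/funext => x; rewrite left_field_e.
    by have [] := Lc_C1 d l.
  have [_ <-] := derive_coord i Ld.
  have -> : (fun x => left_field mul (e d) x 0 i) = Lc d i.
    by apply/funext => x; rewrite left_field_e.
  rewrite (C1_derive_row _ _ (Lc_C1 d i)).
  by apply: eq_bigr => l _; rewrite left_field_e.
have subE (u v : E) : (u - v) 0 i = u 0 i - v 0 i by rewrite !mxE.
rewrite /lie_bracket (subE ('D__ _ _)).
by congr (_ - _); exact: D.
Qed.

Lemma bracket a b q i :
  \sum_c Lc a c q * 'D_(e c) (Lc b i) q - \sum_c Lc b c q * 'D_(e c) (Lc a i) q =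
  omega a b * Lc ez i q.
Proof.
case: (splitP a) => [a' Ea|a' Ea]; case: (splitP b) => [b' Eb|b' Eb].
- have -> : a = lshift 1 a' by exact: val_inj.
  have -> : b = lshift 1 b' by exact: val_inj.
  by rewrite -lie_coord cc_bracket11 mxE left_field_e block_mxEul.
- have -> : a = lshift 1 a' by exact: val_inj.
  have -> : b = ez by apply: val_inj => /=; rewrite Eb (ord1 b').
  by rewrite -lie_coord cc_bracket12 mxE block_mxEur mxE mul0r.
- have -> : a = ez by apply: val_inj => /=; rewrite Ea (ord1 a').
  have -> : b = lshift 1 b' by exact: val_inj.
  rewrite -opprB -lie_coord cc_bracket12 mxE block_mxEdl mxE mul0r oppr0 //.
- have -> : a = ez by apply: val_inj => /=; rewrite Ea (ord1 a').
  have -> : b = ez by apply: val_inj => /=; rewrite Eb (ord1 b').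
  by rewrite subrr block_mxEdr mxE mul0r.
Qed.

Definition beta (q : E) c := \sum_b q 0 b * omega b c.

Lemma beta_ez q : beta q ez = 0.
Proof.
rewrite /beta big1 // => b _; case: (splitP b) => [b' Eb|b' Eb].
  have -> : b = lshift 1 b' by exact: val_inj.
  by rewrite block_mxEur mxE mulr0.
have -> : b = ez by apply: val_inj => /=; rewrite Eb (ord1 b').
by rewrite block_mxEdr mxE mulr0.
Qed.

Lemma beta_lshift q i : beta q (lshift 1 i) = (xpart q *m cc_A G) 0 i.
Proof.
rewrite /beta big_split_ord /= big_ord1 block_mxEdl [X in _ * X]mxE mulr0 addr0 mxE.
by apply: eq_bigr => j _; rewrite block_mxEul !mxE.
Qed.

(* Differentiating [Lc_exp] along [L_c] and using the bracket relations. *)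
Lemma Lc_euler c i q : 'D_q (Lc c i) q =
  Lc c i q + beta q c * Lc ez i q - \sum_b Lc c b q * Lc b i q.
Proof.
have dexp j w : \sum_b (w 0 b * Lc b j q + q 0 b * 'D_w (Lc b j) q) = w 0 j.
  have H1 : is_derive (0 : R) 1 (fun s : R => \sum_b (s *: w + q) 0 b * Lc b j (s *: w + q))
      (\sum_b (w 0 b * Lc b j q + q 0 b * 'D_w (Lc b j) q)).
    apply: drv_sum => b _.
    have D1 : is_derive (0 : R) 1 (fun s : R => (s *: w + q) 0 b) (w 0 b).
      have -> : (fun s : R => (s *: w + q) 0 b) = (fun s => w 0 b * s + q 0 b).
        by apply/funext => s; rewrite !mxE mulrC.
      have := drvD (drvZ (w 0 b) (drv_id (0 : R))) (drv_cst (q 0 b) (0 : R)).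
      by rewrite mulr1 addr0.
    have := @drv_line _ _ (Lc b j) 0 w q; rewrite scale0r add0r => /(_ ((Lc_C1 b j).1 _ _)) D2.
    by have := drvM D1 D2; rewrite scale0r add0r.
  have H2 : is_derive (0 : R) 1 (fun s : R => \sum_b (s *: w + q) 0 b * Lc b j (s *: w + q)) (w 0 j).
    have -> : (fun s : R => \sum_b (s *: w + q) 0 b * Lc b j (s *: w + q)) =
        (fun s => w 0 j * s + q 0 j).
      by apply/funext => s; rewrite Lc_exp !mxE mulrC.
    have := drvD (drvZ (w 0 j) (drv_id (0 : R))) (drv_cst (q 0 j) (0 : R)).
    by rewrite mulr1 addr0.
  exact: drv_unique H1 H2.
rewrite (C1_derive_row q q (Lc_C1 c i)).
apply: (@euler_bracket R 'I_N (fun b => q 0 b) (fun b j => Lc b j q) (fun a b => omega a b)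
  (fun b j m => 'D_(e m) (Lc b j) q) ez c i) => [j|a b j|w j].
- exact: Lc_exp.
- exact: bracket.
have := dexp j (\row_m w m); rewrite mxE => <-; apply: eq_bigr => b _.
rewrite mxE (C1_derive_row q _ (Lc_C1 b j)); congr (_ + _ * _).
by apply: eq_bigr => m _; rewrite mxE.
Qed.

Lemma Lc_ray_derive b i q (s : R) :
  is_derive s 1 (fun s => Lc b i (s *: q)) ('D_q (Lc b i) (s *: q)).
Proof.
have := @drv_line _ _ (Lc b i) s q 0 ((Lc_C1 b i).1 _ _).
by rewrite addr0; under eq_fun do rewrite addr0.
Qed.

Lemma Lc_ray_bound q : exists2 C : R, 0 <= C & forall b i (s : R), 0 <= s <= 1 ->
  `|(i == b)%:R - Lc b i (s *: q)| <= C * s.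
Proof.
have bnd b i : exists2 C : R, 0 <= C & forall s : R, 0 <= s <= 1 ->
    `|(i == b)%:R - Lc b i (s *: q)| <= C * s.
  have dc : continuous (fun s : R => 'D_q (Lc b i) (s *: q)).
    move=> s; apply: (@continuous_comp _ _ _ (fun s : R => s *: q) ('D_q (Lc b i))).
      exact: (@cvgZr_tmp R E _ (nbhs s) _ id s q cvg_id).
    exact: (Lc_C1 b i).2.
  have [C C0 HC] := ray_bound (Lc_ray_derive b i q) dc.
  by exists C => // s /HC; rewrite scale0r Lc0.
have /choice[C HC] : forall bi : 'I_N * 'I_N, exists C : R, 0 <= C /\
    forall s : R, 0 <= s <= 1 -> `|(bi.2 == bi.1)%:R - Lc bi.1 bi.2 (s *: q)| <= C * s.
  by move=> [b i]; have [C C0 HC] := bnd b i; exists C.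
exists (\sum_bi C bi); first by apply: sumr_ge0 => bi _; have [] := HC bi.
move=> b i s s01; have [_ /(_ s s01) h] := HC (b, i); apply: le_trans h _.
apply: ler_wpM2r; first by case/andP: s01.
by rewrite (bigD1 (b, i)) //= lerDl sumr_ge0 // => bi _; have [] := HC bi.
Qed.

Lemma Lc_explicit c i q : Lc c i q = (i == c)%:R + 2^-1 * beta q c * (i == ez)%:R.
Proof.
have [C C0 HC] := Lc_ray_bound q.
rewrite -{1}[q]scale1r; apply: (ray_solution (dM := fun b i s => 'D_q (Lc b i) (s *: q))
  (M := fun b i s => Lc b i (s *: q)) C0 (beta_ez q)) => [b j s|b j s|b j s].
- exact: Lc_ray_derive.
- have [_ <-] := deriveZ_dir s ((Lc_C1 b j).1 (s *: q) q).
  have -> : s * beta q b = beta (s *: q) b.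
    by rewrite /beta mulr_sumr; apply: eq_bigr => l _; rewrite [(s *: q) 0 l]mxE mulrA.
  exact: Lc_euler.
- exact: HC.
Qed.

Lemma frameE i q : frame G i q = e1 i + (2^-1 * (xpart q *m cc_A G) 0 i) *: e0.
Proof.
apply/rowP => l; rewrite /frame /e1 left_field_e Lc_explicit beta_lshift !mxE eqxx /=.
by [].
Qed.

End frame.

(** * The exponential map *)

Section dot_product.
Variables (R : realType) (m : nat).
Implicit Types (u v w : 'rV[R]_m).

Lemma dotvE u v : dotv u v = (u *m v^T) 0 0.
Proof. by rewrite mxE; apply: eq_bigr => i _; rewrite mxE. Qed.

Lemma dotvC u v : dotv u v = dotv v u.
Proof. by apply: eq_bigr => i _; rewrite mulrC. Qed.

Lemma dotvDl u v w : dotv (u + v) w = dotv u w + dotv v w.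
Proof. by rewrite -big_split; apply: eq_bigr => i _; rewrite mxE mulrDl. Qed.

Lemma dotvDr u v w : dotv w (u + v) = dotv w u + dotv w v.
Proof. by rewrite dotvC dotvDl !(dotvC w). Qed.

Lemma dotvZl a u v : dotv (a *: u) v = a * dotv u v.
Proof. by rewrite mulr_sumr; apply: eq_bigr => i _; rewrite mxE mulrA. Qed.

Lemma dotvZr a u v : dotv v (a *: u) = a * dotv v u.
Proof. by rewrite dotvC dotvZl dotvC. Qed.

Lemma dotvNl u v : dotv (- u) v = - dotv u v.
Proof. by rewrite -scaleN1r dotvZl mulN1r. Qed.

Lemma dotvBl u v w : dotv (u - v) w = dotv u w - dotv v w.
Proof. by rewrite dotvDl dotvNl. Qed.

Lemma dotvBr u v w : dotv w (u - v) = dotv w u - dotv w v.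
Proof. by rewrite dotvC dotvBl !(dotvC w). Qed.

Lemma dot0v v : dotv 0 v = 0.
Proof. by rewrite -(scale0r v) dotvZl mul0r. Qed.

Lemma dotv_suml I (r : seq I) (P : pred I) (F : I -> 'rV[R]_m) v :
  dotv (\sum_(i <- r | P i) F i) v = \sum_(i <- r | P i) dotv (F i) v.
Proof.
apply: (big_morph (fun u => dotv u v)) => [x y|]; [exact: dotvDl | exact: dot0v].
Qed.

Lemma dotv_mulmx u v (B : 'M[R]_m) : dotv (u *m B) v = dotv u (v *m B^T).
Proof. by rewrite !dotvE trmx_mul trmxK mulmxA. Qed.

Lemma dotv_delta u a : dotv u (delta_mx 0 a) = u 0 a.
Proof.
rewrite /dotv (bigD1 a) //= [X in _ * X]mxE !eqxx mulr1 big1 ?addr0 // => b ba.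
by rewrite [X in _ * X]mxE (negbTE ba) andbF mulr0.
Qed.

Lemma dotv_ge0 u : 0 <= dotv u u.
Proof. by apply: sumr_ge0 => i _; rewrite -expr2 sqr_ge0. Qed.

Lemma dotv_eq0 u : dotv u u = 0 -> u = 0.
Proof.
move=> u0; apply: row_sqr_eq0; apply/matrixP => i j.
by rewrite !ord1 -dotvE u0 mxE.
Qed.

Lemma dotv_skew (A : 'M[R]_m) u v : A^T = - A -> dotv (u *m A) v = - dotv u (v *m A).
Proof. by move=> AT; rewrite dotv_mulmx AT mulmxN dotvC dotvNl dotvC. Qed.

Lemma dotv_skew0 (A : 'M[R]_m) u : A^T = - A -> dotv u (u *m A) = 0.
Proof.
move=> AT; have := dotv_skew u u AT; rewrite dotvC => /eqP.
by rewrite -addr_eq0 -mulr2n mulrn_eq0 /= => /eqP.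
Qed.

End dot_product.

Section row_derivatives.
Variables (R : realType).

(** Taken coordinatewise, so that its rules reduce to those for real functions. *)
Definition vdrv m (h : R -> 'rV[R]_m) (t : R) (d : 'rV[R]_m) :=
  forall i, is_derive t 1 (fun s => h s 0 i) (d 0 i).

Lemma vdrv_cst m (u : 'rV[R]_m) t : vdrv (fun=> u) t 0.
Proof. by move=> i; rewrite mxE; exact: drv_cst. Qed.

Lemma vdrvD m (h g : R -> 'rV[R]_m) t d e : vdrv h t d -> vdrv g t e ->
  vdrv (fun s => h s + g s) t (d + e).
Proof.
move=> hd ge i; rewrite mxE.
have -> : (fun s => (h s + g s) 0 i) = (fun s => h s 0 i + g s 0 i).
  by apply/funext => s; rewrite mxE.
exact: drvD (hd i) (ge i).
Qed.

Lemma vdrvZ m a (h : R -> 'rV[R]_m) t d : vdrv h t d -> vdrv (fun s => a *: h s) t (a *: d).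
Proof.
move=> hd i; rewrite mxE.
have -> : (fun s => (a *: h s) 0 i) = (fun s => a * h s 0 i).
  by apply/funext => s; rewrite mxE.
exact: drvZ.
Qed.

Lemma vdrvB m (h g : R -> 'rV[R]_m) t d e : vdrv h t d -> vdrv g t e ->
  vdrv (fun s => h s - g s) t (d - e).
Proof.
move=> hd ge i; rewrite !mxE.
have -> : (fun s => (h s - g s) 0 i) = (fun s => h s 0 i - g s 0 i).
  by apply/funext => s; rewrite !mxE.
exact: drvB (hd i) (ge i).
Qed.

Lemma vdrv_scale m (f : R -> R) (u : 'rV[R]_m) (t : R) d : is_derive t 1 f d ->
  vdrv (fun s => f s *: u) t (d *: u).
Proof.
move=> fd i; have := drvZ (u 0 i) fd; rewrite mxE mulrC.
have -> // : (fun s => (f s *: u) 0 i) = (fun t0 => u 0 i * f t0).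
by apply/funext => s; rewrite mxE mulrC.
Qed.

Lemma vdrvM m k (h : R -> 'rV[R]_m) (B : 'M[R]_(m, k)) t d :
  vdrv h t d -> vdrv (fun s => h s *m B) t (d *m B).
Proof.
move=> hd i; have := @drv_sum R 'I_m (index_enum _) xpredT (fun j s => B j i * h s 0 j)
  (fun j => B j i * d 0 j) t (fun j _ => drvZ (B j i) (hd j)).
rewrite (_ : (fun t0 => _) = (fun s => (h s *m B) 0 i)).
  by rewrite mxE; under eq_bigr do rewrite mulrC.
by apply/funext => s; rewrite mxE; apply: eq_bigr => j _; rewrite mulrC.
Qed.

Lemma vdrv_sum m I (r : seq I) (h : I -> R -> 'rV[R]_m) t (d : I -> 'rV[R]_m) :
  (forall j, vdrv (h j) t (d j)) -> vdrv (fun s => \sum_(j <- r) h j s) t (\sum_(j <- r) d j).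
Proof.
move=> hd; elim: r => [|j r IH].
  rewrite big_nil; under eq_fun do rewrite big_nil; exact: vdrv_cst.
rewrite big_cons; under eq_fun do rewrite big_cons; exact: vdrvD.
Qed.

Lemma drv_dotv m (h g : R -> 'rV[R]_m) (t : R) d e : vdrv h t d -> vdrv g t e ->
  is_derive t 1 (fun s => dotv (h s) (g s)) (dotv d (g t) + dotv (h t) e).
Proof.
move=> hd ge; rewrite /dotv -big_split /=.
exact: (@drv_sum R 'I_m (index_enum _) xpredT (fun j s => h s 0 j * g s 0 j) _ t
  (fun j _ => drvM (hd j) (ge j))).
Qed.

Lemma vdrv0_cst m (h : R -> 'rV[R]_m) : (forall t, vdrv h t 0) -> forall t, h t = h 0.
Proof.
move=> hd t; apply/rowP => i.
by apply: (is_derive_0_is_cst (f := fun s => h s 0 i)) => s; have := hd s i; rewrite mxE.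
Qed.

Lemma drv0_cst (f : R -> R) : (forall t : R, is_derive t 1 f 0) -> forall t, f t = f 0.
Proof. by move=> fd t; apply: is_derive_0_is_cst. Qed.

Lemma drv_comp_linear (V W : normedModType R) (phi : V -> W) (c : R -> V) (t : R) d :
  (forall a u v, phi (a *: (u - v)) = a *: (phi u - phi v)) -> continuous phi ->
  is_derive t 1 c d -> is_derive t 1 (fun s => phi (c s)) (phi d).
Proof.
move=> phil phic [cd <-].
have key : h^-1 *: (phi (c (h *: 1 + t)) - phi (c t)) @[h --> 0^'] --> phi ('D_1 c t).
  under eq_fun do rewrite -phil.
  have H : (h^-1 *: (c (h *: 1 + t) - c t)) @[h --> 0^'] --> 'D_1 c t by exact: cd.
  exact: (cvg_comp _ _ H (phic _)).
split; first by apply/cvg_ex; exists (phi ('D_1 c t)).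
by apply: cvg_lim => //; exact: key.
Qed.

End row_derivatives.

(** * The Hamiltonian flow and its conservation laws *)

Section hamiltonian.
Variables (R : realType) (n : nat) (G : contactCarnot R n).
Local Notation A := (cc_A G).
Local Notation E := 'rV[R]_(n.*2 + 1).
Local Notation cotangent := (E * E)%type.
Implicit Types (q p : E) (eta : cotangent).

(** The momenta of the covector along the fields f_i, read in the explicit frame (see
    [dotv_frame]). *)
Definition hmom (eta : cotangent) : 'rV[R]_(n.*2) :=
  xpart eta.2 + (2^-1 * zpart eta.2) *: (xpart eta.1 *m A).

Lemma rowP_xz p q : xpart p = xpart q -> zpart p = zpart q -> p = q.
Proof.
move=> xpq zpq; rewrite -[p]hsubmxK -[q]hsubmxK; congr row_mx; first exact: xpq.
by apply/rowP => i; rewrite (ord1 i).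
Qed.

Lemma dotv_frame p q i : dotv p (frame G i q) = hmom (q, p) 0 i.
Proof.
rewrite frameE dotvDr dotvZr.
rewrite /e1 /e0 !dotv_delta /hmom /xpart /zpart !mxE; congr (_ + _).
by rewrite -!mulrA; congr (_ * _); rewrite mulrC.
Qed.

Lemma hamiltonianE eta : hamiltonian G eta = 2^-1 * \sum_i hmom eta 0 i ^+ 2.
Proof. by case: eta => q p; congr (_ * _); apply: eq_bigr => i _; rewrite dotv_frame. Qed.

(** The Hamiltonian is |h|^2 / 2. Although [hmom] has a bilinear term, it is affine along each
    coordinate direction, which is the case treated here. *)
Lemma derive_hamiltonian (v : cotangent) eta (g : 'rV[R]_(n.*2)) :
  (forall s, hmom (s *: v + eta) = hmom eta + s *: g) ->
  'D_v (hamiltonian G) eta = dotv (hmom eta) g.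
Proof.
move=> hE.
suff /line_drv[_ ->] : is_derive (0 : R) 1 (fun s => hamiltonian G (s *: v + eta)) (dotv (hmom eta) g).
  by [].
have -> : (fun s => hamiltonian G (s *: v + eta)) =
    (fun s => 2^-1 * dotv (hmom eta + s *: g) (hmom eta + s *: g)).
  by apply/funext => s; rewrite hamiltonianE hE; congr (_ * _); apply: eq_bigr => i _; rewrite expr2.
have hd : vdrv (fun s => hmom eta + s *: g) 0 (0 + 1 *: g).
  by apply: vdrvD; [exact: vdrv_cst | exact: vdrv_scale (drv_id 0)].
have := drvZ 2^-1 (drv_dotv hd hd); move/is_derive_eq; apply.
rewrite scale0r addr0 add0r scale1r (dotvC g); by field.
Qed.

Lemma xpartD p q : xpart (p + q) = xpart p + xpart q. Proof. exact: linearD. Qed.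
Lemma xpartZ (a : R) p : xpart (a *: p) = a *: xpart p. Proof. exact: linearZ. Qed.
Lemma zpartD p q : zpart (p + q) = zpart p + zpart q.
Proof. by rewrite /zpart !mxE. Qed.
Lemma zpartZ (a : R) p : zpart (a *: p) = a * zpart p.
Proof. by rewrite /zpart !mxE. Qed.
Lemma xpart0 : @xpart R n 0 = 0. Proof. exact: linear0. Qed.
Lemma zpart0 : @zpart R n 0 = 0. Proof. by rewrite /zpart !mxE. Qed.
Lemma xpart_e1 i : @xpart R n (e1 i) = delta_mx 0 i.
Proof. by apply/rowP => j; rewrite !mxE /= (inj_eq (@lshift_inj _ _)). Qed.
Lemma zpart_e1 i : @zpart R n (e1 i) = 0.
Proof. by rewrite /zpart !mxE /= eq_rlshift. Qed.
Lemma xpart_e0 : @xpart R n e0 = 0.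
Proof. by apply/rowP => j; rewrite !mxE /= eq_lrshift. Qed.
Lemma zpart_e0 : @zpart R n e0 = 1.
Proof. by rewrite /zpart !mxE /= eqxx. Qed.

Lemma xfield eta : xpart (hamiltonian_field G eta).1 = hmom eta.
Proof.
apply/rowP => i; rewrite [LHS]mxE [LHS]mxE (@derive_hamiltonian _ _ (delta_mx 0 i)); last first.
  move=> s; rewrite /hmom /= -/(e1 i) scaler0 add0r xpartD xpartZ zpartD zpartZ.
  by rewrite xpart_e1 zpart_e1 mulr0 add0r -addrA addrC.
by rewrite dotv_delta.
Qed.

Lemma zfield eta : zpart (hamiltonian_field G eta).1 =
  2^-1 * dotv (hmom eta) (xpart eta.1 *m A).
Proof.
rewrite /zpart [LHS]mxE [LHS]mxE (@derive_hamiltonian _ _ (2^-1 *: (xpart eta.1 *m A))) ?dotvZr //.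
move=> s; rewrite /hmom /= -/(@e0 R n) scaler0 add0r xpartD xpartZ zpartD zpartZ.
rewrite xpart_e0 zpart_e0 scaler0 add0r mulr1 mulrDr scalerDl -addrA; congr (_ + _).
by rewrite addrC scalerA [s * _]mulrC.
Qed.

Lemma xfield2 eta : xpart (hamiltonian_field G eta).2 =
  (2^-1 * zpart eta.2) *: (hmom eta *m A).
Proof.
apply/rowP => j; rewrite [LHS]mxE [LHS]mxE [RHS]mxE.
rewrite (@derive_hamiltonian _ _ ((2^-1 * zpart eta.2) *: (delta_mx 0 j *m A))); last first.
  move=> s; rewrite /hmom /= -/(e1 j) scaler0 add0r xpartD xpartZ xpart_e1.
  rewrite mulmxDl scalerDr -scalemxAl -addrA; congr (_ + _); rewrite addrC; congr (_ + _).
  by rewrite !scalerA mulrC.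
rewrite dotvZr -mulrN; congr (_ * _).
rewrite dotvC (dotv_skew _ _ (cc_A_skew G)) opprK.
by rewrite dotvC dotv_delta.
Qed.

Lemma zfield2 eta : zpart (hamiltonian_field G eta).2 = 0.
Proof.
rewrite /zpart [LHS]mxE [LHS]mxE (@derive_hamiltonian _ _ 0); last first.
  move=> s; rewrite /hmom /= -/(@e0 R n) !scaler0 add0r xpartD xpartZ xpart_e0 scaler0 add0r.
  by rewrite addr0.
by rewrite dotvC dot0v oppr0.
Qed.

Section curve.
Variables (c : R -> cotangent) (eta : E).
Hypothesis cI : integral_curve G (0, eta) c.
Let u := xpart eta.
Let lam := zpart eta.
Let X t := xpart (c t).1.
Let h t := hmom (c t).

Lemma coord_phi1 a : continuous (fun w : cotangent => w.1 0 a).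
Proof.
move=> w; apply: (@continuous_comp _ _ _ (fun w : cotangent => w.1) (fun M : E => M 0 a)).
  exact: cvg_fst.
exact: coord_continuous.
Qed.

Lemma coord_phi2 a : continuous (fun w : cotangent => w.2 0 a).
Proof.
move=> w; apply: (@continuous_comp _ _ _ (fun w : cotangent => w.2) (fun M : E => M 0 a)).
  exact: cvg_snd.
exact: coord_continuous.
Qed.

Lemma curve_coord1 (t : R) a : is_derive t 1 (fun s => (c s).1 0 a) ((hamiltonian_field G (c t)).1 0 a).
Proof.
apply: (@drv_comp_linear _ _ R^o (fun w : cotangent => w.1 0 a) c).
- by move=> k w w'; rewrite !mxE.
- exact: coord_phi1.
- exact: cI.2.
Qed.

Lemma curve_coord2 (t : R) a : is_derive t 1 (fun s => (c s).2 0 a) ((hamiltonian_field G (c t)).2 0 a).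
Proof.
apply: (@drv_comp_linear _ _ R^o (fun w : cotangent => w.2 0 a) c).
- by move=> k w w'; rewrite !mxE.
- exact: coord_phi2.
- exact: cI.2.
Qed.

Lemma curve_X t : vdrv X t (h t).
Proof.
move=> i; rewrite /h -xfield mxE; have := curve_coord1 t (lshift 1 i).
by under [in X in _ -> is_derive _ _ X _]eq_fun do rewrite mxE.
Qed.

Lemma curve_Z (t : R) : is_derive t 1 (fun s => zpart (c s).1) (2^-1 * dotv (h t) (X t *m A)).
Proof.
rewrite /h /X -zfield /zpart [X in is_derive _ _ _ X]mxE.
have := curve_coord1 t (rshift n.*2 ord0).
by under [in X in _ -> is_derive _ _ X _]eq_fun do rewrite mxE.
Qed.

Lemma curve_lam t : zpart (c t).2 = lam.
Proof.
have H (s : R) : is_derive s 1 (fun s => zpart (c s).2) 0.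
  have := curve_coord2 s (rshift n.*2 ord0).
  have -> : (hamiltonian_field G (c s)).2 0 (rshift n.*2 ord0) = 0.
    by rewrite -[RHS](zfield2 (c s)) /zpart [RHS]mxE.
  by under [in X in _ -> is_derive _ _ X _]eq_fun do rewrite /zpart mxE.
by rewrite (drv0_cst H) cI.1.
Qed.

Lemma curve_P t : vdrv (fun s => xpart (c s).2) t ((2^-1 * lam) *: (h t *m A)).
Proof.
move=> i; rewrite -(curve_lam t) /h -xfield2 mxE; have := curve_coord2 t (lshift 1 i).
by under [in X in _ -> is_derive _ _ X _]eq_fun do rewrite mxE.
Qed.

(** Two equal halves: one from the covector, one from the motion of the base point. *)
Lemma curve_h t : vdrv h t (lam *: (h t *m A)).
Proof.
have hE : (fun s => xpart (c s).2 + (2^-1 * lam) *: (X s *m A)) = h.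
  by apply/funext => s; rewrite /h /hmom curve_lam.
have -> : lam *: (h t *m A) = (2^-1 * lam) *: (h t *m A) + (2^-1 * lam) *: (h t *m A).
  by rewrite -scalerDl; congr (_ *: _); field.
rewrite -{1}hE; apply: vdrvD; first exact: curve_P.
by apply: vdrvZ; apply: vdrvM; exact: curve_X.
Qed.

Lemma curve_X0 : X 0 = 0.
Proof. by rewrite /X cI.1 /=; exact: linear0. Qed.

Lemma curve_h0 : h 0 = u.
Proof. by rewrite /h /hmom cI.1 /= xpart0 mul0mx scaler0 addr0. Qed.

Lemma skew_flow_norm (d : R -> 'rV[R]_(n.*2)) : (forall t, vdrv d t (lam *: (d t *m A))) ->
  forall t, dotv (d t) (d t) = dotv (d 0) (d 0).
Proof.
move=> dd; apply: drv0_cst => t; have := drv_dotv (dd t) (dd t).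
move/is_derive_eq; apply.
by rewrite dotvC dotvZr dotv_skew0 ?cc_A_skew // mulr0 addr0.
Qed.

(** The difference of two solutions solves the same skew equation, so its norm keeps the initial
    value 0. *)
Lemma curve_h_unique (g : R -> 'rV[R]_(n.*2)) : (forall t, vdrv g t (lam *: (g t *m A))) ->
  g 0 = u -> forall t, h t = g t.
Proof.
move=> gd g0 t; apply/eqP; rewrite -subr_eq0; apply/eqP; apply: dotv_eq0.
rewrite (@skew_flow_norm (fun t => h t - g t)) ?g0 ?curve_h0 ?subrr ?dot0v // => s.
by rewrite mulmxBl scalerBr; apply: vdrvB; [exact: curve_h | exact: gd].
Qed.

Lemma curve_horizontal t : lam *: (X t *m A) = h t - u.
Proof.
have H s : vdrv (fun s => lam *: (X s *m A) - h s) s 0.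
  rewrite -(subrr (lam *: (h s *m A))); apply: vdrvB; last exact: curve_h.
  by apply: vdrvZ; apply: vdrvM; exact: curve_X.
have := vdrv0_cst H t; rewrite curve_X0 mul0mx scaler0 sub0r curve_h0 => /eqP.
by rewrite subr_eq addrC => /eqP.
Qed.

(** After multiplication by [lam], [curve_horizontal] replaces lam X A by h - u in z', and |h|^2 is
    constant; the vertical coordinate is thus found without integrating the rotation. *)
Lemma curve_vertical t : 2 * lam * zpart (c t).1 = dotv u u * t - dotv u (X t).
Proof.
have H (s : R) : is_derive s 1
    (fun s => 2 * lam * zpart (c s).1 - dotv u u * s + dotv u (X s)) 0.
  have := drvD (drvB (drvZ (2 * lam) (curve_Z s)) (drvZ (dotv u u) (drv_id s)))
    (drv_dotv (vdrv_cst u s) (curve_X s)).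
  move/is_derive_eq; apply; rewrite dot0v add0r mulr1.
  have -> : 2 * lam * (2^-1 * dotv (h s) (X s *m A)) = dotv (h s) (lam *: (X s *m A)).
    by rewrite dotvZr; field.
  rewrite curve_horizontal dotvBr (skew_flow_norm curve_h) curve_h0 (dotvC (h s)).
  by ring.
have := drv0_cst H t; rewrite curve_X0 cI.1 /= mulr0 subr0 [dotv u 0]dotvC dot0v addr0.
have -> : zpart (0 : E) = 0 by rewrite /zpart !mxE.
by rewrite mulr0 => H0; rewrite -[LHS]subr0 -[X in _ - X]H0; ring.
Qed.

Lemma curve_lam0 : lam = 0 -> X 1 = u /\ zpart (c 1).1 = 0.
Proof.
move=> l0.
have hu t : h t = u by have := curve_horizontal t; rewrite l0 scale0r => /eqP; rewrite eq_sym subr_eq0 => /eqP.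
have XE t : X t = t *: u.
  have H s : vdrv (fun s => X s - s *: u) s 0.
    by have := vdrvB (curve_X s) (vdrv_scale u (drv_id s)); rewrite hu scale1r subrr.
  by have := vdrv0_cst H t; rewrite curve_X0 scale0r subr0 => /eqP; rewrite subr_eq0 => /eqP.
split; first by rewrite XE scale1r.
have H (s : R) : is_derive s 1 (fun s => zpart (c s).1) 0.
  have := curve_Z s; move/is_derive_eq; apply.
  by rewrite hu XE -scalemxAl dotvZr dotv_skew0 ?cc_A_skew // !mulr0.
by rewrite (drv0_cst H) cI.1 /zpart !mxE.
Qed.

End curve.
End hamiltonian.

Section build_curve.
Variables (R : realType) (N : nat).
Local Notation E := 'rV[R]_N.

Lemma drv_vsum (V : normedModType R) I (r : seq I) (c : I -> R -> R) (d : I -> R) (v : I -> V) (t : R) :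
  (forall i, is_derive t 1 (c i) (d i)) ->
  is_derive t 1 (fun s => \sum_(i <- r) c i s *: v i) (\sum_(i <- r) d i *: v i).
Proof.
move=> cd; elim: r => [|i r IH].
  have -> : (fun s => \sum_(i <- [::]) c i s *: v i) = cst 0.
    by apply/funext => s; rewrite big_nil.
  by rewrite big_nil; exact: is_derive_cst.
have -> : (fun s => \sum_(j <- i :: r) c j s *: v j) =
    (fun s => c i s *: v i) + (fun s => \sum_(j <- r) c j s *: v j).
  by apply/funext => s; rewrite big_cons.
rewrite big_cons; apply: is_deriveD => //.
apply: (@drv_comp_linear R R^o V (fun x : R => x *: v i) (c i) t (d i)) => //.
- by move=> a u w; rewrite -scalerBl scalerA.
- by move=> x; apply: cvgZr_tmp; exact: cvg_id.
Qed.

Lemma drv_pair (c : R -> E * E) (t : R) (d : E * E) :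
  (forall a, is_derive t 1 (fun s => (c s).1 0 a) (d.1 0 a)) ->
  (forall a, is_derive t 1 (fun s => (c s).2 0 a) (d.2 0 a)) ->
  is_derive t 1 c d.
Proof.
move=> d1 d2.
have E' (w : E * E) : w = \sum_a w.1 0 a *: ((delta_mx 0 a, 0) : E * E) +
    \sum_a w.2 0 a *: ((0, delta_mx 0 a) : E * E).
  rewrite [LHS]surjective_pairing [RHS]surjective_pairing; congr (_, _) => /=.
    rewrite !(big_morph fst (id1 := 0) (op1 := +%R)) // [X in _ + X]big1 ?addr0.
      exact: row_sum_delta.
    by move=> a _ /=; rewrite scaler0.
  rewrite !(big_morph snd (id1 := 0) (op1 := +%R)) // big1 ?add0r.
    exact: row_sum_delta.
  by move=> a _ /=; rewrite scaler0.
rewrite [d]E'.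
have -> : c = (fun s => \sum_a (c s).1 0 a *: ((delta_mx 0 a, 0) : E * E)) +
    (fun s => \sum_a (c s).2 0 a *: ((0, delta_mx 0 a) : E * E)).
  by apply/funext => s; exact: E'.
by apply: is_deriveD; exact: drv_vsum.
Qed.

End build_curve.

(** * The exponential map in closed form *)

Section exponential.
Variables (R : realType) (n k : nat) (G : contactCarnot R n) (al : k.-tuple R).
Hypothesis G_al : distinct_singular_values (cc_A G) al.
Local Notation A := (cc_A G).
Local Notation E := 'rV[R]_(n.*2 + 1).
Local Notation P j := (sv_proj (cc_A G) (tnth al j)).
Local Notation a_ j := (tnth al j).
Implicit Types (u : 'rV[R]_(n.*2)) (eta p : E).

(** The row u exp(lam t A): on the j-th component A / a_j squares to -1. *)
Definition rotation u (lam t : R) : 'rV[R]_(n.*2) :=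
  \sum_j (cos (lam * a_ j * t) *: (u *m P j) + (sin (lam * a_ j * t) / a_ j) *: (u *m P j *m A)).

Lemma proj_sqr_row u j : u *m P j *m A *m A = - a_ j ^+ 2 *: (u *m P j).
Proof.
have -> : u *m P j *m A *m A = u *m (P j *m A *m A) by rewrite !mulmxA.
by rewrite proj_sqr ?cc_A_skew // -scalemxAr.
Qed.

Lemma sum_proj_row u : \sum_j u *m P j = u.
Proof. by rewrite -mulmx_sumr (sum_proj (cc_A_nondeg G) G_al) mulmx1. Qed.

Lemma rotation_drv u lam t : vdrv (rotation u lam) t (lam *: (rotation u lam t *m A)).
Proof.
rewrite /rotation mulmx_suml scaler_sumr; apply: vdrv_sum => j.
have a0 : a_ j != 0 by rewrite gt_eqF // (sv_gt0 (cc_A_nondeg G) G_al).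
have dc := drv_dilate (is_derive_cos (lam * a_ j * t)).
have ds := drv_dilate (is_derive_sin (lam * a_ j * t)).
have := vdrvD (vdrv_scale (u *m P j) dc)
  (vdrv_scale (u *m P j *m A) (drvM ds (drv_cst (a_ j)^-1 t))).
congr (vdrv _ t _); rewrite mulr0 addr0 mulmxDl -!scalemxAl proj_sqr_row scalerDr !scalerA.
by rewrite addrC; congr (_ *: _ + _ *: _); field.
Qed.

Lemma rotation0 u lam : rotation u lam 0 = u.
Proof.
rewrite -[RHS]sum_proj_row; apply: eq_bigr => j _.
by rewrite mulr0 cos0 sin0 mul0r scale0r addr0 scale1r.
Qed.

Definition mk_pt (x : 'rV[R]_(n.*2)) (z : R) : E := row_mx x z%:M.

Lemma xpart_mk x z : xpart (mk_pt x z) = x. Proof. exact: row_mxKl. Qed.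
Lemma zpart_mk x z : zpart (mk_pt x z) = z.
Proof. by rewrite /zpart row_mxKr mxE eqxx mulr1n. Qed.

Lemma mk_curve eta (X : R -> 'rV[R]_(n.*2)) (Z : R -> R) (h : R -> 'rV[R]_(n.*2)) :
  X 0 = 0 -> Z 0 = 0 -> h 0 = xpart eta ->
  (forall t, vdrv X t (h t)) -> (forall t : R, is_derive t 1 Z (2^-1 * dotv (h t) (X t *m A))) ->
  (forall t, vdrv h t (zpart eta *: (h t *m A))) ->
  exists c, integral_curve G (0, eta) c.
Proof.
move=> X0 Z0 h0 Xd Zd hd; set lam := zpart eta in hd.
pose Pm t := h t - (2^-1 * lam) *: (X t *m A).
pose c t : E * E := (mk_pt (X t) (Z t), mk_pt (Pm t) lam); exists c.
have hm t : hmom G (c t) = h t.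
  by rewrite /hmom /= !xpart_mk zpart_mk /Pm subrK.
split.
  rewrite /c X0 Z0 /Pm h0 X0 mul0mx scaler0 subr0; congr (_, _).
    by apply: rowP_xz; rewrite ?xpart_mk ?zpart_mk ?xpart0 ?zpart0.
  by apply: rowP_xz; rewrite ?xpart_mk ?zpart_mk.
have coord (x : R -> 'rV[R]_(n.*2)) (z : R -> R) (t : R) dx dz (d : E) : vdrv x t dx -> is_derive t 1 z dz ->
    xpart d = dx -> zpart d = dz ->
    forall a, is_derive t 1 (fun s => mk_pt (x s) (z s) 0 a) (d 0 a).
  move=> xd zd dX dZ a; case: (splitP a) => [i Ea|i Ea].
    have -> : a = lshift 1 i by exact: val_inj.
    have -> : d 0 (lshift 1 i) = dx 0 i by rewrite -dX mxE.
    have -> : (fun s => mk_pt (x s) (z s) 0 (lshift 1 i)) = (fun s => x s 0 i).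
      by apply/funext => s; rewrite row_mxEl.
    exact: xd.
  have -> : a = rshift n.*2 ord0 by apply: val_inj => /=; rewrite Ea (ord1 i).
  have -> : d 0 (rshift n.*2 ord0) = dz by rewrite -dZ /zpart mxE.
  have -> // : (fun s => mk_pt (x s) (z s) 0 (rshift n.*2 ord0)) = z.
  by apply/funext => s; rewrite row_mxEr mxE eqxx mulr1n.
move=> t; apply: drv_pair.
  by apply: coord (Xd t) (Zd t) _ _; rewrite ?xfield ?zfield /= ?hm ?xpart_mk.
have Pd : vdrv Pm t ((2^-1 * lam) *: (h t *m A)).
  have := vdrvB (hd t) (vdrvZ (2^-1 * lam) (vdrvM A (Xd t))).
  by congr (vdrv _ t _); rewrite -scalerBl; congr (_ *: _); field.
by apply: coord Pd (drv_cst lam t) _ _; rewrite ?xfield2 ?zfield2 /= ?hm ?zpart_mk.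
Qed.

(** Needed because [exp_map] selects a curve by [get]. For lam <> 0 the curve is obtained by solving
    the conservation laws [curve_horizontal] and [curve_vertical] for the position. *)
Lemma integral_curve_exists eta : exists c, integral_curve G (0, eta) c.
Proof.
set u := xpart eta; set lam := zpart eta; have [l0|l0] := eqVneq lam 0.
  apply: (@mk_curve eta (fun t => t *: u) (fun=> 0) (fun=> u)) => //.
  - by rewrite scale0r.
  - by move=> t; have := vdrv_scale u (drv_id t); rewrite scale1r.
  - move=> t; have := drv_cst 0 t; move/is_derive_eq; apply.
    by rewrite -scalemxAl dotvZr dotv_skew0 ?cc_A_skew // !mulr0.
  - by move=> t; rewrite -/lam l0 scale0r; exact: vdrv_cst.
pose h := rotation u lam; pose X t := lam^-1 *: ((h t - u) *m invmx A).
have XA t : X t *m A = lam^-1 *: (h t - u) by rewrite -scalemxAl mulmxKV ?cc_A_nondeg.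
have hd := rotation_drv u lam.
have Xd t : vdrv X t (h t).
  have := vdrvZ lam^-1 (vdrvM (invmx A) (vdrvB (hd t) (vdrv_cst u t))).
  congr (vdrv _ t _); rewrite subr0 -scalemxAl mulmxK ?cc_A_nondeg // scalerA mulVf //.
  by rewrite scale1r.
have hn t : dotv (h t) (h t) = dotv u u.
  by rewrite (@skew_flow_norm _ _ G eta h hd) /h rotation0.
apply: (@mk_curve eta X (fun t => (2 * lam)^-1 * (dotv u u * t - dotv u (X t))) h) => //.
- by rewrite /X /h rotation0 subrr mul0mx scaler0.
- by rewrite /X /h rotation0 subrr mul0mx scaler0 mulr0 dotvC dot0v subrr mulr0.
- exact: rotation0.
- move=> t; have := drvZ (2 * lam)^-1 (drvB (drvZ (dotv u u) (drv_id t)) (drv_dotv (vdrv_cst u t) (Xd t))).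
  move/is_derive_eq; apply; rewrite dot0v add0r mulr1 XA dotvZr dotvBr hn (dotvC (h t)).
  by field.
Qed.

Lemma exp_map_curve eta : exists2 c, integral_curve G (0, eta) c & exp_map G eta = (c 1).1.
Proof.
exists (get (integral_curve G (0, eta))) => //.
by have [c cI] := integral_curve_exists eta; exact: getI cI.
Qed.

(** For lam <> 0 the conservation laws at time 1 determine the endpoint, [A] being invertible. *)
Lemma exp_mapP eta p : exp_map G eta = p <->
  (zpart eta = 0 /\ xpart p = xpart eta /\ zpart p = 0) \/
  (zpart eta != 0 /\
   zpart eta *: (xpart p *m A) = rotation (xpart eta) (zpart eta) 1 - xpart eta /\
   2 * zpart eta * zpart p = dotv (xpart eta) (xpart eta) - dotv (xpart eta) (xpart p)).
Proof.
have [c cI ->] := exp_map_curve eta; set lam := zpart eta; set u := xpart eta.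
have hE := curve_h_unique cI (rotation_drv u lam) (rotation0 u lam) 1.
have hor := curve_horizontal cI 1; rewrite hE in hor.
have ver := curve_vertical cI 1; rewrite mulr1 in ver.
split=> [<-|].
  have [l0|l0] := eqVneq lam 0; [left | right].
    by have [H1 H2] := curve_lam0 cI l0.
  by [].
have [l0|l0] := eqVneq lam 0.
  case=> [[_ [xp zp]]|[]]; last by [].
  have [H1 H2] := curve_lam0 cI l0.
  by apply: rowP_xz; rewrite ?H1 ?H2.
case=> [[]|[_ [hp vp]]]; first by move/eqP; rewrite (negbTE l0).
have XE : xpart (c 1).1 = xpart p.
  apply: (can_inj (mulmxK (cc_A_nondeg G))); apply: (scalerI l0).
  by rewrite hp hor.
apply: rowP_xz => //; apply: (mulfI (x := 2 * lam)); first by rewrite mulf_neq0 // pnatr_eq0.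
by rewrite ver vp XE.
Qed.

End exponential.

(** * Fibers over [lam] *)

Section inversion.
Variables (R : realType) (lam a c s : R).
Hypotheses (lam0 : lam != 0) (a0 : a != 0) (c1 : 1 - c != 0) (s2 : s ^+ 2 = 1 - c ^+ 2).

(** With Y = X A and W = U A, the first equation is the second one multiplied by A. Together they
    form a 2 by 2 system in U and W of determinant (c - 1)^2 + s^2 = 2 (1 - c), up to sign and
    scaling. *)
Lemma invert_scalar (X Y U W : R) : - (lam * a ^+ 2) * X = (c - 1) * W - (s * a) * U ->
  lam * Y = (c - 1) * U + (s / a) * W ->
  U = (lam * a * s / (2 * (1 - c))) * X - (lam / 2) * Y.
Proof.
move=> e1 e2.
have -> : X = ((1 - c) * W + s * a * U) / (lam * a ^+ 2).
  have la : lam * a ^+ 2 != 0 by rewrite mulf_neq0 // expf_neq0.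
  apply: (mulfI la); rewrite -[LHS]opprK -mulNr e1; field.
  by rewrite lam0 a0.
have -> : Y = ((c - 1) * U + (s / a) * W) / lam by rewrite -e2 mulrC mulKf.
apply/eqP; rewrite -subr_eq0; apply/eqP.
transitivity ((1 - c ^+ 2 - s ^+ 2) * U / (2 * (1 - c))).
  by field; rewrite lam0 a0 c1.
by rewrite s2 subrr !mul0r.
Qed.

Lemma invert_vec m (X Y U W : 'rV[R]_m) :
  - (lam * a ^+ 2) *: X = (c - 1) *: W - (s * a) *: U ->
  lam *: Y = (c - 1) *: U + (s / a) *: W ->
  U = (lam * a * s / (2 * (1 - c))) *: X - (lam / 2) *: Y.
Proof.
move=> e1 e2; apply/rowP => i; rewrite !mxE; apply: invert_scalar (W 0 i) _ _.
  by move/rowP/(_ i): e1; rewrite !mxE.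
by move/rowP/(_ i): e2; rewrite !mxE.
Qed.

Lemma invert_vec_back m (X Y U W : 'rV[R]_m) :
  U = (lam * a * s / (2 * (1 - c))) *: X - (lam / 2) *: Y ->
  W = (lam * a * s / (2 * (1 - c))) *: Y + (lam * a ^+ 2 / 2) *: X ->
  lam *: Y = (c - 1) *: U + (s / a) *: W.
Proof.
move=> -> ->; apply/rowP => i; rewrite !mxE.
apply/eqP; rewrite -subr_eq0; apply/eqP.
transitivity ((1 - c ^+ 2 - s ^+ 2) * lam * Y 0 i / (2 * (1 - c))).
  by field; rewrite a0 c1.
by rewrite s2 subrr !mul0r.
Qed.

End inversion.

(** * The covectors that reach a given point *)

Section geodesics.
Variables (R : realType) (n k : nat) (G : contactCarnot R n) (al : k.-tuple R).
Hypothesis G_al : distinct_singular_values (cc_A G) al.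
Local Notation A := (cc_A G).
Local Notation E := 'rV[R]_(n.*2 + 1).
Local Notation P j := (sv_proj (cc_A G) (tnth al j)).
Local Notation a_ j := (tnth al j).
Local Notation V := 'rV[R]_(n.*2).
Implicit Types (u v : V) (eta : E) (lam : R).

Lemma a_gt0 j : 0 < a_ j. Proof. exact: sv_gt0 (cc_A_nondeg G) G_al j. Qed.

Lemma PP i j : P i *m P j = if i == j then P i else 0.
Proof. exact: proj_proj (cc_A_nondeg G) G_al i j. Qed.

Lemma PA j : A *m P j = P j *m A.
Proof. exact: proj_comm (cc_A_skew G) (cc_A_nondeg G) G_al j. Qed.

Lemma PT j : (P j)^T = P j.
Proof. exact: projT (cc_A_nondeg G) G_al j. Qed.

Lemma mulP u i j : u *m P i *m P j = if i == j then u *m P i else 0.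
Proof. by rewrite -mulmxA PP; case: eqP => // _; rewrite mulmx0. Qed.

Lemma mulPA u i j : u *m P i *m A *m P j = if i == j then u *m P i *m A else 0.
Proof.
rewrite -mulmxA PA mulmxA mulP; case: eqP => // _.
by rewrite mul0mx.
Qed.

Lemma dotv_P u v j : dotv (u *m P j) v = dotv (u *m P j) (v *m P j).
Proof.
have e : u *m P j *m P j = u *m P j by rewrite mulP eqxx.
by rewrite -{1}e dotv_mulmx PT.
Qed.

Lemma dotv_PA u v j : dotv (u *m P j *m A) (v *m P j *m A) = a_ j ^+ 2 * dotv (u *m P j) (v *m P j).
Proof.
by rewrite dotv_skew ?cc_A_skew // proj_sqr_row // dotvZr mulNr opprK.
Qed.

Lemma dotv_sum_P u v : dotv u v = \sum_j dotv (u *m P j) (v *m P j).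
Proof.
rewrite -{1}[u](sum_proj_row G_al) dotv_suml; apply: eq_bigr => j _; exact: dotv_P.
Qed.

Lemma rotation_P u lam j : rotation G al u lam 1 *m P j =
  cos (lam * a_ j) *: (u *m P j) + (sin (lam * a_ j) / a_ j) *: (u *m P j *m A).
Proof.
have gen (Q : 'I_k -> 'M[R]_(n.*2)) (f g : 'I_k -> R) :
    (forall u i j, u *m Q i *m Q j = if i == j then u *m Q i else 0) ->
    (forall u i j, u *m Q i *m A *m Q j = if i == j then u *m Q i *m A else 0) ->
    (\sum_i (f i *: (u *m Q i) + g i *: (u *m Q i *m A))) *m Q j =
    f j *: (u *m Q j) + g j *: (u *m Q j *m A).
  move=> QQ QAQ; rewrite mulmx_suml (bigD1 j) //= mulmxDl -!scalemxAl QQ QAQ eqxx.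
  rewrite big1 ?addr0 // => i ij; rewrite mulmxDl -!scalemxAl QQ QAQ (negbTE ij).
  by rewrite !scaler0 addr0.
have := gen (fun j => P j) (fun j => cos (lam * a_ j * 1)) (fun j => sin (lam * a_ j * 1) / a_ j)
  mulP mulPA.
by rewrite mulr1.
Qed.

Variable p : E.
Local Notation x := (xpart p).
Local Notation z := (zpart p).
Local Notation xc j := (xpart p *m P j).

(** The component u_j that the horizontal equation forces when [lam] is not resonant for j. *)
Definition psi lam j : V :=
  (lam * a_ j * sin (lam * a_ j) / (2 * (1 - cos (lam * a_ j)))) *: xc j - (lam / 2) *: (xc j *m A).

Lemma sin2E (t : R) : sin t ^+ 2 = 1 - cos t ^+ 2.
Proof. by rewrite -(cos2Dsin2 t) addrAC subrr add0r. Qed.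

Lemma psi_P lam j : psi lam j *m P j = psi lam j.
Proof. by rewrite mulmxBl -!scalemxAl mulP mulPA eqxx. Qed.

Lemma psi_P0 lam i j : i != j -> psi lam i *m P j = 0.
Proof. by move=> /negbTE ij; rewrite mulmxBl -!scalemxAl mulP mulPA ij !scaler0 subr0. Qed.

Lemma psi_eq lam j u : lam != 0 -> cos (lam * a_ j) != 1 ->
  lam *: (xc j *m A) = (cos (lam * a_ j) - 1) *: (u *m P j) +
    (sin (lam * a_ j) / a_ j) *: (u *m P j *m A) <-> u *m P j = psi lam j.
Proof.
move=> l0 c1; have a0 : a_ j != 0 by rewrite gt_eqF // a_gt0.
have c1' : 1 - cos (lam * a_ j) != 0 by rewrite subr_eq0 eq_sym.
have s2 := sin2E (lam * a_ j).
rewrite /psi; split=> H.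
  apply: (invert_vec l0 a0 c1' s2 (W := u *m P j *m A)) => //.
  have := congr1 (mulmx^~ A) H; rewrite /= mulmxDl -!scalemxAl !proj_sqr_row // !scalerA => H1.
  have -> : - (lam * a_ j ^+ 2) = lam * - a_ j ^+ 2 by ring.
  rewrite H1 -[in RHS]scaleNr; congr (_ + _).
  by congr (_ *: _); field.
apply: (invert_vec_back a0 c1' s2 H); rewrite H mulmxBl -!scalemxAl proj_sqr_row //.
by rewrite scalerA -scaleNr; congr (_ + _ *: _); field.
Qed.

(** The contribution of a non-resonant component to the vertical equation; it is here that [phi]
    appears. *)
Lemma psi_norm lam j : cos (lam * a_ j) != 1 ->
  dotv (psi lam j) (psi lam j) - dotv (psi lam j) (xc j) =
  2 * lam * (a_ j * dotv (xc j) (xc j) / 4 * phi (a_ j * lam)).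
Proof.
move=> c1; have c1' : 1 - cos (lam * a_ j) != 0 by rewrite subr_eq0 eq_sym.
rewrite /psi !(dotvBl, dotvBr, dotvZl, dotvZr) dotv_PA (dotvC (xc j *m A)) dotv_skew0 ?cc_A_skew //.
rewrite /phi [a_ j * lam]mulrC; have s2 := sin2E (lam * a_ j).
move: (dotv _ _) => X; move: (cos _) (sin _) c1' s2 => c s c1' s2.
apply/eqP; rewrite -subr_eq0; apply/eqP.
transitivity ((s ^+ 2 - (1 - c ^+ 2)) * (X * lam ^+ 2 * a_ j ^+ 2 / (2 * (1 - c)) ^+ 2)).
  by field.
by rewrite s2 subrr mul0r.
Qed.

Definition resonant lam j := cos (lam * a_ j) == 1.
Definition Jset : pred 'I_k := fun j => xc j != 0.
Definition weight j := a_ j * dotv (xc j) (xc j) / 4.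
Local Notation F := (Fsum Jset weight (fun j => a_ j)).
Definition res_norm lam u := \sum_(j | resonant lam j) dotv (u *m P j) (u *m P j).

Lemma horizontalP lam u : lam != 0 ->
  lam *: (x *m A) = rotation G al u lam 1 - u <->
  forall j, if resonant lam j then xc j = 0 else u *m P j = psi lam j.
Proof.
move=> l0.
have split_eq : lam *: (x *m A) = rotation G al u lam 1 - u <->
    forall j, lam *: (xc j *m A) = (cos (lam * a_ j) - 1) *: (u *m P j) +
      (sin (lam * a_ j) / a_ j) *: (u *m P j *m A).
  have E1 j : (lam *: (x *m A)) *m P j = lam *: (xc j *m A).
    by rewrite -scalemxAl -mulmxA PA mulmxA.
  have E2 j : (rotation G al u lam 1 - u) *m P j = (cos (lam * a_ j) - 1) *: (u *m P j) +
      (sin (lam * a_ j) / a_ j) *: (u *m P j *m A).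
    by rewrite mulmxBl rotation_P scalerBl scale1r addrAC.
  split=> [H j|H]; first by rewrite -E1 H E2.
  rewrite -[LHS](sum_proj_row G_al) -[RHS](sum_proj_row G_al); apply: eq_bigr => j _.
  by rewrite E1 E2 H.
have one j : lam *: (xc j *m A) = (cos (lam * a_ j) - 1) *: (u *m P j) +
      (sin (lam * a_ j) / a_ j) *: (u *m P j *m A) <->
    if resonant lam j then xc j = 0 else u *m P j = psi lam j.
  rewrite /resonant; case: eqP => [c1|/eqP c1]; last exact: psi_eq.
  have s0 : sin (lam * a_ j) = 0.
    by apply/eqP; rewrite -sqrf_eq0 sin2E c1 expr1n subrr.
  rewrite c1 s0 subrr mul0r !scale0r addr0; split=> [|->]; last by rewrite mul0mx scaler0.
  move/eqP; rewrite scaler_eq0 (negbTE l0) => /eqP xA0.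
  by apply: (can_inj (mulmxK (cc_A_nondeg G))); rewrite xA0 mul0mx.
split=> [/split_eq H j|H]; first exact: (one j).1 (H j).
by apply/split_eq => j; exact: (one j).2 (H j).
Qed.

Lemma GammaP_lam eta : zpart eta != 0 ->
  Gamma G p eta <->
  [/\ forall j, resonant (zpart eta) j -> xc j = 0,
      forall j, ~~ resonant (zpart eta) j -> xpart eta *m P j = psi (zpart eta) j &
      2 * zpart eta * (z - F (zpart eta)) = res_norm (zpart eta) (xpart eta)].
Proof.
move=> l0; set lam := zpart eta in l0 *; set u := xpart eta.
have main : (forall j, if resonant lam j then xc j = 0 else u *m P j = psi lam j) ->
    dotv u u - dotv u x = 2 * lam * F lam + res_norm lam u.
  move=> H; rewrite !(dotv_sum_P u) -sumrB (bigID (resonant lam)) /= addrC; congr (_ + _).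
    rewrite mulr_sumr [RHS]big_mkcond [LHS]big_mkcond; apply: eq_bigr => j _.
    have := H j; case: ifP => // rj Hj /=.
      by rewrite /Jset Hj eqxx.
    rewrite Hj psi_norm; last by rewrite -/(resonant lam j) rj.
    rewrite /Jset /weight; case: eqP => //= ->.
    by rewrite dot0v mulr0 !mul0r mulr0.
  apply: eq_bigr => j rj; have := H j; rewrite rj => ->.
  by rewrite [dotv _ 0]dotvC dot0v subr0.
rewrite /Gamma /=; split.
  move=> /(exp_mapP G_al)[[/eqP]|[_ [/(horizontalP _ l0) H ver]]]; first by rewrite (negbTE l0).
  split.
  - by move=> j rj; have := H j; rewrite -/lam rj.
  - by move=> j rj; have := H j; rewrite -/lam (negbTE rj).
  - by rewrite mulrBr ver (main H) addrAC subrr add0r.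
move=> [H1 H2 H3]; have H j : if resonant lam j then xc j = 0 else u *m P j = psi lam j.
  by case: ifP => rj; [exact: H1 | apply: H2; rewrite rj].
apply/(exp_mapP G_al); right; split=> //; split; first exact/horizontalP.
by rewrite -/lam -/u (main H) -H3; ring.
Qed.

Lemma GammaP_0 eta : zpart eta = 0 -> Gamma G p eta <-> x = xpart eta /\ z = 0.
Proof.
move=> l0; rewrite /Gamma /=; split.
  by move=> /(exp_mapP G_al)[[_ //]|[]]; rewrite l0 eqxx.
by move=> H; apply/(exp_mapP G_al); left.
Qed.

Hypothesis x0 : x != 0.

Lemma Jset_ex : exists j, Jset j.
Proof.
apply/existsP; apply: contraNT x0; rewrite negb_exists => /forallP H.
rewrite -[x](sum_proj_row G_al) big1 // => j _.
by have := H j; rewrite negbK => /eqP.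
Qed.

Lemma weight_gt0 j : Jset j -> 0 < weight j.
Proof.
move=> Jj; rewrite /weight divr_gt0 // mulr_gt0 ?a_gt0 // lt_neqAle dotv_ge0 andbT eq_sym.
by apply: contraNneq Jj => /dotv_eq0 ->.
Qed.

Lemma Fodd lam : F (- lam) = - F lam.
Proof. by rewrite /Fsum -sumrN; apply: eq_bigr => j _; rewrite mulrN phiN mulrN. Qed.

Lemma F_gt0 mu : 0 < mu -> (forall j, Jset j -> cos (a_ j * mu) != 1) -> 0 < F mu.
Proof.
move=> mu0 nr; have [j0 Jj0] := Jset_ex.
have pos j : Jset j -> 0 < weight j * phi (a_ j * mu).
  by move=> Jj; rewrite mulr_gt0 ?weight_gt0 // phi_gt0 ?nr // mulr_gt0 // a_gt0.
rewrite /Fsum (bigD1 j0) //= ltr_wpDr ?pos // sumr_ge0 // => j /andP[Jj _].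
exact/ltW/pos.
Qed.

Lemma res_norm_ge0 lam u : 0 <= res_norm lam u.
Proof. by apply: sumr_ge0 => j _; exact: dotv_ge0. Qed.

(** As F is odd, and positive on positive non-resonant arguments, while the residual norm is
    nonnegative, lam z is positive; so the equations can be written with |lam| and |z|. *)
Lemma Gamma_lam_sign eta : zpart eta != 0 -> Gamma G p eta ->
  [/\ 0 < zpart eta * z, forall j, Jset j -> cos (a_ j * `|zpart eta|) != 1,
      F `|zpart eta| <= `|z| &
      2 * `|zpart eta| * (`|z| - F `|zpart eta|) = res_norm (zpart eta) (xpart eta)].
Proof.
move=> l0 /(GammaP_lam l0); set lam := zpart eta in l0 *; move=> [H1 H2 H3].
have nr j : Jset j -> cos (a_ j * `|lam|) != 1.
  move=> Jj; rewrite -[a_ j]gtr0_norm ?a_gt0 // -normrM cos_norm mulrC.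
  by apply: contraNN Jj => /H1 ->.
have mu0 : 0 < `|lam| by rewrite normr_gt0.
have F0 := F_gt0 mu0 nr.
have lF : lam * F lam = `|lam| * F `|lam|.
  case: (ltgtP lam 0) l0 => // l0 _; last by rewrite gtr0_norm.
  by rewrite ltr0_norm // Fodd mulrNN.
have E : 2 * (lam * z - `|lam| * F `|lam|) = res_norm lam (xpart eta).
  by rewrite -lF -H3; ring.
have r0 := res_norm_ge0 lam (xpart eta).
have lz : `|lam| * F `|lam| <= lam * z.
  by rewrite -subr_ge0 -(pmulr_rge0 _ (ltr0Sn R 1)) E.
have lz0 : 0 < lam * z by apply: lt_le_trans lz; rewrite mulr_gt0.
have lzE : lam * z = `|lam| * `|z| by rewrite -normrM gtr0_norm.
split=> //; first by rewrite -(ler_pM2l mu0) -lzE.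
by rewrite -E lzE; ring.
Qed.

End geodesics.

Lemma zpart_continuous (R : realType) n : continuous (@zpart R n).
Proof.
have -> : @zpart R n = (fun q => q 0 (rshift n.*2 ord0)).
  by apply/funext => q; rewrite /zpart mxE.
exact: coord_continuous.
Qed.

Lemma row_mulmx_continuous (R : realType) (T : topologicalType) m k (B : 'M[R]_(m, k))
    (w : T -> 'rV[R]_m) : continuous w -> continuous (fun t => w t *m B).
Proof.
move=> wc; apply: continuous_row => i.
have -> : (fun t => (w t *m B) 0 i) = (fun t => \sum_j w t 0 j * B j i).
  by apply/funext => t; rewrite mxE.
apply: (@continuous_sum R T R^o) => j; apply: continuousM_real; last exact: cst_continuous.
move=> t; apply: (@continuous_comp _ _ _ w (fun M : 'rV[R]_m => M 0 j)); first exact: wc.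
exact: coord_continuous.
Qed.

Lemma coord_comp_continuous (R : realType) (T : topologicalType) m (w : T -> 'rV[R]_m) i :
  continuous w -> continuous (fun t => w t 0 i).
Proof.
move=> wc t; apply: (@continuous_comp _ _ _ w (fun M : 'rV[R]_m => M 0 i)); first exact: wc.
exact: coord_continuous.
Qed.

(** * Homology of the fibers *)

Section fibers.
Variables (R : realType) (n k : nat) (G : contactCarnot R n) (al : k.-tuple R).
Hypothesis G_al : distinct_singular_values (cc_A G) al.
Variable p : 'rV[R]_(n.*2 + 1).
Hypothesis x0 : xpart p != 0.
Local Notation A := (cc_A G).
Local Notation E := 'rV[R]_(n.*2 + 1).
Local Notation P j := (sv_proj (cc_A G) (tnth al j)).
Local Notation a_ j := (tnth al j).
Local Notation V := 'rV[R]_(n.*2).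
Local Notation X := (set_type (Gamma G p)).
Local Notation z := (zpart p).
Local Notation F := (Fsum (Jset G al p) (weight G al p) (fun j => a_ j)).
Local Notation psi := (psi G al p).
Local Notation resonant := (resonant al).
Implicit Types (lam : R) (u v : V).

Definition lam_of (y : X) : R := zpart (val y).

Lemma lam_of_continuous : continuous lam_of.
Proof.
move=> y; apply: (@continuous_comp _ _ _ (val : X -> E) (@zpart R n)).
  exact: val_continuous.
exact: zpart_continuous.
Qed.

Definition fiber lam : set X := lam_of @^-1` [set lam].

Lemma val_Gamma (y : X) : Gamma G p (val y). Proof. exact: set_valP. Qed.

(** When F |lam| = |z| nothing is left for the resonant components, which vanish; the others are
    forced to be [psi]. *)
Lemma fiber_unique (eta eta' : E) : Gamma G p eta -> Gamma G p eta' -> zpart eta = zpart eta' ->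
  (zpart eta != 0 -> F `|zpart eta| = `|z|) -> eta = eta'.
Proof.
move=> He He' ll Fz; apply: rowP_xz => //.
have [l0|l0] := eqVneq (zpart eta) 0.
  have l0' : zpart eta' = 0 by rewrite -ll.
  have [<- _] := (GammaP_0 G_al p l0).1 He.
  by have [<- _] := (GammaP_0 G_al p l0').1 He'.
have l0' : zpart eta' != 0 by rewrite -ll.
have [_ H2 _] := (GammaP_lam G_al p l0).1 He.
have [_ H2' _] := (GammaP_lam G_al p l0').1 He'.
have [_ _ _ H3] := Gamma_lam_sign G_al x0 l0 He.
have [_ _ _ H3'] := Gamma_lam_sign G_al x0 l0' He'.
move: H3 H3'; rewrite -ll (Fz l0) subrr mulr0 => /esym r0 /esym r0'.
rewrite -[LHS](sum_proj_row G_al) -[RHS](sum_proj_row G_al); apply: eq_bigr => j _.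
have [rj|rj] := boolP (resonant (zpart eta) j); last by rewrite H2 // H2' -?ll.
have zero (u : V) : res_norm G al (zpart eta) u = 0 -> u *m P j = 0.
  move=> r; apply: dotv_eq0.
  exact: (psumr_eq0P (fun i _ => dotv_ge0 (u *m P i)) r (i := j) rj).
by rewrite !zero.
Qed.

Lemma point_fiber lam (y : X) m : fiber lam y -> (lam != 0 -> F `|lam| = `|z|) ->
  homology_le R (fiber lam) m (m == 0%N).
Proof.
move=> ly Fz; have -> : fiber lam = [set y]; last exact: point_homology.
apply/seteqP; split=> [y' ly'|_ -> //]; apply: val_inj.
apply: fiber_unique; try exact: val_Gamma; first by rewrite [LHS]ly' [RHS]ly.
by rewrite [zpart _]ly'.
Qed.

Section sphere.
Variables (lam : R) (y0 : X).
Hypotheses (y0lam : fiber lam y0) (lam0 : lam != 0) (Flt : F `|lam| < `|z|).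

(** Data of the sphere: [Q] projects on the sum of the resonant subspaces, the rows of [B] are a
    basis of it, [rho] is the squared radius and [u0] the center. *)
Let Q : 'M[R]_(n.*2) := \sum_(j | resonant lam j) P j.
Let B := row_base Q.
Let rho : R := 2 * `|lam| * (`|z| - F `|lam|).
Let u0 : V := \sum_(j | ~~ resonant lam j) psi lam j.

Lemma rho_gt0 : 0 < rho.
Proof. by rewrite mulr_gt0 ?mulr_gt0 ?normr_gt0 // subr_gt0. Qed.

Lemma mulQP u j : u *m Q *m P j = if resonant lam j then u *m P j else 0.
Proof.
rewrite /Q mulmx_sumr mulmx_suml; case: ifP => rj.
  rewrite (bigD1 j) //= mulP // eqxx big1 ?addr0 // => i /andP[_ ij].
  by rewrite mulP // (negbTE ij).
rewrite big1 // => i ri; rewrite mulP //; case: eqP => // ij.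
by move: ri; rewrite ij rj.
Qed.

Lemma mulPQ u j : u *m P j *m Q = if resonant lam j then u *m P j else 0.
Proof.
rewrite /Q mulmx_sumr; case: ifP => rj.
  rewrite (bigD1 j) //= mulP // eqxx big1 ?addr0 // => i /andP[_ ij].
  by rewrite mulP // eq_sym (negbTE ij).
rewrite big1 // => i ri; rewrite mulP //; case: eqP => // ij.
by move: ri; rewrite -ij rj.
Qed.

Lemma mulQQ u : u *m Q *m Q = u *m Q.
Proof.
have -> : u *m Q *m Q = \sum_(j | resonant lam j) u *m Q *m P j by rewrite -mulmx_sumr.
by rewrite [RHS]mulmx_sumr; apply: eq_bigr => j rj; rewrite mulQP rj.
Qed.

Lemma normQ u : dotv (u *m Q) (u *m Q) = res_norm G al lam u.
Proof.
rewrite (dotv_sum_P G_al) /res_norm [RHS]big_mkcond; apply: eq_bigr => j _.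
by rewrite mulQP; case: ifP => // _; rewrite dot0v.
Qed.

Lemma BQ (w : 'rV[R]_(\rank Q)) : exists v, w *m B = v *m Q.
Proof.
exists (w *m B *m pinvmx Q); rewrite mulmxKpV //.
by rewrite (submx_trans (submxMl _ _)) // eq_row_base.
Qed.

Lemma wB_gt0 (w : 'rV[R]_(\rank Q)) : w != 0 -> 0 < dotv (w *m B) (w *m B).
Proof.
move=> w0; rewrite lt_neqAle dotv_ge0 andbT eq_sym; apply: contraNneq w0 => /dotv_eq0 wB.
by apply/eqP; apply: (row_free_inj (row_base_free Q)); rewrite /= mul0mx.
Qed.

Definition sphere_dir (w : 'rV[R]_(\rank Q)) : V :=
  (Num.sqrt rho / Num.sqrt (dotv (w *m B) (w *m B))) *: (w *m B).

Definition sphere_map (w : 'rV[R]_(\rank Q)) : E := mk_pt (u0 + sphere_dir w) lam.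

Lemma sphere_dir_norm w : w != 0 -> dotv (sphere_dir w) (sphere_dir w) = rho.
Proof.
move=> w0; have w1 := wB_gt0 w0; rewrite /sphere_dir dotvZl dotvZr mulrA -expr2.
rewrite exprMn exprVn !sqr_sqrtr ?(ltW w1) ?(ltW rho_gt0) //.
by rewrite mulfVK // gt_eqF.
Qed.

Lemma sphere_map_Gamma w : w != 0 -> Gamma G p (sphere_map w).
Proof.
move=> w0; have zl : zpart (sphere_map w) = lam by rewrite zpart_mk.
have l0' : zpart (sphere_map w) != 0 by rewrite zl.
have ly : zpart (val y0) = lam by exact: y0lam.
have ly0 : zpart (val y0) != 0 by rewrite ly.
(* The geodesic [y0] supplies what depends on [lam] alone: x_j = 0 at resonant indices, and the
   value of the residual norm. *)
have [K1 _ K3] := (GammaP_lam G_al p ly0).1 (val_Gamma y0).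
have [_ _ _ K4] := Gamma_lam_sign G_al x0 ly0 (val_Gamma y0).
rewrite !ly in K1 K3 K4.
have [v vE] := BQ w.
apply/(GammaP_lam G_al p l0'); rewrite zl xpart_mk; split=> // [j rj|].
  rewrite mulmxDl /sphere_dir vE -scalemxAl mulQP (negbTE rj) scaler0 addr0 /u0 mulmx_suml.
  have H i : psi lam i *m P j = if i == j then psi lam j else 0.
    by case: (eqVneq i j) => [->|ij]; [exact: (psi_P G_al) | exact: (psi_P0 G_al)].
  rewrite (eq_bigr _ (fun i _ => H i)); move: (psi lam j) => v'.
  by rewrite (bigD1 j rj) /= eqxx big1 ?addr0 // => i /andP[_ /negbTE ->].
rewrite K3 -K4 -normQ mulmxDl.
have -> : u0 *m Q = 0.
  rewrite /u0 mulmx_suml big1 // => j rj.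
  have := mulPQ (psi lam j) j; rewrite (negbTE rj) => <-.
  by congr (_ *m _); rewrite (psi_P G_al p lam j).
have -> : sphere_dir w *m Q = sphere_dir w by rewrite /sphere_dir vE -scalemxAl mulQQ.
by rewrite add0r sphere_dir_norm.
Qed.

Lemma sphere_map_continuous (T : topologicalType) (w : T -> 'rV[R]_(\rank Q)) :
  continuous w -> (forall t, w t != 0) -> continuous (fun t => sphere_map (w t)).
Proof.
move=> wc w0.
have wBc : continuous (fun t => w t *m B) by exact: row_mulmx_continuous.
have nc : continuous (fun t => dotv (w t *m B) (w t *m B)).
  apply: (@continuous_sum R T R^o) => i.
  by apply: continuousM_real; exact: (@coord_comp_continuous _ _ _ (fun t => w t *m B)).
have cc : continuous (fun t => Num.sqrt rho / Num.sqrt (dotv (w t *m B) (w t *m B))).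
  apply: continuousM_real; first exact: cst_continuous.
  apply: continuousV_real => t; first by rewrite gt_eqF // sqrtr_gt0 wB_gt0.
  apply: (@continuous_comp _ _ _ (fun t => dotv (w t *m B) (w t *m B)) Num.sqrt); first exact: nc.
  exact: sqrt_continuous.
apply: continuous_row => a; case: (splitP a) => [i Ea|i Ea].
  have -> : a = lshift 1 i by exact: val_inj.
  have -> : (fun t => sphere_map (w t) 0 (lshift 1 i)) = (fun t => u0 0 i +
      Num.sqrt rho / Num.sqrt (dotv (w t *m B) (w t *m B)) * (w t *m B) 0 i).
    by apply/funext => t; rewrite row_mxEl [LHS]mxE [X in _ + X]mxE.
  apply: continuousD_real; first exact: cst_continuous.
  by apply: continuousM_real => //; exact: (@coord_comp_continuous _ _ _ (fun t => w t *m B)).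
have -> : a = rshift n.*2 ord0 by apply: val_inj => /=; rewrite Ea (ord1 i).
have -> : (fun t => sphere_map (w t) 0 (rshift n.*2 ord0)) = cst lam.
  by apply/funext => t; rewrite row_mxEr mxE eqxx mulr1n.
exact: cst_continuous.
Qed.

Definition sphere_coord (y : X) : 'rV[R]_(\rank Q) := xpart (val y) *m (Q *m pinvmx B).

Lemma sphere_coordB y : sphere_coord y *m B = xpart (val y) *m Q.
Proof.
by rewrite /sphere_coord mulmxA mulmxKpV // eq_row_base submxMl.
Qed.

Lemma fiber_norm y : fiber lam y -> dotv (xpart (val y) *m Q) (xpart (val y) *m Q) = rho.
Proof.
move=> ly; have ly' : zpart (val y) = lam by exact: ly.
have l0 : zpart (val y) != 0 by rewrite ly'.
have [_ _ _ K4] := Gamma_lam_sign G_al x0 l0 (val_Gamma y).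
by rewrite normQ -{1}ly' -K4 ly'.
Qed.

Lemma sphere_coord_neq0 y : fiber lam y -> sphere_coord y != 0.
Proof.
move=> ly; apply/eqP => y00; have := fiber_norm ly.
rewrite -sphere_coordB y00 mul0mx dot0v => r0.
by have := rho_gt0; rewrite -r0 ltxx.
Qed.

Lemma sphere_mapK y : fiber lam y -> sphere_map (sphere_coord y) = val y.
Proof.
move=> ly; have ly' : zpart (val y) = lam by exact: ly.
have l0 : zpart (val y) != 0 by rewrite ly'.
have [_ K2 _] := (GammaP_lam G_al p l0).1 (val_Gamma y).
apply: rowP_xz; rewrite ?zpart_mk ?xpart_mk //.
rewrite /sphere_dir sphere_coordB fiber_norm // divff ?scale1r; last first.
  by rewrite gt_eqF // sqrtr_gt0 rho_gt0.
rewrite -[RHS](sum_proj_row G_al) [RHS](bigID (resonant lam)) /= [RHS]addrC; congr (_ + _).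
  by apply: eq_bigr => j rj; rewrite K2 ly'.
by rewrite /Q mulmx_sumr.
Qed.

Lemma rank_gt0 : (0 < \rank Q)%N.
Proof.
rewrite lt0n; apply/eqP => r0; have := sphere_coord_neq0 y0lam.
move/eqP; apply; apply/rowP => i; exfalso.
by have := leq_ltn_trans (leq0n i) (ltn_ord i); rewrite lt0n => /eqP; apply.
Qed.

Lemma resonant_ex : exists j, resonant lam j.
Proof.
apply/existsP; have := rank_gt0; apply: contraLR; rewrite negb_exists => /forallP H.
rewrite -eqn0Ngt mxrank_eq0 /Q big1 // => j rj.
by move: (H j); rewrite rj.
Qed.

(** The sphere is a retract of a punctured linear space: coordinates of the resonant part one way,
    normalization to radius sqrt rho the other way. *)
Lemma sphere_fiber m : homology_le R (fiber lam) m ((m == 0%N) + (m == (\rank Q).-1)).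
Proof.
have rk : \rank Q = (\rank Q).-1.+1 by rewrite prednK // rank_gt0.
pose g (w : 'rV[R]_(\rank Q)) : X := insubd y0 (sphere_map w).
have gE w : w != 0 -> val (g w) = sphere_map w.
  by move=> w0; rewrite /g insubdK //; apply: mem_set; exact: sphere_map_Gamma.
apply: (@homology_le_retract R X 'rV[R]_(\rank Q) (fiber lam) [set w | w != 0] sphere_coord g).
- apply: continuous_good_on => y _.
  apply: (@row_mulmx_continuous R X _ _ (Q *m pinvmx B) (fun y => xpart (val y))) => y'.
  apply: (@continuous_comp _ _ _ (val : X -> E) (@xpart R n)); first exact: val_continuous.
  exact: continuous_lsubmx.
- move=> l s s0; apply: continuous_comp_initial.
  have -> : set_val \o (g \o s) = (fun t => sphere_map (s t)).
    by rewrite set_valE; apply/funext => t /=; rewrite gE //; exact: s0.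
  by apply: sphere_map_continuous; [exact: cts_fun | exact: s0].
- exact: sphere_coord_neq0.
- by move=> w w0; rewrite /fiber /= /lam_of gE // zpart_mk.
- move=> y ly; apply: val_inj; rewrite gE; first exact: sphere_mapK.
  exact: sphere_coord_neq0.
- move: (\rank Q) rk => r ->; exact: punctured_homology.
Qed.

End sphere.
End fibers.

(** * Counting geodesics *)

(** A duplicate-free list of maximal length exhausts [S]. *)
Lemma bounded_seq_finite (T : choiceType) (S : T -> Prop) (N : nat) :
  (forall s : seq T, uniq s -> (forall y, y \in s -> S y) -> (size s <= N)%N) ->
  exists2 L : seq T, uniq L & forall y, S y <-> y \in L.
Proof.
move=> SN.
pose Q m := `[< exists s : seq T, [/\ uniq s, size s = m & forall y, y \in s -> S y] >].
have Q0 : exists m, Q m by exists 0%N; apply/asboolP; exists [::].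
have QN m : Q m -> (m <= N)%N by move=> /asboolP[s [us <- Ss]]; exact: SN.
case: (ex_maxnP Q0 QN) => m /asboolP[L [uL szL SL]] maxm; exists L => // y.
split=> [Sy|]; last exact: SL.
apply: contrapT => /negP yL; have : Q m.+1.
  apply/asboolP; exists (y :: L); split; rewrite /= ?yL ?szL //.
  by move=> y'; rewrite inE => /predU1P[->|/SL].
by move=> /maxm; rewrite ltnn.
Qed.

Lemma sum_eq_le1 K d : (\sum_(0 <= m < K) (m == d) <= 1)%N.
Proof.
elim: K => [|K IH]; first by rewrite big_geq.
rewrite big_nat_recr //=; have [->|Kd] := eqVneq K d; last by rewrite addn0.
rewrite big_nat big1 // => m /andP[_ md].
by rewrite (ltn_eqF md).
Qed.

Section counting_geodesics.
Variables (R : realType) (n k : nat) (G : contactCarnot R n) (al : k.-tuple R).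
Hypothesis G_al : distinct_singular_values (cc_A G) al.
Variable p : 'rV[R]_(n.*2 + 1).
Hypothesis x0 : xpart p != 0.
Local Notation E := 'rV[R]_(n.*2 + 1).
Local Notation P j := (sv_proj (cc_A G) (tnth al j)).
Local Notation a_ j := (tnth al j).
Local Notation x := (xpart p).
Local Notation z := (zpart p).
Local Notation J := (Jset G al p).
Local Notation F := (Fsum J (weight G al p) (fun j => a_ j)).
Local Notation a1 := (head 0 al).
Local Notation ak := (last 0 al).

Lemma k_gt0 : (0 < k)%N.
Proof.
apply: (sv_count (cc_A_nondeg G) G_al); rewrite double_gt0; exact: (cc_n_gt0 G).
Qed.

Lemma sv_bounds j : a1 <= a_ j <= ak.
Proof.
have srt : sorted <=%R al by apply: sub_sorted (G_al.1) => u v /ltW.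
have sz := size_tuple al.
have mono := sorted_leq_nth le_trans lexx 0 srt.
have k0 := k_gt0.
rewrite -nth0 -nth_last (tnth_nth 0) !mono ?inE ?sz ?prednK //.
by rewrite -ltnS prednK.
Qed.

Lemma a1_gt0 : 0 < a1.
Proof.
have -> : a1 = a_ (Ordinal k_gt0) by rewrite (tnth_nth 0) nth0.
exact: (a_gt0 G_al).
Qed.

Lemma xx_gt0 : 0 < dotv x x.
Proof.
rewrite lt_neqAle dotv_ge0 andbT eq_sym; apply: contraNneq x0 => /dotv_eq0 ->.
by [].
Qed.

(** The solution mu of a1 (a1 mu - 1) |x|^2 / 8 = |z|, whose left side is the lower bound of F mu
    that follows from [phi_ge]. *)
Definition Lbound : R := 8 * `|z| / (a1 ^+ 2 * dotv x x) + a1^-1.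

Lemma Lbound_ge0 : 0 <= Lbound.
Proof.
rewrite addr_ge0 ?invr_ge0 ?(ltW a1_gt0) // divr_ge0 ?mulr_ge0 ?exprn_ge0 ?dotv_ge0 //;
  exact: ltW a1_gt0.
Qed.

Lemma Gamma_lam_bound eta : zpart eta != 0 -> Gamma G p eta -> `|zpart eta| <= Lbound.
Proof.
move=> l0 He; have [_ nr Fz _] := Gamma_lam_sign G_al x0 l0 He.
move: (`|_|) nr Fz (normr_gt0 (zpart eta)) => mu nr Fz; rewrite l0 => mu0.
have a10 := a1_gt0; have xx := xx_gt0.
(* Below 1 / a1 the lower bound of F is not positive, but the second term of [Lbound] suffices. *)
have [small|big] := leP mu a1^-1.
  apply: (le_trans small); rewrite lerDr; apply: divr_ge0; first exact: mulr_ge0.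
  by apply: mulr_ge0; [exact: sqr_ge0 | exact: ltW].
have big' : 0 < a1 * mu - 1 by rewrite subr_gt0 -ltr_pdivrMl // mulr1.
have lower : a1 * (a1 * mu - 1) / 8 * dotv x x <= F mu.
  rewrite (dotv_sum_P G_al) mulr_sumr (bigID J) /= [X in _ + X]big1 ?addr0; last first.
    by move=> j; rewrite negbK => /eqP ->; rewrite dot0v mulr0.
  apply: ler_sum => j Jj; rewrite /weight.
  have /andP[aj _] := sv_bounds j.
  have amu : 0 < a_ j * mu by rewrite mulr_gt0 // (a_gt0 G_al).
  have ph := phi_ge amu (nr j Jj).
  apply: (@le_trans _ _ (a_ j * dotv (x *m P j) (x *m P j) / 4 * ((a_ j * mu - 1) / 2))).
    have h1 : a1 * mu - 1 <= a_ j * mu - 1 by rewrite lerD2r ler_pM2r.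
    have h2 : a1 * (a1 * mu - 1) <= a_ j * (a_ j * mu - 1).
      by rewrite ler_pM // ?(ltW a10) // ltW.
    have d0 := dotv_ge0 (x *m P j).
    rewrite (_ : _ * _ / 4 * _ = a_ j * (a_ j * mu - 1) / 8 * dotv (x *m P j) (x *m P j)).
      by rewrite ler_wpM2r // ler_wpM2r // invr_ge0.
    by field.
  by rewrite ler_wpM2l // ltW // (weight_gt0 G_al).
have := le_trans lower Fz; rewrite /Lbound => h.
rewrite -lerBlDr ler_pdivlMr; last by rewrite mulr_gt0 // exprn_gt0.
have -> : (mu - a1^-1) * (a1 ^+ 2 * dotv x x) = 8 * (a1 * (a1 * mu - 1) / 8 * dotv x x).
  by field; rewrite gt_eqF.
by rewrite ler_wpM2l.
Qed.

Definition lam_set (lam : R) := exists2 eta : E, Gamma G p eta & zpart eta = lam.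

Definition point_type (lam : R) := (lam == 0) || (F `|lam| == `|z|).

Local Notation Ns := (Nsum (fun j => a_ j) Lbound).

(** Points are weighted by 1 and spheres by 2, the total Betti numbers that bound them. *)
Lemma lam_count (s : seq R) : uniq s -> (forall lam, lam \in s -> lam_set lam) ->
  (count point_type s + 2 * count (predC point_type) s <= 2 * (Ns J).+1 + 2 * Ns (predC J))%N.
Proof.
(* If z = 0, only lam = 0 occurs; if z <> 0, it cannot occur. *)
move=> us sS; have [z00|z00] := eqVneq z 0.
  have s0 lam : lam \in s -> lam = 0.
    move=> /sS[eta He le]; apply/eqP; apply: contraT; rewrite -le => l0.
    by have [] := Gamma_lam_sign G_al x0 l0 He; rewrite z00 mulr0 ltxx.
  have -> : count (predC point_type) s = 0%N.
    apply/eqP; rewrite -leqn0 leqNgt -has_count; apply/hasP => -[lam /s0 ->].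
    by rewrite /= /point_type eqxx.
  have : (count point_type s <= 1)%N.
    apply: leq_trans (count_size _ _) _.
    by apply: (@uniq_leq_size _ s [:: 0]) => // lam /s0 ->; rewrite mem_head.
  by rewrite muln0 addn0 => /leq_trans; apply; rewrite -[1%N]/(1 * 1)%N (leq_trans _ (leq_addr _ _)) // leq_mul.
have snz lam : lam \in s -> lam != 0.
  move=> /sS[eta He le]; apply: contraNneq z00 => l0.
  by have [_ ->] := (GammaP_0 G_al p (etrans le l0)).1 He.
have facts lam : lam \in s -> [/\ 0 < lam * z, 0 < `|lam|, `|lam| <= Lbound,
    forall j, J j -> cos (a_ j * `|lam|) != 1 & F `|lam| <= `|z|].
  move=> ls; have l0 := snz _ ls; have [eta He le] := sS _ ls.
  have l0' : zpart eta != 0 by rewrite le.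
  have [h1 h2 h3 _] := Gamma_lam_sign G_al x0 l0' He.
  have h4 := Gamma_lam_bound l0' He.
  by rewrite le in h1 h2 h3 h4; split=> //; rewrite normr_gt0.
have inj : {in s &, injective (fun lam : R => `|lam|)}.
  move=> l1 l2 /facts[h1 _ _ _ _] /facts[h2 _ _ _ _] /eqP; rewrite eqr_norm2 => /orP[/eqP //|/eqP e].
  by move: h1; rewrite e mulNr oppr_gt0 => /(lt_trans h2); rewrite ltxx.
have uniq_abs (Q : pred R) : uniq [seq `|lam| | lam <- s & Q lam].
  rewrite map_inj_in_uniq; first exact: filter_uniq.
  move=> l1 l2; rewrite !mem_filter => /andP[_ h1] /andP[_ h2]; exact: inj.
have c1 : (count point_type s <= 2 * (Ns J).+1)%N.
  rewrite -size_filter -(size_map (fun lam : R => `|lam|)).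
  apply: (@Fsum_count R k J (weight G al p) (fun j => a_ j) (@weight_gt0 _ _ _ _ _ G_al p)
    (a_gt0 G_al) (Jset_ex G_al x0) Lbound `|z| Lbound_ge0 _ (uniq_abs point_type)).
  move=> _ /mapP[lam + ->]; rewrite mem_filter => /andP[pt ls].
  have [_ h2 h3 h4 _] := facts _ ls; split=> //.
  by move: pt; rewrite /point_type (negbTE (snz _ ls)) => /eqP.
(* A sphere has a resonant index j, for which x_j = 0, so |lam| is a pole of j. *)
have c2 : (count (predC point_type) s <= Ns (predC J))%N.
  rewrite -size_filter -(size_map (fun lam : R => `|lam|)).
  pose D := flatten [seq poles (fun j => a_ j) Lbound j | j <- enum (predC J)].
  have -> : Ns (predC J) = size D.
    rewrite size_flatten /shape -map_comp sumnE big_map /Nsum -big_enum /=.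
    by apply: eq_bigr => j _; rewrite size_poles.
  apply: uniq_leq_size => // _ /mapP[lam + ->]; rewrite mem_filter /= => /andP[pt ls].
  have [_ h2 h3 h4 h5] := facts _ ls; have [eta He le] := sS _ ls.
  have l0 := snz _ ls.
  have Flt : F `|lam| < `|z|.
    by rewrite lt_neqAle h5 andbT; move: pt; rewrite /point_type (negbTE l0).
  have yl : fiber lam (SigSub (mem_set He) : set_type (Gamma G p)) by exact: le.
  have [j rj] := resonant_ex G_al x0 yl l0 Flt.
  have l0' : zpart eta != 0 by rewrite le.
  have [K1 _ _] := (GammaP_lam G_al p l0').1 He; rewrite le in K1.
  apply/flatten_mapP; exists j.
    by rewrite mem_enum inE /= /Jset (K1 j rj) eqxx.
  apply: mem_poles => //; first exact: a_gt0 G_al.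
    exact: Lbound_ge0.
  rewrite -[a_ j]gtr0_norm ?(a_gt0 G_al) // -normrM cos_norm mulrC.
  exact/eqP.
by rewrite leq_add // leq_mul.
Qed.

(** The expansion of 2 N + 2 with N replaced by k [Lbound] ak / (2 pi), a bound for the total number
    of poles. *)
Definition geodesic_bound : R := 8 * k%:R / pi * (ak / a1 ^+ 2) * (`|z| / dotv x x) +
  (k%:R / pi * (ak / a1) + 2).

Lemma lam_count_bound : (2 * (Ns J).+1 + 2 * Ns (predC J))%:R <= geodesic_bound.
Proof.
have -> : (2 * (Ns J).+1 + 2 * Ns (predC J) = 2 * Ns xpredT + 2)%N.
  have -> : Ns xpredT = (Ns J + Ns (predC J))%N by rewrite /Nsum (bigID J).
  by rewrite mulnS mulnDr addnC addnA addnC addnA.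
have a10 := a1_gt0; have pi0 := @pi_gt0 R.
have h : (Ns xpredT)%:R <= k%:R * (Lbound * ak / (pi *+ 2)).
  rewrite /Nsum natr_sum; apply: (@le_trans _ _ (\sum_(j < k) Lbound * ak / (pi *+ 2))).
    apply: ler_sum => j _.
    apply: le_trans (npoles_le (a_gt0 G_al) Lbound_ge0 j) _.
    apply: ler_wpM2r; first by rewrite invr_ge0 mulrn_wge0 // ltW.
    by apply: ler_wpM2l; [exact: Lbound_ge0 | have /andP[] := sv_bounds j].
  by rewrite sumr_const card_ord mulr_natl.
rewrite natrD natrM; apply: (@le_trans _ _ (2 * (k%:R * (Lbound * ak / (pi *+ 2))) + 2)).
  by rewrite lerD2r ler_wpM2l.
rewrite le_eqVlt; apply/orP; left; apply/eqP; rewrite /geodesic_bound /Lbound -mulr_natr.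
have xx := xx_gt0; move: pi pi0 {h} => c c0; field.
by rewrite !gt_eqF.
Qed.

Definition fiber_dim (lam : R) := (\rank (\sum_(j | resonant al lam j) P j)%R).-1.

Definition fiber_rank (lam : R) m : nat :=
  if point_type lam then (m == 0%N) : nat else ((m == 0%N) + (m == fiber_dim lam))%N.

Lemma fiber_homology lam m : lam_set lam -> homology_le R (@fiber R n G p lam) m (fiber_rank lam m).
Proof.
move=> [eta He le].
have yl : fiber lam (SigSub (mem_set He) : set_type (Gamma G p)) by exact: le.
rewrite /fiber_rank; case: ifP => pt.
  apply: (point_fiber G_al x0 yl) => l0.
  by move: pt; rewrite /point_type (negbTE l0) => /eqP.
have /norP[l0 Fne] : ~~ point_type lam by rewrite pt.
have l0' : zpart eta != 0 by rewrite le.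
have [_ _ h3 _] := Gamma_lam_sign G_al x0 l0' He; rewrite le in h3.
by apply: (sphere_fiber G_al x0 yl l0); rewrite lt_neqAle Fne.
Qed.

Lemma lam_list : exists2 L : seq R, uniq L & forall lam, lam_set lam <-> lam \in L.
Proof.
apply: (bounded_seq_finite (N := 2 * (Ns J).+1 + 2 * Ns (predC J))) => s us sS.
apply: leq_trans (lam_count us sS).
by rewrite -(count_predC point_type s) leq_add2l leq_pmull.
Qed.

Lemma hat_beta_le : (hat_beta G p <= geodesic_bound%:E)%E.
Proof.
have [L uL SL] := lam_list.
apply: (@le_trans _ _ ((2 * (Ns J).+1 + 2 * Ns (predC J))%:R%:E)); last first.
  by rewrite lee_fin lam_count_bound.
apply: (total_betti_le (rk := fun m => (\sum_(lam <- L) fiber_rank lam m)%N)) => [m|K].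
  have -> : [set: set_type (Gamma G p)] = @lam_of R n G p @^-1` [set` L].
    apply/seteqP; split=> // y _ /=; apply/SL; exists (val y) => //; exact: val_Gamma.
  apply: homology_le_fibers => //; first exact: lam_of_continuous.
  by move=> lam /SL; exact: fiber_homology.
(* Summed over degrees first, each fiber contributes at most its weight in [lam_count], whatever the
   dimension of the sphere. *)
rewrite exchange_big /=; apply: leq_trans (lam_count uL (fun lam => (SL lam).2)).
rewrite -!sum1_count big_distrr /= [in X in (_ <= X)%N]big_mkcond [X in (_ <= _ + X)%N]big_mkcond /=.
rewrite -big_split /=; apply: leq_sum => lam _; rewrite /fiber_rank.
case: (point_type lam); first exact: sum_eq_le1.
by rewrite big_split /=; exact: (leq_add (sum_eq_le1 K 0) (sum_eq_le1 K _)).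
Qed.

(** Without vanishing components there is no resonance, hence no sphere: a geodesic is determined by
    its [lam]. *)
Lemma hat_nu_le : (forall j, component G al x j <> 0) -> (hat_nu G p <= geodesic_bound%:E)%E.
Proof.
move=> xj; have Jall j : J j by apply/eqP; exact: xj.
have pt eta : Gamma G p eta -> zpart eta != 0 -> F `|zpart eta| = `|z|.
  move=> He l0; have [_ _ _ h] := Gamma_lam_sign G_al x0 l0 He.
  have [K1 _ _] := (GammaP_lam G_al p l0).1 He.
  move: h; rewrite /res_norm big1 => [|j rj]; last by have := Jall j; rewrite /Jset (K1 j rj) eqxx.
  move/eqP; rewrite !mulf_eq0 normr_eq0 (negbTE l0) pnatr_eq0 /= subr_eq0 => /eqP.
  by [].
have bnd (s : seq E) : uniq s -> (forall eta, eta \in s -> Gamma G p eta) ->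
    (size s <= 2 * (Ns J).+1 + 2 * Ns (predC J))%N.
  move=> us sG; rewrite -(size_map (@zpart R n)).
  have ul : uniq [seq zpart eta | eta <- s].
    rewrite map_inj_in_uniq // => e1 e2 /sG He1 /sG He2 zz.
    by apply: (fiber_unique G_al x0 He1 He2 zz) => l0; exact: pt.
  have lS lam : lam \in [seq zpart eta | eta <- s] -> lam_set lam.
    by move=> /mapP[eta /sG He ->]; exists eta.
  apply: leq_trans (lam_count ul lS).
  by rewrite -(count_predC point_type) leq_add2l leq_pmull.
have [L uL GL] := bounded_seq_finite bnd.
apply: (@le_trans _ _ ((2 * (Ns J).+1 + 2 * Ns (predC J))%:R%:E)); last first.
  by rewrite lee_fin lam_count_bound.
(* The counting measure of an infinite set is infinite, so finiteness is settled first. *)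
rewrite /hat_nu /counting; case: asboolP => [fin|nfin]; last first.
  exfalso; apply: nfin; have -> : Gamma G p = [set` L] by apply/seteqP; split=> y /GL.
  exact: finite_seq.
rewrite lee_fin ler_nat; apply: bnd; first exact: finmap.fset_uniq.
by move=> eta; rewrite in_fset_set // inE.
Qed.

End counting_geodesics.

Theorem theorem23 (R : realType) (k : nat) :
  exists R2 : k.-tuple R -> R,
    (forall (c : R) (al : k.-tuple R),
       0 < c -> sorted <%R al -> all (fun a => 0 < a) al ->
       R2 (map_tuple ( *%R c) al) = R2 al) /\
    forall (n : nat) (G : contactCarnot R n) (al : k.-tuple R),
      distinct_singular_values (cc_A G) al ->
      forall p : 'rV[R]_(n.*2 + 1), p <> 0 ->
        (hat_beta G p <=
           (8 * k%:R / pi * (last 0 al / head 0 al ^+ 2))%:E * zx_ratio p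
           + (R2 al)%:E)%E /\
        ((forall j : 'I_k, component G al (xpart p) j <> 0) ->
           Gamma G p = Gamma0 G al p /\
           (hat_nu G p <=
              (8 * k%:R / pi * (last 0 al / head 0 al ^+ 2))%:E * zx_ratio p
              + (R2 al)%:E)%E).
Proof.
exists (fun al : k.-tuple R => k%:R / pi * (last 0 al / head 0 al) + 2); split.
  move=> c al c0 _ _; congr (_ * _ + _); rewrite /=.
  have -> : last 0 [seq c * i | i <- al] = c * last 0 al.
    (* The default value 0 is fixed by the scaling, so the empty tuple needs no separate
       treatment. *)
    by rewrite -{1}(mulr0 c) last_map.
  have -> : head 0 [seq c * i | i <- al] = c * head 0 al.
    by case: (tval al) => [|a s] /=; rewrite ?mulr0.
  by rewrite -mulf_div divff ?mul1r // gt_eqF.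
move=> n G al G_al p p0; have [x0|x0] := eqVneq (xpart p) 0.
  (* For x = 0 the ratio is infinite and its coefficient positive, so the bound is trivial; as k >
     0, the components of x cannot all be nonzero. *)
  have k0 := k_gt0 G_al; have a10 := a1_gt0 G_al.
  have ak0 : 0 < last 0 al.
    by have /andP[h1 h2] := sv_bounds G_al (Ordinal k0); exact: lt_le_trans (lt_le_trans a10 h1) h2.
  have C0 : 0 < 8 * k%:R / pi * (last 0 al / head 0 al ^+ 2).
    by rewrite mulr_gt0 // divr_gt0 ?exprn_gt0 ?mulr_gt0 ?ltr0n ?pi_gt0.
  rewrite /zx_ratio x0 eqxx mulry gtr0_sg // mul1e addye // !leey; split=> // xj.
  by case: (xj (Ordinal k0)); rewrite /component mul0mx.
have bE : ((8 * k%:R / pi * (last 0 al / head 0 al ^+ 2))%:E * zx_ratio p +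
    (k%:R / pi * (last 0 al / head 0 al) + 2)%:E)%E = (geodesic_bound al p)%:E.
  by rewrite /zx_ratio (negbTE x0).
split; first by rewrite bE; exact: hat_beta_le.
move=> xj; split; last by rewrite bE; exact: hat_nu_le.
apply/seteqP; split=> [eta He|eta []//]; split=> //=.
by rewrite big1 // => j /eqP /xj.
Qed.
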